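(* Let $D$ be an open subset of $\mathbb R^d$ with $\mathcal S(D)\subset\overline D$. Suppose that $u\in W^{2,p}_{\rm loc}(D)\cap C_b(\mathbb R^d)$ for some $p>d$ and that $\hat x\in D$ is a maximum point of $u$ in $D$. Then $$\liminf_{x\to\hat x}\operatorname{ess}\,Au(x)\le0.$$
   Context: **Operator.** $Au=Lu+Su$, where $$Lu(x)=\tfrac12\sum_{i,j=1}^d q_{i,j}(x)\partial^2_{x_i,x_j}u(x)+\sum_{i=1}^d b_i(x)\partial_{x_i}u(x),$$ $$Su(x)=\int_{\mathbb R^d}\Big(u(x+y)-u(x)-\sum_{i=1}^d\frac{y_i\partial_{x_i}u(x)}{1+|y|^2}\Big)N(x,dy).$$ Standing assumptions: $q_{i,j},b_i:\mathbb R^d\to\mathbb R$ are bounded and Borel measurable; for every compact $K\subset\mathbb R^d$ there is $\gamma_K>0$ with $\gamma_K|\xi|^2\le\sum_{i,j}q_{i,j}(x)\xi_i\xi_j$ for $x\in K$, $\xi\in\mathbb R^d$; for each $x$, $N(x,\cdot)$ is a $\sigma$-finite Borel measure on $\mathbb R^d$, $x\mapsto N(x,B)$ is Borel for each Borel $B$, and $\sup_x\int\min\{1,|y|^2\}N(x,dy)<\infty$. For $D$ open and $u\in W^{2,p}_{\rm loc}(D)\cap C_b(\mathbb R^d)$ with $p>d$, $Au$ is defined a.e. in $D$ by these formulas. **Notation.** $\mathcal S(D)=\bigcup_{x\in D}\{x+y:\,y\in\operatorname{supp}N(x,\cdot)\}$. For a measurable $f$ on $D$ and $x_0\in D$, $\liminf_{x\to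 x_0}\operatorname{ess}f(x):=\lim_{r\to0+}\operatorname{ess\,inf}_{B(x_0,r)}f$ (over balls $B(x_0,r)\subset D$). *)

(* Defs.v *)
From HB Require Import structures.
From mathcomp Require Import all_boot all_order all_algebra.
From mathcomp Require Import all_classical all_reals all_analysis.
From mathcomp Require Import measurable_realfun ess_sup_inf kernel.

Set Implicit Arguments.
Unset Strict Implicit.
Unset Printing Implicit Defensive.

Import Order.TTheory GRing.Theory Num.Theory.
Import numFieldNormedType.Exports.

Local Open Scope classical_set_scope.
Local Open Scope ring_scope.

(* Borel sigma-algebra of R^n *)
HB.instance Definition _ (R : realType) (n : nat) :=
  @isMeasurable.Build (sigma_display (@open 'rV[R]_n)) 'rV[R]_n
    <<s (@open 'rV[R]_n) >> (@sigma_algebra0 _ _ _)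
    (@sigma_algebraC _ _) (@sigma_algebra_bigcup _ _ _).

Section borel_rV.
Context {R : realType}.

Lemma measurable_open_rV n (U : set 'rV[R]_n) : open U -> measurable U.
Proof. by move=> oU; exact: sub_sigma_algebra. Qed.

Lemma continuous_measurable_rV m n (f : 'rV[R]_m -> 'rV[R]_n) :
  continuous f -> measurable_fun setT f.
Proof.
move=> /continuousP cf; apply: measurability; first exact: erefl.
move=> _ [U oU <-]; rewrite setTI; apply: measurable_open_rV; exact: cf.
Qed.

Lemma continuous_measurable_rV_R n (f : 'rV[R]_n -> R) :
  continuous f -> measurable_fun setT f.
Proof.
move=> /continuousP cf; apply: (measurability _ (RGenOpens.measurableE R)).
move=> _ [_ [a [b ->]] <-]; rewrite setTI; apply: measurable_open_rV.
exact/cf/itv_open.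
Qed.

Lemma open_bigcup_ball_rV n (U : set 'rV[R]_n) : open U ->
  U = \bigcup_(p in [set p : 'rV[rat]_n * nat |
         ball (map_mx ratr p.1 : 'rV[R]_n) p.2.+1%:R^-1 `<=` U])
        ball (map_mx ratr p.1 : 'rV[R]_n) p.2.+1%:R^-1.
Proof.
move=> oU; apply/seteqP; split => [x Ux|x [p pU /pU]//].
have /nbhs_ballP[e /= e0 eU] : nbhs x U by exact: open_nbhs_nbhs.
have [k ke] : exists k, k.+1%:R^-1 < e / 2.
  have := near_infty_natSinv_lt (PosNum (divr_gt0 e0 (ltr0n R 2))).
  by case=> k _ /(_ k (leqnn k)) /= ?; exists k.
have k0 : 0 < k.+1%:R^-1 :> R by rewrite invr_gt0.
have [q qx] : exists q : 'rV[rat]_n, forall j, ball (x 0 j) k.+1%:R^-1 (ratr (q 0 j) : R).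
  have H j : exists q : rat, ball (x 0 j) k.+1%:R^-1 (ratr q : R).
    have := @dense_rat R (ball (x 0 j) k.+1%:R^-1).
    case; [by exists (x 0 j); exact: ballxx|exact: ball_open|].
    by move=> y [yx [q _ qy]]; exists q; rewrite qy.
  have [f fH] := choice H.
  by exists (\row_j f j) => j; rewrite mxE.
have xq : ball (map_mx ratr q : 'rV[R]_n) k.+1%:R^-1 x.
  by split => // i j; rewrite mxE ord1; apply: ball_sym; exact: qx.
exists (q, k) => //= y qy; apply: eU.
rewrite [e]splitr; apply: (@ball_triangle R _ (map_mx ratr q : 'rV[R]_n)).
  by apply: ball_sym; exact: le_ball (ltW ke) _ xq.
exact: le_ball (ltW ke) _ qy.
Qed.

Lemma measurable_fun_rV d (T : measurableType d) n (f : T -> 'rV[R]_n) :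
  (forall j, measurable_fun setT (fun t => f t 0 j)) -> measurable_fun setT f.
Proof.
move=> mf; apply: measurability; first exact: erefl.
move=> _ [U oU <-]; rewrite setTI (open_bigcup_ball_rV oU) preimage_bigcup.
rewrite bigcup_mkcond; apply: countable_bigcupT_measurable => [|[q k]].
  exact: countableP.
case: ifPn => // _.
rewrite [X in measurable X](_ : _ = \big[setI/setT]_(j < n)
   ((fun t => f t 0 j) @^-1` ball (ratr (q 0 j) : R) k.+1%:R^-1)); last first.
  apply/seteqP; split=> t /=.
    by move=> [_ H]; rewrite -bigcap_seq => j _ /=; have := H 0 j; rewrite mxE.
  rewrite -bigcap_seq => H; split; first by rewrite invr_gt0.
  by move=> i j; rewrite mxE ord1; apply: H; rewrite /= mem_index_enum.
apply: bigsetI_measurable => j _; rewrite -[X in measurable X]setTI.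
by apply: mf => //; apply: open_measurable; exact: ball_open.
Qed.

End borel_rV.

Lemma sigma_finite_product_measure1 d1 d2 (T1 : measurableType d1)
    (T2 : measurableType d2) (R : realType)
    (m1 : {sigma_finite_measure set T1 -> \bar R})
    (m2 : {sigma_finite_measure set T2 -> \bar R}) :
  sigma_finite setT (m1 \x m2)%E.
Proof.
have /sigma_finiteP[F [TF ndF Foo]] := sigma_finiteT m1.
have /sigma_finiteP[G [TG ndG Goo]] := sigma_finiteT m2.
exists (fun n => F n `*` G n).
  rewrite -setXTT TF TG; apply/seteqP; split=> [[x y]|[x y] [n _ []/= ? ?]].
    move=> [/= [n _ Fnx] [k _ Gky]]; exists (maxn n k) => //; split.
    - by move: x Fnx; exact/subsetPset/ndF/leq_maxl.
    - by move: y Gky; exact/subsetPset/ndG/leq_maxr.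
  by split; exists n.
move=> k; have [? ?] := Foo k; have [? ?] := Goo k.
split; first exact: measurableX.
by rewrite product_measure1E// lte_mul_pinfty// ge0_fin_numE.
Qed.

Section sigma_finite_measure_of.
Context d (T : measurableType d) (R : realType).
Variable m : {measure set T -> \bar R}.
Hypothesis sf : sigma_finite setT m.

Let mf : set T -> \bar R := m.

HB.instance Definition _ := Measure.on mf.
HB.instance Definition _ := Measure_isSigmaFinite.Build _ _ _ mf sf.

Lemma sigma_finite_measure_of :
  exists mu : {sigma_finite_measure set T -> \bar R},
    (m : set T -> \bar R) = mu.
Proof. by exists mf. Qed.

End sigma_finite_measure_of.

Section lebesgue_rV.
Context {R : realType}.

Definition cons_rV n (p : R * 'rV[R]_n) : 'rV[R]_n.+1 :=
  row_mx p.1%:M p.2 : 'rV[R]_(1 + n).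

Lemma cons_rV0 n (p : R * 'rV[R]_n) : cons_rV p 0 ord0 = p.1.
Proof.
rewrite /cons_rV (_ : ord0 = lshift n (0 : 'I_1)); last exact/val_inj.
by rewrite (@row_mxEl _ 1 1 n) mxE eqxx mulr1n.
Qed.

Lemma cons_rVS n (p : R * 'rV[R]_n) k : cons_rV p 0 (lift ord0 k) = p.2 0 k.
Proof.
rewrite /cons_rV (_ : lift ord0 k = rshift 1 k); last exact/val_inj.
by rewrite (@row_mxEr _ 1 1 n).
Qed.

Definition uncons_rV n (x : 'rV[R]_n.+1) : R * 'rV[R]_n :=
  (x 0 0, rsubmx (x : 'rV[R]_(1 + n))).

Lemma cons_rVK n : cancel (@cons_rV n) (@uncons_rV n).
Proof.
by case=> a x; rewrite /uncons_rV; congr (_, _); [exact: cons_rV0|exact: row_mxKr].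
Qed.

Lemma uncons_rVK n : cancel (@uncons_rV n) (@cons_rV n).
Proof.
move=> x; rewrite /cons_rV /= -[RHS](@hsubmxK _ 1 1 n).
have -> // : (x 0 0)%:M = lsubmx (x : 'rV[R]_(1 + n)) :> 'M[R]_1.
apply/matrixP => i j; rewrite !ord1 !mxE eqxx mulr1n.
by congr (x _ _); exact/val_inj.
Qed.

(* Cavalieri: A |-> \int_t lebesgue_rV n [set v | A (t, v)] in dimension n.+1 *)
Fixpoint lebesgue_rV n : set 'rV[R]_n -> \bar R :=
  match n with
  | 0 => \d_(0 : 'rV[R]_0)
  | n'.+1 => pushforward (@lebesgue_measure R \x @lebesgue_rV n')%E
               (@cons_rV n')
  end.

Lemma measurable_cons_rV n : measurable_fun setT (@cons_rV n).
Proof.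
apply: measurable_fun_rV => j; case: (unliftP ord0 j) => [k|] ->.
  rewrite (_ : (fun _ => _) = (fun x : 'rV[R]_n => x 0 k) \o snd); last first.
    by apply/funext => p; rewrite cons_rVS.
  apply: measurableT_comp; last exact: measurable_snd.
  by apply: continuous_measurable_rV_R; exact: coord_continuous.
rewrite (_ : (fun _ => _) = fst); first exact: measurable_fst.
by apply/funext => p; rewrite cons_rV0.
Qed.

Lemma measurable_uncons_rV n : measurable_fun setT (@uncons_rV n).
Proof.
apply/measurable_fun_pairP; split.
  by apply: continuous_measurable_rV_R; exact: coord_continuous.
apply: measurable_fun_rV => j; apply: continuous_measurable_rV_R.
rewrite (_ : (fun _ => _) = (fun x : 'rV[R]_n.+1 => x 0 (rshift 1 j))).
  exact: coord_continuous.
by apply/funext => x; rewrite /= mxE.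
Qed.

Lemma lebesgue_rV_sigma_finite_measure n :
  exists mu : {sigma_finite_measure set 'rV[R]_n -> \bar R},
    @lebesgue_rV n = mu.
Proof.
elim: n => [|n [mu muE]]; first by exists \d_(0 : 'rV[R]_0).
have mc := @measurable_cons_rV n.
have [m0 m0E] : exists m0 : {measure set 'rV[R]_n.+1 -> \bar R},
    pushforward (@lebesgue_measure R \x mu)%E (@cons_rV n) = m0.
  by unshelve eexists (pushforward (@lebesgue_measure R \x mu)%E (@cons_rV n)
    : {measure set _ -> \bar R}).
have sf : sigma_finite setT m0.
  have [F FT mF] := sigma_finite_product_measure1 (@lebesgue_measure R) mu.
  exists (fun i => @uncons_rV n @^-1` F i).
    by rewrite -preimage_bigcup -FT preimage_setT.
  move=> i; have [mFi Fi] := mF i; split.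
    by rewrite -[X in measurable X]setTI; exact: measurable_uncons_rV.
  rewrite -m0E /= /pushforward -comp_preimage.
  by rewrite (_ : _ \o _ = id) // funeqE => x /=; exact: cons_rVK.
have [mu' mu'E] := sigma_finite_measure_of sf.
by exists mu'; rewrite /= muE -mu'E.
Qed.

Section lebesgue_rV_measure.
Variable n : nat.

Let leb0 : @lebesgue_rV n set0 = 0%E.
Proof. by have [mu ->] := lebesgue_rV_sigma_finite_measure n. Qed.

Let leb_ge0 A : (0 <= @lebesgue_rV n A)%E.
Proof. by have [mu ->] := lebesgue_rV_sigma_finite_measure n. Qed.

Let leb_sigma_additive : semi_sigma_additive (@lebesgue_rV n).
Proof.
have [mu ->] := lebesgue_rV_sigma_finite_measure n.
exact: measure_semi_sigma_additive.
Qed.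

HB.instance Definition _ := isMeasure.Build _ _ _ (@lebesgue_rV n)
  leb0 leb_ge0 leb_sigma_additive.

Let leb_sigma_finite : sigma_finite setT (@lebesgue_rV n).
Proof.
by have [mu ->] := lebesgue_rV_sigma_finite_measure n; exact: sigma_finiteT.
Qed.

HB.instance Definition _ := Measure_isSigmaFinite.Build _ _ _ (@lebesgue_rV n)
  leb_sigma_finite.

End lebesgue_rV_measure.

Lemma lebesgue_rV_box n (A : 'I_n -> set R) : (forall i, measurable (A i)) ->
  lebesgue_rV [set x : 'rV[R]_n | forall i, A i (x 0 i)] =
  (\prod_(i < n) @lebesgue_measure R (A i))%E.
Proof.
elim: n A => [A _|n IH A mA].
  by rewrite big_ord0 /= diracE mem_set// => -[].
rewrite big_ord_recl -IH//.
rewrite -product_measure1E//; last first.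
  rewrite [X in measurable X](_ : _ =
      \big[setI/setT]_(i < n) ((fun x : 'rV[R]_n => x 0 i) @^-1` A (lift ord0 i))).
    apply: bigsetI_measurable => i _; rewrite -[X in measurable X]setTI.
    apply: continuous_measurable_rV_R => //; exact: coord_continuous.
  rewrite -bigcap_seq; apply/seteqP; split=> [x xA i _|x xA i]; first exact: xA.
  by apply: xA; rewrite /= mem_index_enum.
  exact: mA.
rewrite [LHS]/= /pushforward; apply: congr1.
apply/seteqP; split=> -[a x] /=.
  move=> xA; split=> [|i]; first by have := xA ord0; rewrite cons_rV0.
  by have := xA (lift ord0 i); rewrite cons_rVS.
by move=> [a0 xA] i; case: (unliftP ord0 i) => [k|] ->;
  rewrite ?cons_rVS ?cons_rV0.
Qed.

End lebesgue_rV.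
Arguments lebesgue_rV {R n}.


Section euclidean.
Context {R : realType} {n : nat}.
Implicit Types x y : 'rV[R]_n.

(* `|x| on 'rV[R]_n is the sup norm, hence these Euclidean versions. *)
Definition enorm x : R := Num.sqrt (\sum_i x 0 i ^+ 2).

Definition eball x (r : R) : set 'rV[R]_n := [set y | enorm (y - x) < r].

Definition partial (i : 'I_n) (f : 'rV[R]_n -> R) : 'rV[R]_n -> R :=
  'D_(delta_mx 0 i) f.

Definition partials (s : seq 'I_n) (f : 'rV[R]_n -> R) : 'rV[R]_n -> R :=
  foldr partial f s.

Definition smooth (f : 'rV[R]_n -> R) : Prop :=
  forall s : seq 'I_n, continuous (partials s f) /\
    forall i x, derivable (partials s f) x (delta_mx 0 i).

Definition tsupport (f : 'rV[R]_n -> R) : set 'rV[R]_n :=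
  closure [set x | f x != 0].

Definition test_function (D : set 'rV[R]_n) (f : 'rV[R]_n -> R) : Prop :=
  [/\ smooth f, compact (tsupport f) & tsupport f `<=` D].

Definition locLp (D : set 'rV[R]_n) (p : R) (f : 'rV[R]_n -> R) : Prop :=
  measurable_fun D f /\
  forall K, compact K -> K `<=` D ->
    (\int[lebesgue_rV]_(x in K) (`|f x| `^ p)%:E < +oo)%E.

Definition weak_derivative (D : set 'rV[R]_n) (s : seq 'I_n)
    (f g : 'rV[R]_n -> R) : Prop :=
  [/\ locLp D 1 f, locLp D 1 g &
    forall phi, test_function D phi ->
      \int[lebesgue_rV]_(x in D) (f x * partials s phi x) =
      (-1) ^+ size s * \int[lebesgue_rV]_(x in D) (g x * phi x)].

(* W^{k,p}_loc(D); the weak derivative D^alpha is indexed by a word s in which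
   each i occurs alpha_i times, so that |alpha| = size s *)
Definition sobolev_loc (D : set 'rV[R]_n) (k : nat) (p : R)
    (f : 'rV[R]_n -> R) : Prop :=
  locLp D p f /\
  forall s : seq 'I_n, (size s <= k)%N ->
    exists2 g, locLp D p g & weak_derivative D s f g.

Definition ess_inf_on (B : set 'rV[R]_n) (f : 'rV[R]_n -> \bar R) : \bar R :=
  ess_inf lebesgue_rV (patch (fun=> +oo%E) B f).

(* Only arbitrarily small balls matter, so that for x0 in an open set D the
   restriction to balls included in D is automatic. *)
Definition ess_liminf (f : 'rV[R]_n -> \bar R) (x0 : 'rV[R]_n) : \bar R :=
  lim (ess_inf_on (eball x0 r) f @[r --> 0^'+]).

Lemma ess_liminfE f x0 :
  ess_liminf f x0 = ereal_sup [set ess_inf_on (eball x0 r) f | r in `]0, +oo[].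
Proof.
apply/cvg_lim => //; apply: nonincreasing_at_right_cvge => //.
move=> r s _ _ rs; apply: le_ess_inf; apply: nearW => x; rewrite /patch.
have [xr|_] := boolP (x \in eball x0 r); last by rewrite leey.
by rewrite ifT// inE; move: xr; rewrite inE => /lt_le_trans; apply.
Qed.

Definition measure_support (mu : set 'rV[R]_n -> \bar R) : set 'rV[R]_n :=
  [set y | forall U, open U -> U y -> (0 < mu U)%E].

End euclidean.

Section operator.
Context {R : realType} {d : nat}.
Variables (q : 'I_d -> 'I_d -> 'rV[R]_d -> R) (b : 'I_d -> 'rV[R]_d -> R).
Variable N : R.-sigmafker 'rV[R]_d ~> 'rV[R]_d.

Definition jump_range (D : set 'rV[R]_d) : set 'rV[R]_d :=
  \bigcup_(x in D) [set x + y | y in measure_support (N x)].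

(* Au is only defined a.e.: du i and d2u i j are representatives of the weak
   derivatives of u. The jump part is an extended-real Lebesgue integral. *)
Definition opL (du : 'I_d -> 'rV[R]_d -> R)
    (d2u : 'I_d -> 'I_d -> 'rV[R]_d -> R) (x : 'rV[R]_d) : R :=
  2^-1 * (\sum_i \sum_j q i j x * d2u i j x) + \sum_i b i x * du i x.

Definition opS (u : 'rV[R]_d -> R) (du : 'I_d -> 'rV[R]_d -> R)
    (x : 'rV[R]_d) : \bar R :=
  (\int[N x]_y (u (x + y) - u x
     - \sum_i y 0 i * du i x / (1 + enorm y ^+ 2))%:E)%E.

Definition opA (u : 'rV[R]_d -> R) (du : 'I_d -> 'rV[R]_d -> R)
    (d2u : 'I_d -> 'I_d -> 'rV[R]_d -> R) (x : 'rV[R]_d) : \bar R :=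
  ((opL du d2u x)%:E + opS u du x)%E.

End operator.

(* Main.v *)
Require Import Defs.
From HB Require Import structures.
From mathcomp Require Import all_boot all_order all_algebra.
From mathcomp Require Import all_classical all_reals all_analysis.
From mathcomp Require Import measurable_realfun ess_sup_inf kernel.
From mathcomp Require Import ring lra.

(** Why the theorem is true. Since [u] is only twice weakly differentiable, the
    classical argument at the maximum point [xhat] is replaced by an
    Aleksandrov-Bakelman-Pucci argument: near [xhat] there is a non-null set of points
    where [u] is touched from above by a paraboloid of small opening [delta], and at
    such points [Au] is at most a constant times [delta].

    Fix a small cube around [xhat] included in [D]. The mollifications [U] of [u] are
    smooth there and close to [u], so for every slope [xi] in a small cube of side
    [2 * s0] the maximum of [U - delta * sqnorm (z - xhat) - xi . z] over the cube of
    radius [r] is attained inside it ([contact_slopes]). Hence the map sending a point to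
    the gradient of [U - delta * sqnorm (z - xhat)] maps the set of contact points onto
    the cube of slopes. A covering argument ([area_estimate]) bounds the volume
    of the image by the integral over the contact set of a power [d] of the norm of the
    second derivatives, and Jensen's inequality ([moll_jensen]) replaces these by the
    weak second derivatives of [u], whose power [d] is integrable because [d <= p]. So
    this integral over the contact sets stays away from 0 while the mollification gets
    finer ([contact_at_scale]); by dominated convergence the upper limit of the contact
    sets is not null. The weak derivatives are approximated in L1 ([moll_cvg_L1]), so by
    Markov's inequality and the Borel-Cantelli lemma almost every point of this upper
    limit is an exact contact point of [u] with its weak derivatives
    ([contact_not_negligible]).

    At a contact point, [2 * delta * 1 - D^2 u] is nonnegative and so is [q], so the trace
    of their product is nonnegative ([trace_mul_ge0]); the gradient is at most
    [2 * delta]; and on the support of the jump measure, where [u (x + y) <= u xhat], the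
    contact inequality bounds the jump integrand by a multiple of
    [delta * min 1 (enorm y ^+ 2)] ([jump_pointwise]). A positive lower bound for [Au]
    almost everywhere on a ball around [xhat] is therefore impossible. *)

Set Implicit Arguments.
Unset Strict Implicit.
Unset Printing Implicit Defensive.

Import Order.TTheory GRing.Theory Num.Theory.
Import numFieldNormedType.Exports.

Local Open Scope classical_set_scope.
Local Open Scope ring_scope.


(** * Smooth bumps of one variable *)

Section bump.
Context {R : realType}.
Implicit Types (P : {poly R}) (t x : R) (k n : nat).

(** The functions [P(t) * (1 - t^2)^-k * exp (- 1 / (1 - t^2))] between -1 and 1,
    extended by 0, are stable under derivation: all derivatives of the standard bump lie
    in this class. *)
Definition bump_fun P k t : R :=
  if t ^+ 2 < 1 then P.[t] * (1 - t ^+ 2) ^- k * expR (- (1 - t ^+ 2)^-1) else 0.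

Definition bump_poly P k : {poly R} :=
  P^`() * (1 - 'X ^+ 2) ^+ 2 + (k.*2%:R)%:P * 'X * P * (1 - 'X ^+ 2)
  - 2%:P * 'X * P.

(** The exponential dominates every power, so a bump vanishes quadratically at the ends
    of its support. *)
Lemma expR_inv_le n (w : R) : 0 < w -> w ^- n * expR (- w^-1) <= n.+2`!%:R * w ^+ 2.
Proof.
move=> w0; rewrite expRN ler_pdivrMr ?expR_gt0//.
have wV0 : 0 <= w^-1 by rewrite invr_ge0 ltW.
have h : w^-1 ^+ n.+2 <= expR w^-1 * n.+2`!%:R.
  rewrite -ler_pdivrMr ?ltr0n ?fact_gt0//.
  by apply: le_trans (expR_ge1Dxn n.+1 wV0); rewrite lerDr.
have : w ^- n = w ^+ 2 * w^-1 ^+ n.+2.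
  by rewrite -[n.+2]addn2 exprD !exprVn mulrCA divff ?mulr1// expf_neq0// gt_eqF.
move=> ->; rewrite [leRHS](_ : _ = w ^+ 2 * (expR w^-1 * n.+2`!%:R)); last by ring.
by rewrite ler_wpM2l ?sqr_ge0.
Qed.

Lemma bump_fun_out P k t : 1 <= t ^+ 2 -> bump_fun P k t = 0.
Proof. by rewrite /bump_fun ltNge => ->. Qed.

(** At the end points [t = 1, -1] of the support, the function is [O((s - t)^2)], so its
    derivative is 0, as is the value of the candidate. *)
Lemma is_derive_bump P k t : is_derive t 1 (bump_fun P k) (bump_fun (bump_poly P k) k.+2 t).
Proof.
have [t1|t1|t1] := ltgtP (t ^+ 2) 1.
- set w : {poly R} := 1 - 'X ^+ 2.
  have wE s : w.[s] = 1 - s ^+ 2 by rewrite /w !hornerE.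
  pose v s := (w.[s])^-1.
  pose f := (horner P * v ^+ k * (expR \o (- v)))%R.
  have fE s : f s = P.[s] * (1 - s ^+ 2) ^- k * expR (- (1 - s ^+ 2)^-1).
    by rewrite /f /GRing.mul/= /v !fctE wE exprVn.
  apply: (@near_eq_is_derive _ _ _ f).
    have : \forall s \near t, s ^+ 2 < 1.
      have : (fun s : R => s ^+ 2) @ t --> t ^+ 2 by exact: exprn_continuous.
      by move=> /cvgr_lt; apply.
    by apply: filterS => s s1; rewrite fE /bump_fun s1.
  have w0 : w.[t] != 0 by rewrite wE subr_eq0 gt_eqF.
  have dv : is_derive t 1 v (- (w.[t]) ^- 2 *: w^`().[t]).
    exact: is_deriveV.
  rewrite /f; apply: is_derive_eq.
  have -> : w^`().[t] = - (2 * t).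
    by rewrite /w !poly.derivE !hornerE; ring.
  rewrite /bump_fun t1 /bump_poly !fctE /v wE; rewrite wE in w0.
  rewrite !hornerE /GRing.scale/= -!mul2n natrM.
  clear f fE; case: k => [|k'] /=; rewrite -?exprVn ?exprS; field=> //.
- rewrite bump_fun_out ?(ltW t1)//; apply: (@near_eq_is_derive _ _ _ (cst 0)).
    have : \forall s \near t, 1 < s ^+ 2.
      have : (fun s : R => s ^+ 2) @ t --> t ^+ 2 by exact: exprn_continuous.
      by move=> /cvgr_gt; apply.
    by apply: filterS => s s1; rewrite bump_fun_out// ltW.
- rewrite bump_fun_out ?t1//.
  have [M M0 PM] : exists2 M, 0 < M & forall s, `|s| <= 2 -> `|P.[s]| <= M.
    exists (\sum_(i < size P) `|P`_i| * 2 ^+ i + 1).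
      by rewrite ltr_wpDl// sumr_ge0// => i _; rewrite mulr_ge0// exprn_ge0.
    move=> s s2; rewrite horner_coef (le_trans (ler_norm_sum _ _ _))//.
    rewrite ler_wpDr// ler_sum// => i _; rewrite normrM ler_wpM2l// normrX.
    by rewrite lerXn2r// nnegrE.
  (* [1 - s^2 <= 3 * `|s - t|] near an end point, whence the factor [9 = 3 ^ 2] *)
  pose C := M * k.+2`!%:R * 9.
  have tE : t * t = 1 by rewrite -expr2.
  have t1' : `|t| = 1.
    by apply/eqP; rewrite -(@pexpr_eq1 _ _ 2)// real_normK ?num_real ?t1.
  have bC s : `|s - t| <= 1 -> `|bump_fun P k s| <= C * `|s - t| ^+ 2.
    move=> st; rewrite /bump_fun; case: ifPn => s1; last first.
      by rewrite normr0 mulr_ge0 ?sqr_ge0// /C !mulr_ge0// ltW.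
    have s2 : `|s| <= 2.
      by rewrite -[s](subrK t) (le_trans (ler_normD _ _))// t1' -[2]/(1 + 1) lerD2r.
    have w0 : 0 < 1 - s ^+ 2 by rewrite subr_gt0.
    have w3 : 1 - s ^+ 2 <= 3 * `|s - t|.
      have -> : 1 - s ^+ 2 = (s + t) * - (s - t) by rewrite -t1; ring.
      rewrite (le_trans (ler_norm _))// normrM normrN ler_wpM2r//.
      rewrite (le_trans (ler_normD _ _))// t1'; lra.
    rewrite -mulrA normrM /C -!mulrA ler_pM//; first exact: PM.
    rewrite ger0_norm; last by rewrite mulr_ge0 ?expR_ge0// invr_ge0 exprn_ge0// ltW.
    apply: (le_trans (expR_inv_le k w0)); rewrite ler_wpM2l//.
    rewrite (_ : 9 * _ = (3 * `|s - t|) ^+ 2); last by ring.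
    by rewrite lerXn2r ?nnegrE ?mulr_ge0// ltW.
  apply/is_derive1_caratheodory.
  exists (fun z => bump_fun P k z / (z - t)); split; last 2 first.
  - apply/cvgrPdist_le => /= e e0.
    have C0 : 0 < C by rewrite !mulr_gt0 ?ltr0n ?fact_gt0.
    have eC0 : 0 < e / C by exact: divr_gt0.
    rewrite subrr invr0 mulr0; near=> z.
    rewrite sub0r normrN normrM normfV.
    have [->|zt] := eqVneq z t; first by rewrite subrr normr0 invr0 mulr0 ltW.
    rewrite ler_pdivrMr ?normr_gt0 ?subr_eq0//.
    have z1 : `|z - t| <= 1.
      by rewrite distrC; apply/ltW; near: z; exact: (@nbhsx_ballx _ _ t).
    rewrite (le_trans (bC _ z1))// expr2 mulrA ler_wpM2r//.
    rewrite mulrC -ler_pdivlMr; last exact: C0.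
    by rewrite -normrN opprB; apply/ltW; near: z; exact: (nbhsx_ballx t).
  - by rewrite subrr invr0 mulr0.
  - move=> z; rewrite (bump_fun_out P k (t := t)) ?t1// subr0.
    have [->|zt] := eqVneq z t; first by rewrite subrr mulr0 bump_fun_out ?t1.
    by rewrite divfK// subr_eq0.
Unshelve. all: by end_near. Qed.

(** A bump of radius [eta] comes with all its derivatives, so that the partial
    derivatives of a tensor product of bumps are again given by the family. *)
Definition bump_family (eta : R) (b : nat -> R -> R) :=
  [/\ forall n t, is_derive t 1 (b n) (b n.+1 t),
      forall n t, eta <= `|t| -> b n t = 0,
      forall t, 0 <= b 0%N t /\ b 0%N (- t) = b 0%N t,
      forall t, `|t| < eta -> 0 < b 0%N t &
      forall n, exists M, forall t, `|b n t| <= M].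

(** The bump [exp (- 1 / (1 - t^2))] rescaled by [eta]; its [n]-th derivative has the
    exponent [k = 2 n], which increases by 2 at each derivation. *)
Lemma bump_family_exists (eta : R) : 0 < eta -> exists b, bump_family eta b.
Proof.
move=> eta0.
pose P := fix P n : {poly R} := if n is n'.+1 then eta^-1 *: bump_poly (P n') n'.*2 else 1.
have PZ c Q k t : bump_fun (c *: Q) k t = c * bump_fun Q k t.
  by rewrite /bump_fun; case: ifP => _; rewrite ?mulr0// hornerZ !mulrA.
have d n t : is_derive t 1 (fun s => bump_fun (P n) n.*2 (eta^-1 * s))
    (bump_fun (P n.+1) (n.+1).*2 (eta^-1 * t)).
  rewrite /= PZ mulrC.
  have dm : is_derive t 1 (fun s : R => eta^-1 * s) eta^-1.
    by apply: is_derive_eq; rewrite /GRing.scale/= mulr1.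
  exact: (is_derive1_comp (is_derive_bump (P n) n.*2 (eta^-1 * t)) dm).
have sq t : (eta^-1 * t) ^+ 2 < 1 = (`|t| < eta).
  rewrite -real_normK ?num_real// expr_lt1// normrM gtr0_norm ?invr_gt0//.
  by rewrite mulrC ltr_pdivrMr// mul1r.
exists (fun n t => bump_fun (P n) n.*2 (eta^-1 * t)); split.
- exact: d.
- by move=> n t et; rewrite bump_fun_out// leNgt sq -leNgt.
- move=> t; rewrite /bump_fun mulrN sqrrN; case: ifP => // _.
  by rewrite !hornerC expr0 invr1 !mul1r expR_ge0.
- by move=> t te; rewrite /bump_fun sq te hornerC expr0 invr1 !mul1r expR_gt0.
- move=> n; pose f t := bump_fun (P n) n.*2 (eta^-1 * t).
  have cf : {within `[- eta, eta], continuous (fun t => `|f t|)}.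
    apply: continuous_subspaceT => t; apply: continuous_comp; last exact: norm_continuous.
    by apply/differentiable_continuous/derivable1_diffP; have [] := d n t.
  have [c _ cM] := EVT_max (ge0_cp (ltW eta0)).2 cf.
  exists `|f c| => t; rewrite -/(f t).
  have [te|te] := lerP `|t| eta; first by apply: cM; rewrite in_itv/= -ler_norml.
  by rewrite /f bump_fun_out ?normr0// leNgt sq -leNgt ltW.
Qed.
End bump.

(** * Cubes and lines in the space of row vectors *)

Section rV_norm.
Context {R : realType} {d : nat}.
Implicit Types (x y v : 'rV[R]_d) (e : R).

Lemma rV_norm_leP x e : 0 <= e -> reflect (forall i, `|x 0 i| <= e) (`|x| <= e).
Proof.
move=> e0; rewrite [`|x|]/Num.norm/= mx_normrE; apply: (iffP (bigmax_leP _ _ _ _)).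
  by move=> [_ h] i; exact: (h (0, i)).
by move=> h; split => // -[i j] _ /=; rewrite ord1.
Qed.

Lemma rV_coord_le x i : `|x 0 i| <= `|x|.
Proof. by move: i; apply/(rV_norm_leP _ (normr_ge0 x)). Qed.

Lemma rV_sum_norm_le x : \sum_i `|x 0 i| <= d%:R * `|x|.
Proof.
rewrite (le_trans (ler_sum _ (fun i _ => rV_coord_le x i)))//.
by rewrite sumr_const card_ord mulr_natl.
Qed.

(** The norm on row vectors is the sup norm, so its closed balls are cubes and their
    measure is a product of lengths. *)
Definition cube x e : set 'rV[R]_d := [set y | `|y - x| <= e].

Lemma closed_le_fun (f g : 'rV[R]_d -> R) : continuous f -> continuous g ->
  closed [set y | f y <= g y].
Proof.
move=> cf cg; rewrite (_ : [set y | _] = (fun y => f y - g y) @^-1` [set z : R | z <= 0]).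
  have /continuous_closedP : continuous (fun y => f y - g y).
    by move=> y; apply: continuousB; [exact: cf|exact: cg].
  by apply; exact: closed_le.
by apply/seteqP; split => y /=; rewrite subr_le0.
Qed.

Lemma continuous_rVP (f : 'rV[R]_d -> R) : continuous f <->
  forall z e, 0 < e -> exists2 r, 0 < r & forall y, `|z - y| < r -> `|f z - f y| <= e.
Proof.
split=> [cf z e e0|cf z].
  have /(@cvgrPdist_le _ _ _ (nbhs (z : 'rV[R]_d)) (nbhs_filter _)) /(_ _ e0) := cf z.
  move=> /nbhs_ballP[r /= r0 h]; exists r => // y zy; apply: h.
  by rewrite -ball_normE.
apply/(@cvgrPdist_le _ _ _ (nbhs (z : 'rV[R]_d)) (nbhs_filter _)) => e e0.
have [r r0 h] := cf z e e0; apply/nbhs_ballP; exists r => // y.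
by rewrite -ball_normE; exact: h.
Qed.

Lemma continuous_norm_sub x : continuous (fun y => `|y - x|).
Proof.
move=> y; apply: (@continuous_comp _ _ _ (fun y => y - x)); last exact: norm_continuous.
by apply: continuousB; [exact: cvg_id|exact: cst_continuous].
Qed.

Lemma closed_cube x e : closed (cube x e).
Proof. by apply: (@closed_le_fun _ (fun=> e)); [exact: continuous_norm_sub|exact: cst_continuous]. Qed.

Lemma closed_cube_compact (A : set 'rV[R]_d) x e : closed A -> A `<=` cube x e -> compact A.
Proof.
move=> cA Ax; apply: bounded_closed_compact => //.
exists (`|x| + e); split; first exact: num_real.
move=> M Me y /Ax /= yx; rewrite -[y](subrK x) (le_trans (ler_normD _ _))//.
by rewrite (le_trans _ (ltW Me))// addrC lerD2l.
Qed.

Lemma compact_cube x e : compact (cube x e).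
Proof. exact: (closed_cube_compact (@closed_cube x e) (@subset_refl _ _)). Qed.

(** Directional derivatives are derivatives of functions of one real variable, for which
    the chain rule and the mean value theorem are stated. *)
Lemma is_derive_line (f : 'rV[R]_d -> R) y v (l : R) :
  is_derive (0 : R) (1 : R) (fun s : R => f (y + s *: v)) l <-> is_derive y v f l.
Proof.
have E : (fun h : R => h^-1 *: (((fun s : R => f (y + s *: v)) \o shift 0) (h *: 1) -
     f (y + 0 *: v))) = (fun h : R => h^-1 *: ((f \o shift y) (h *: v) - f y)).
  by apply/funext => h; rewrite /= scale0r !addr0 [h *: 1]mulr1 [y + _]addrC.
by split=> -[dv vE]; constructor; move: dv vE; rewrite /derivable /derive E.
Qed.

Lemma is_derive_line_shift (f : 'rV[R]_d -> R) y v (s l : R) :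
  is_derive s (1 : R) (fun s : R => f (y + s *: v)) l <-> is_derive (y + s *: v) v f l.
Proof.
rewrite -is_derive_line.
have E : (fun h : R => h^-1 *: (((fun s : R => f (y + s *: v)) \o shift s) (h *: 1) -
     f (y + s *: v))) =
  (fun h : R => h^-1 *: (((fun t : R => f (y + s *: v + t *: v)) \o shift 0) (h *: 1) -
     f (y + s *: v + 0 *: v))).
  apply/funext => h; rewrite /= scale0r !addr0 [h *: 1]mulr1.
  by rewrite [h + s]addrC scalerDl addrA.
by split=> -[dv vE]; constructor; move: dv vE; rewrite /derivable /derive E.
Qed.

Lemma is_derive_quadratic (a c e s : R) :
  is_derive s (1 : R) (fun s : R => a + c * s + e * s ^+ 2) (c + 2 * e * s).
Proof.
pose p : {poly R} := a%:P + c%:P * 'X + e%:P * 'X^2.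
have -> : (fun s : R => a + c * s + e * s ^+ 2) = horner p.
  by apply/funext => t; rewrite /p !hornerE.
have -> : c + 2 * e * s = p^`().[s] by rewrite /p !poly.derivE !hornerE; ring.
exact: is_derive_poly.
Qed.

End rV_norm.

(** * Tensor products of bumps *)

Section kern.
Context {R : realType} {d : nat}.
Variables (eta : R) (b : nat -> R -> R).
Hypothesis eta0 : 0 < eta.
Hypothesis bP : bump_family eta b.
Implicit Types (m : 'I_d -> nat) (x y z v : 'rV[R]_d).

(** The multi-index [m] counts the derivations in each coordinate: partial derivation
    then acts on [kern] through [incr]. *)
Definition kern m z : R := \prod_i b (m i) (z 0 i).

Definition incr m i : 'I_d -> nat := fun j => ((i == j) + m j)%N.

Lemma is_derive_prod (I : eqType) (r : seq I) (h h' : I -> R -> R) (s : R) :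
  uniq r -> (forall i, is_derive s 1 (h i) (h' i s)) ->
  is_derive s 1 (fun s => \prod_(i <- r) h i s)
    (\sum_(i <- r) \prod_(j <- r) (if i == j then h' j s else h j s)).
Proof.
move=> + hh; elim: r => [_|a r IH /= /andP[ar ur]].
  by rewrite big_nil; under eq_fun do rewrite big_nil; exact: is_derive_cst.
have {}IH := IH ur.
have -> : (fun s => \prod_(i <- a :: r) h i s) = (h a * (fun s => \prod_(i <- r) h i s))%R.
  by apply/funext => t; rewrite big_cons.
apply: is_derive_eq.
rewrite big_cons addrC; congr (_ + _).
  rewrite big_cons eqxx /GRing.scale/= mulrC; congr (_ * _).
  by apply: eq_big_seq => i ir; case: eqP => // ai; rewrite ai ir in ar.
rewrite /GRing.scale/= big_distrr/=; apply: eq_big_seq => i ir.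
by rewrite big_cons; case: eqP => // ia; rewrite -ia ir in ar.
Qed.

Lemma is_derive_kern m z v :
  is_derive z v (kern m) (\sum_i v 0 i * kern (incr m i) z).
Proof.
apply/is_derive_line.
have h i : is_derive (0 : R) 1 (fun s => b (m i) ((z + s *: v) 0 i))
    (v 0 i * b (m i).+1 ((z + (0 : R) *: v) 0 i)).
  have -> : (fun s => b (m i) ((z + s *: v) 0 i)) = b (m i) \o (fun s => z 0 i + s * v 0 i).
    by apply/funext => s; rewrite !mxE.
  rewrite mulrC; apply: is_derive1_comp.
    by rewrite !mxE; have [+ _ _ _ _] := bP; apply.
  have := is_derive_quadratic (z 0 i) (v 0 i) 0 0; rewrite mulr0 addr0.
  by congr is_derive; apply/funext => s; rewrite mul0r addr0 [s * _]mulrC.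
have D := @is_derive_prod _ (index_enum 'I_d) (fun i s => b (m i) ((z + s *: v) 0 i))
  (fun i s => v 0 i * b (m i).+1 ((z + s *: v) 0 i)) 0 (index_enum_uniq _) h.
apply: (@is_derive_eq _ _ _ _ _ _ _ _ D); apply: eq_bigr => i _.
rewrite (bigD1 i)//= eqxx -mulrA.
congr (_ * _); rewrite /kern [RHS](bigD1 i)//= /incr eqxx/= scale0r addr0.
by congr (_ * _); apply: eq_bigr => j /negPf; rewrite eq_sym => ->.
Qed.

Lemma kern_bounded m : exists C, 0 <= C /\ forall z, `|kern m z| <= C.
Proof.
have [_ _ _ _ bB] := bP.
have [M MP] := choice (fun i => bB (m i)).
exists (\prod_i M i); split.
  by apply: prodr_ge0 => i _; exact: le_trans (MP i 0).
by move=> z; rewrite normr_prod; apply: ler_prod => i _; rewrite normr_ge0/=.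
Qed.

Lemma kern_lipschitz m : exists2 L, 0 <= L & forall z z', `|kern m z - kern m z'| <= L * `|z - z'|.
Proof.
have [C /all_and2[C0 CP]] := choice (fun i => kern_bounded (incr m i)).
exists (\sum_i C i); first exact: sumr_ge0.
move=> z z'; pose v := z - z'.
have D (s : R) : is_derive s (1 : R) (fun s : R => kern m (z' + s *: v))
    (\sum_i v 0 i * kern (incr m i) (z' + s *: v)).
  by apply/is_derive_line_shift; exact: is_derive_kern.
have [|c _] := @MVT_segment R (fun s : R => kern m (z' + s *: v)) _ 0 1 ler01 (fun s _ => D s).
  apply: continuous_subspaceT => s.
  by apply/differentiable_continuous/derivable1_diffP; have [] := D s.
rewrite scale1r scale0r addr0 [z' + v]addrC subrK subr0 mulr1 => ->.
rewrite (le_trans (ler_norm_sum _ _ _))// mulr_suml ler_sum// => i _.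
by rewrite normrM mulrC ler_pM//; exact: rV_coord_le.
Qed.

Lemma continuous_lipschitz (f : 'rV[R]_d -> R) L :
  (forall z z', `|f z - f z'| <= L * `|z - z'|) -> continuous f.
Proof.
move=> fL; apply/continuous_rVP => z e e0.
have L0 : 0 < `|L| + 1 by rewrite ltr_wpDl.
exists (e / (`|L| + 1)); first exact: divr_gt0.
move=> y zy; rewrite (le_trans (fL _ _))//.
move/ltW: zy; rewrite ler_pdivlMr// mulrC; apply: le_trans; rewrite ler_wpM2r//.
by rewrite (le_trans (ler_norm _))// lerDl.
Qed.

Lemma partials_kern m x (s : seq 'I_d) :
  partials s (fun y => kern m (y - x)) = fun y => kern (fun i => (count_mem i s + m i)%N) (y - x).
Proof.
elim: s => [|i s IH] //=; rewrite IH; apply/funext => y; rewrite /partial.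
pose m' j := (count_mem j s + m j)%N; rewrite -/m'.
have D : is_derive y (delta_mx 0 i) (fun y => kern m' (y - x))
    (\sum_j (delta_mx 0 i : 'rV[R]_d) 0 j * kern (incr m' j) (y - x)).
  apply/is_derive_line; under eq_fun do rewrite addrAC.
  by apply/is_derive_line; exact: is_derive_kern.
have [_ ->] := D; rewrite (bigD1 i)//= big1 => [|j ji]; last first.
  by rewrite mxE/= (negPf ji) mul0r.
by rewrite mxE !eqxx mul1r addr0; congr kern; apply/funext => j; rewrite /incr /m' addnA.
Qed.

Lemma kern_out m z : eta <= `|z| -> kern m z = 0.
Proof.
move=> ez; suff [i zi] : exists i, eta <= `|z 0 i|.
  by have [_ + _ _ _] := bP => /(_ _ _ zi) b0; rewrite /kern (bigD1 i)//= b0 mul0r.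
apply: contrapT => /forallNP h.
have : `|z| < eta.
  rewrite [`|z|]/Num.norm/= mx_normrE; apply/bigmax_ltP; split => // -[i j] _ /=.
  by rewrite ord1 ltNge; apply/negP/h.
by rewrite ltNge ez.
Qed.

Lemma kern0_ge0 z : 0 <= kern (fun=> 0%N) z.
Proof. by have [_ _ h _ _] := bP; apply: prodr_ge0 => i _; case: (h (z 0 i)). Qed.

Lemma kern0_even z : kern (fun=> 0%N) (- z) = kern (fun=> 0%N) z.
Proof. by have [_ _ h _ _] := bP; apply: eq_bigr => i _; rewrite mxE; case: (h (z 0 i)). Qed.

Lemma kern0_gt0 z : `|z| < eta -> 0 < kern (fun=> 0%N) z.
Proof.
have [_ _ _ h _] := bP => ze; apply: prodr_gt0 => i _; apply: h.
exact: le_lt_trans (rV_coord_le _ _) ze.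
Qed.

(** Translates of the kernel are admissible in the definition of weak derivatives, which
    is how weak derivatives turn into derivatives of mollifications. *)
Lemma kern_test_function (D : set 'rV[R]_d) m x :
  cube x eta `<=` D -> test_function D (fun y => kern m (y - x)).
Proof.
move=> xD; have sub : tsupport (fun y => kern m (y - x)) `<=` cube x eta.
  rewrite /tsupport; have /closure_id -> := @closed_cube _ _ x eta.
  apply: closureS => y /=; apply: contraR; rewrite -ltNge => /ltW h.
  by rewrite kern_out.
split.
- move=> s; split.
    rewrite partials_kern.
    have [L L0 LP] := kern_lipschitz (fun i => (count_mem i s + m i)%N).
    apply: (@continuous_lipschitz _ L) => z z'; rewrite (le_trans (LP _ _))//.
    by rewrite opprB addrA subrK.
  move=> i y; rewrite partials_kern.
  have D' := @is_derive_kern (fun i => (count_mem i s + m i)%N) (y - x) (delta_mx 0 i).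
  suff [] : is_derive y (delta_mx 0 i) (fun y => kern (fun i => (count_mem i s + m i)%N) (y - x))
    (\sum_j (delta_mx 0 i : 'rV[R]_d) 0 j * kern (incr (fun i => (count_mem i s + m i)%N) j) (y - x)) by [].
  apply/is_derive_line; under eq_fun do rewrite addrAC.
  exact/is_derive_line.
- exact: closed_cube_compact (@closed_closure _ _) sub.
- exact: subset_trans sub xD.
Qed.

End kern.

(** * Translations and cubes for the Lebesgue measure *)

Section lebesgue_facts.
Context {R : realType}.

(** The Lebesgue measure is determined by its values on half-open intervals. *)
Lemma lebesgue_measure_shift (a : R) (A : set R) : measurable A ->
  lebesgue_measure [set x | A (x + a)] = lebesgue_measure A.
Proof.
move=> mA; pose phi : R -> measurableTypeR R := fun x => x + a.
have mphi : measurable_fun setT phi by exact: measurable_funD.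
change (pushforward (@lebesgue_measure R) phi A = lebesgue_measure A).
apply/esym/lebesgue_measure_unique => //= _ [[c e]] _ <-.
rewrite /pushforward /= !lebesgue_measure_itv/=.
rewrite (_ : phi @^-1` _ = `]c - a, e - a]%classic); last first.
  by apply/seteqP; split => x /=; rewrite /phi !in_itv/= ltrBlDr lerBrDr.
rewrite lebesgue_measure_itv/= !lte_fin ltrD2r; case: ifP => // _.
by rewrite -!EFinB; congr EFin; ring.
Qed.

(** Induction on the dimension: a translation acts separately on the first coordinate
    and on the sections whose measures are integrated. *)
Lemma lebesgue_rV_shift n (a : 'rV[R]_n) (A : set 'rV[R]_n) : measurable A ->
  lebesgue_rV [set x | A (x + a)] = lebesgue_rV A.
Proof.
elim: n a A => [|n IH] a A mA.
  by congr (lebesgue_rV _); apply/seteqP; split => x /=; rewrite (_ : x + a = x)//;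
    apply/matrixP => i [].
have mB : measurable (@cons_rV R n @^-1` A).
  by rewrite -[X in measurable X]setTI; exact: measurable_cons_rV.
rewrite /= /pushforward /product_measure1.
set B := _ @^-1` A; set a' := (uncons_rV a).2.
have E t : xsection (@cons_rV R n @^-1` [set x | A (x + a)]) t =
   [set v | xsection B (t + a 0 0) (v + a')].
  apply/seteqP; split => v /=; rewrite /xsection /= !inE /B /=;
  rewrite (_ : cons_rV (t, v) + a = cons_rV (t + a 0 0, v + a'))//;
  apply/rowP => j; rewrite mxE; case: (unliftP ord0 j) => [k|] ->;
  rewrite ?cons_rVS ?cons_rV0 //= ?mxE; congr (_ + a _ _); exact/val_inj.
under eq_integral => t _.
  rewrite /= E IH; last by exact: measurable_xsection.
  over.
rewrite /=.
pose phi : measurableTypeR R -> measurableTypeR R := fun x : R => x + a 0 0 : R.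
have mphi : measurable_fun setT phi by exact: measurable_funD.
have := @ge0_integral_pushforward _ _ _ _ R _ mphi (@lebesgue_measure R) setT
  (fun t => lebesgue_rV (xsection B t)) measurableT.
rewrite preimage_setT /= => <-//; last exact: measurable_fun_xsection.
apply: eq_measure_integral => C mC _.
exact: lebesgue_measure_shift.
Qed.

Lemma measurable_shift n (a : 'rV[R]_n) : measurable_fun setT (fun x : 'rV[R]_n => x + a).
Proof.
apply: continuous_measurable_rV => x.
by apply: continuousD; [exact: cvg_id|exact: cst_continuous].
Qed.

Lemma integral_rV_shift n (a : 'rV[R]_n) (f : 'rV[R]_n -> \bar R) :
  measurable_fun setT f -> (forall x, 0 <= f x)%E ->
  (\int[lebesgue_rV]_x f (x + a)%R = \int[lebesgue_rV]_x f x)%E.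
Proof.
move=> mf f0.
have := @ge0_integral_pushforward _ _ _ _ R _ (measurable_shift a) (@lebesgue_rV R n) setT f
  measurableT mf (fun x _ => f0 x).
rewrite preimage_setT /= => <-.
apply: eq_measure_integral => [|mphi C mC _]; first exact: measurable_shift.
exact: lebesgue_rV_shift.
Qed.

Lemma lebesgue_rV_cube n (x : 'rV[R]_n) e : 0 <= e ->
  lebesgue_rV (cube x e) = ((2 * e) ^+ n)%:E.
Proof.
move=> e0.
rewrite (_ : cube x e = [set y | forall i, `[x 0 i - e, x 0 i + e]%classic (y 0 i)]); last first.
  apply/seteqP; split => y; rewrite /cube /=.
    by move=> /(rV_norm_leP _ e0) h i; have := h i; rewrite !mxE in_itv/= ler_distl.
  move=> h; apply/(rV_norm_leP _ e0) => i.
  by have := h i; rewrite !mxE in_itv/= ler_distl.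
rewrite (lebesgue_rV_box (A := fun i => `[x 0 i - e, x 0 i + e]%classic)); last by [].
under eq_bigr => i _.
  rewrite lebesgue_measure_itv/= (_ : (if _ then _ else _) = (2 * e)%:E); last first.
    rewrite lte_fin; case: ltP => h; first by rewrite -EFinB; congr EFin; ring.
    by congr EFin; lra.
  over.
by rewrite prodEFin prodr_const card_ord.
Qed.

Lemma measurable_cube n (x : 'rV[R]_n) e : measurable (cube x e).
Proof.
rewrite -[cube x e]setCK; apply: measurableC; apply: measurable_open_rV.
by apply: closed_openC; exact: closed_cube.
Qed.

Lemma measurable_closed_rV n (A : set 'rV[R]_n) : closed A -> measurable A.
Proof.
move=> cA; rewrite -[A]setCK; apply: measurableC; apply: measurable_open_rV.
exact: closed_openC.
Qed.

End lebesgue_facts.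

(** * Convolution of an integrable function with a bounded kernel *)

Section convol.
Context {R : realType} {d : nat}.
Local Notation leb := (@lebesgue_rV R d).
Implicit Types (F G : 'rV[R]_d -> R) (C : R) (K : 'rV[R]_d -> R) (x y z v : 'rV[R]_d).

Definition L1 F := leb.-integrable setT (EFin \o F).

Definition convol K F x : R := \int[leb]_y (F y * K (y - x)).

Lemma L1_measurable F : L1 F -> measurable_fun setT F.
Proof. by move=> /integrableP[/measurable_EFinP]. Qed.

Lemma L1_norm F : L1 F -> L1 (fun y => `|F y|).
Proof. by move=> /integrable_abse; apply: eq_integrable. Qed.

Lemma L1D F G : L1 F -> L1 G -> L1 (fun y => F y + G y).
Proof. by move=> iF iG; have := integrableD measurableT iF iG; apply: eq_integrable. Qed.

Lemma L1Z (c : R) F : L1 F -> L1 (fun y => c * F y).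
Proof. by move=> iF; have := integrableZl measurableT c iF; apply: eq_integrable. Qed.

Lemma L1B F G : L1 F -> L1 G -> L1 (fun y => F y - G y).
Proof. by move=> iF iG; have := integrableB measurableT iF iG; apply: eq_integrable. Qed.

Lemma L1_sum (I : Type) (r : seq I) (F : I -> 'rV[R]_d -> R) :
  (forall i, L1 (F i)) -> L1 (fun y => \sum_(i <- r) F i y).
Proof.
move=> iF; elim: r => [|i r IH].
  by under eq_fun do rewrite big_nil; exact: integrable0.
by under eq_fun do rewrite big_cons; exact: L1D.
Qed.

Lemma L1_le F G : measurable_fun setT F -> L1 G -> (forall y, `|F y| <= `|G y|) -> L1 F.
Proof.
move=> mF iG FG; apply: (le_integrable measurableT) iG => //.
  exact/measurable_EFinP.
by move=> y _; rewrite /= lee_fin.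
Qed.

Lemma L1_mul_bounded F K C : L1 F -> measurable_fun setT K -> (forall z, `|K z| <= C) ->
  L1 (fun y => F y * K y).
Proof.
move=> iF mK KC; have iCF := L1Z C iF; apply: L1_le iCF _.
  by apply: measurable_funM => //; exact: L1_measurable.
by move=> y; rewrite !normrM mulrC ler_wpM2r// (le_trans (KC y))// ler_norm.
Qed.

Section fixed_kernel.
Variables (K : 'rV[R]_d -> R) (C : R).
Hypothesis cK : continuous K.
Hypothesis KC : forall z, `|K z| <= C.

Lemma continuous_sub_arg x : continuous (fun y => K (y - x)).
Proof.
move=> y; apply: (@continuous_comp _ _ _ (fun y => y - x)); last exact: cK.
by apply: continuousB; [exact: cvg_id|exact: cst_continuous].
Qed.

Lemma L1_convol F x : L1 F -> L1 (fun y => F y * K (y - x)).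
Proof.
move=> iF; apply: (L1_mul_bounded (C := C)) => //.
by apply: continuous_measurable_rV_R; exact: continuous_sub_arg.
Qed.

Lemma convolD F G x : L1 F -> L1 G -> convol K (fun y => F y + G y) x = convol K F x + convol K G x.
Proof.
move=> iF iG; rewrite /convol -RintegralD//; [|exact: L1_convol|exact: L1_convol].
by apply: eq_Rintegral => y _; rewrite mulrDl.
Qed.

Lemma convolB F G x : L1 F -> L1 G -> convol K (fun y => F y - G y) x = convol K F x - convol K G x.
Proof.
move=> iF iG; rewrite /convol -RintegralB//; [|exact: L1_convol|exact: L1_convol].
by apply: eq_Rintegral => y _; rewrite mulrBl.
Qed.

Lemma convolZ (c : R) F x : L1 F -> convol K (fun y => c * F y) x = c * convol K F x.
Proof.
move=> iF; rewrite /convol -RintegralZl//; last exact: L1_convol.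
by apply: eq_Rintegral => y _; rewrite mulrA.
Qed.

(** This makes mollifications continuous, hence measurable, and gives the Lipschitz
    regularity of second derivatives used in the area estimate. *)
Lemma convol_lipschitz L F : L1 F -> (forall z z', `|K z - K z'| <= L * `|z - z'|) ->
  exists M, forall x x', `|convol K F x - convol K F x'| <= M * `|x - x'|.
Proof.
move=> iF KL; exists (L * \int[leb]_y `|F y|) => x x'.
rewrite /convol -RintegralB//; [|exact: L1_convol|exact: L1_convol].
have i1 : L1 (fun y => F y * K (y - x) - F y * K (y - x')).
  by apply: L1B; exact: L1_convol.
rewrite (le_trans (le_normr_Rintegral measurableT i1))//.
rewrite mulrAC -RintegralZl//; last exact: L1_norm.
apply: le_Rintegral => //; [exact: (L1_norm i1)|exact/L1Z/L1_norm|].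
move=> y _; rewrite -mulrBr normrM mulrC ler_wpM2r//.
by rewrite (le_trans (KL _ _))// opprB [_ + (x' - y)]addrC addrA subrK distrC.
Qed.

Lemma convol_norm_le F x : L1 F -> (forall z, 0 <= K z) ->
  `|convol K F x| <= convol K (fun y => `|F y|) x.
Proof.
move=> iF K0; rewrite /convol (le_trans (le_normr_Rintegral measurableT (L1_convol x iF)))//.
by rewrite le_eqVlt; apply/orP; left; apply/eqP; apply: eq_Rintegral => y _;
  rewrite normrM (ger0_norm (K0 _)).
Qed.

Lemma convol_le F G x : L1 F -> L1 G -> (forall z, 0 <= K z) ->
  (forall y, K (y - x) != 0 -> F y <= G y) -> convol K F x <= convol K G x.
Proof.
move=> iF iG K0 FG; apply: le_Rintegral => //; [exact: L1_convol|exact: L1_convol|].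
move=> y _; have [->|K1] := eqVneq (K (y - x)) 0; first by rewrite !mulr0.
by rewrite ler_wpM2r// FG.
Qed.

Lemma eq_convol F G x : (forall y, K (y - x) != 0 -> F y = G y) -> convol K F x = convol K G x.
Proof.
move=> FG; apply: eq_Rintegral => y _.
have [->|K1] := eqVneq (K (y - x)) 0; first by rewrite !mulr0.
by rewrite FG.
Qed.

(** Tonelli's theorem; as [K] is even, the integral of [K (y - x)] in [x] is that of a
    translate of [K]. *)
Lemma integral_convol F : L1 F -> (forall y, 0 <= F y) -> (forall z, 0 <= K z) ->
  (forall z, K (- z) = K z) -> L1 K ->
  (\int[leb]_x (convol K F x)%:E = (\int[leb]_z K z)%:E * \int[leb]_y (F y)%:E)%E.
Proof.
move=> iF F0 K0 Ke iK.
have mF := L1_measurable iF.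
have mK := continuous_measurable_rV_R cK.
under eq_integral => x _.
  rewrite /convol /Rintegral fineK; last first.
    exact: (integrable_fin_num measurableT (L1_convol x iF)).
  over.
pose f (p : 'rV[R]_d * 'rV[R]_d) : \bar R := (F p.2 * K (p.2 - p.1))%:E.
have mf : measurable_fun setT f.
  apply/measurable_EFinP; apply: measurable_funM.
    by apply: measurableT_comp => //; exact: measurable_snd.
  apply: (measurableT_comp mK); apply: measurable_fun_rV => j.
  have -> : (fun t : 'rV[R]_d * 'rV[R]_d => (t.2 - t.1) 0 j) =
     (fun t => ((fun x : 'rV[R]_d => x 0 j) \o snd) t - ((fun x : 'rV[R]_d => x 0 j) \o fst) t).
    by apply/funext => t; rewrite !mxE.
  have mc : measurable_fun setT (fun x : 'rV[R]_d => x 0 j).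
    by apply: continuous_measurable_rV_R; exact: coord_continuous.
  by apply: measurable_funB; apply: measurableT_comp.
have f0 p : (0 <= f p)%E by rewrite lee_fin mulr_ge0.
have := @fubini_tonelli _ _ _ _ R leb leb f mf f0.
rewrite /fubini_F /fubini_G /= => ->.
have cKy y : continuous (fun x => K (y - x)).
  rewrite (_ : (fun x => K (y - x)) = (fun x => K (x - y))).
    exact: continuous_sub_arg.
  by apply/funext => x; rewrite -Ke opprB.
have step y : (\int[leb]_x (F y * K (y - x))%:E = (\int[leb]_z K z)%:E * (F y)%:E)%E.
  under eq_integral do rewrite EFinM.
  rewrite ge0_integralZl_EFin//; last 2 first.
    by move=> x _; rewrite lee_fin.
    by apply/measurable_EFinP; exact: (continuous_measurable_rV_R (cKy y)).
  rewrite muleC; congr (_ * _)%E.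
  rewrite /Rintegral fineK; last exact: (integrable_fin_num measurableT iK).
  rewrite -[RHS](integral_rV_shift (- y)).
  - by apply: eq_integral => x _; rewrite -Ke opprB.
  - exact/measurable_EFinP.
  - by move=> x; rewrite lee_fin.
under eq_integral do rewrite /f /= step.
rewrite ge0_integralZl_EFin//; first by move=> y _; rewrite lee_fin.
- exact/measurable_EFinP.
- by apply: Rintegral_ge0.
Qed.

End fixed_kernel.
End convol.

(** * Mollification *)

Section moll.
Context {R : realType} {d : nat}.
Local Notation leb := (@lebesgue_rV R d).
Implicit Types (F G : 'rV[R]_d -> R) (b : nat -> R -> R) (x y z v : 'rV[R]_d).

Lemma L1_indic (A : set 'rV[R]_d) : measurable A -> (leb A < +oo)%E -> L1 (\1_A : _ -> R).
Proof.
move=> mA A1; apply/integrableP; split; first exact/measurable_EFinP/measurable_indic.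
under eq_integral => y _ do rewrite /= ger0_norm//.
by rewrite integral_indic// setIT.
Qed.

Lemma Rintegral_indic (A : set 'rV[R]_d) : measurable A ->
  \int[leb]_y (\1_A y : R) = fine (leb A).
Proof. by move=> mA; rewrite /Rintegral integral_indic// setIT. Qed.

Lemma cube_ltoo x e : (leb (cube x e) < +oo)%E.
Proof.
have [e0|e0] := leP 0 e; first by rewrite lebesgue_rV_cube// ltry.
rewrite (_ : cube x e = set0) ?measure0 ?ltry//.
by apply/seteqP; split => // y; rewrite /cube/= leNgt (lt_le_trans e0).
Qed.

Lemma L1_bounded_cube F C x e : measurable_fun setT F -> (forall y, `|F y| <= C) ->
  (forall y, ~ cube x e y -> F y = 0) -> L1 F.
Proof.
move=> mF FC F0; have i1 := L1_indic (measurable_cube x e) (cube_ltoo x e).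
apply: L1_le mF (L1Z C i1) _ => y; rewrite indicE.
have [yx|yx] := boolP (y \in cube x e).
  by rewrite mulr1 (le_trans (FC y))// ler_norm.
by rewrite mulr0 F0 ?normr0// => /mem_set yx'; rewrite yx' in yx.
Qed.

Section family.
Variables (eta : R) (b : nat -> R -> R).
Hypothesis eta0 : 0 < eta.
Hypothesis bP : bump_family eta b.

Local Notation kap := (kern b (fun=> 0%N) : 'rV[R]_d -> R).

Lemma continuous_kern m : continuous (kern b m : 'rV[R]_d -> R).
Proof. by have [L _ LP] := kern_lipschitz (d := d) bP m; exact: continuous_lipschitz LP. Qed.
Arguments continuous_kern m : clear implicits.

Lemma L1_kern_shift m x : L1 (fun y => kern b m (y - x)).
Proof.
have [C [C0 CP]] := kern_bounded (d := d) bP m.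
apply: (@L1_bounded_cube _ C x eta) => //.
  by apply: continuous_measurable_rV_R; exact/continuous_sub_arg/continuous_kern.
move=> y; rewrite /cube/= => /negP; rewrite -ltNge => /ltW.
exact: (kern_out eta0 bP).
Qed.

Lemma L1_kern m : L1 (kern b m : 'rV[R]_d -> R).
Proof. by have := L1_kern_shift m 0; under eq_fun do rewrite subr0. Qed.

Definition mass : R := \int[leb]_y kap y.

Lemma mass_gt0 : 0 < mass.
Proof.
have k0 : 0 < kap 0 by apply: (kern0_gt0 bP); rewrite normr0.
have k2 : 0 < kap 0 / 2 by rewrite divr_gt0.
have [r r0 rP] := (continuous_rVP kap).1 (continuous_kern (fun=> 0%N)) 0 _ k2.
have i1 := L1_indic (measurable_cube 0 (r / 2)) (cube_ltoo 0 (r / 2)).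
apply: (@lt_le_trans _ _ (\int[leb]_y (kap 0 / 2 * \1_(cube 0 (r / 2)) y))).
  rewrite RintegralZl// Rintegral_indic; last exact: measurable_cube.
  by rewrite lebesgue_rV_cube ?divr_ge0 1?ltW//= mulr_gt0// exprn_gt0// mulr_gt0// divr_gt0.
apply: le_Rintegral => //; [exact: L1Z|exact: L1_kern|move=> y _].
rewrite indicE; have [|_] := boolP (y \in cube 0 (r / 2)); last first.
  by rewrite mulr0; exact: (kern0_ge0 bP).
rewrite inE /cube /= subr0 mulr1 => yr.
have : `|0 - y| < r by rewrite sub0r normrN (le_lt_trans yr)// ltr_pdivrMr// ltr_pMr// ltr1n.
by move=> /rP; rewrite ler_distl => /andP[]; lra.
Qed.

(** The kernel [kern] has total mass [mass b] instead of 1, hence the division. *)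
Definition moll F x : R := convol kap F x / mass.

Let kapC := kern_bounded (d := d) bP (fun=> 0%N).

Lemma mollD F G x : L1 F -> L1 G -> moll (fun y => F y + G y) x = moll F x + moll G x.
Proof.
have [C [_ CP]] := kapC.
by move=> iF iG; rewrite /moll (convolD (continuous_kern _) CP)// mulrDl.
Qed.

Lemma mollB F G x : L1 F -> L1 G -> moll (fun y => F y - G y) x = moll F x - moll G x.
Proof.
have [C [_ CP]] := kapC.
by move=> iF iG; rewrite /moll (convolB (continuous_kern _) CP)// mulrBl.
Qed.

Lemma mollZ (c : R) F x : L1 F -> moll (fun y => c * F y) x = c * moll F x.
Proof.
have [C [_ CP]] := kapC.
by move=> iF; rewrite /moll (convolZ (continuous_kern _) CP)// mulrA.
Qed.

Lemma moll_lipschitz F : L1 F ->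
  exists M, forall x x', `|moll F x - moll F x'| <= M * `|x - x'|.
Proof.
move=> iF; have [C [_ CP]] := kapC; have [L _ LP] := kern_lipschitz (d := d) bP (fun=> 0%N).
have [M MP] := convol_lipschitz (continuous_kern _) CP iF LP.
exists (M / mass) => x x'; rewrite /moll -mulrBl normrM [`|mass^-1|]gtr0_norm ?invr_gt0 ?mass_gt0//.
by rewrite mulrAC ler_wpM2r// invr_ge0 ltW// mass_gt0.
Qed.

Lemma continuous_moll F : L1 F -> continuous (moll F).
Proof. by move=> /moll_lipschitz[M]; exact: continuous_lipschitz. Qed.

Lemma kap_cube x y : kap (y - x) != 0 -> cube x eta y.
Proof. by apply: contraR; rewrite -ltNge => /ltW/(kern_out eta0 bP) ->. Qed.

(** The value at [x] only depends on the cube of radius [eta]; this locality lets [u]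
    and its derivatives be cut off outside a cube. *)
Lemma eq_moll F G x : (forall y, cube x eta y -> F y = G y) -> moll F x = moll G x.
Proof. by move=> FG; rewrite /moll; congr (_ / _); apply: eq_convol => y /kap_cube /FG. Qed.

Lemma moll_le F G x : L1 F -> L1 G -> (forall y, cube x eta y -> F y <= G y) ->
  moll F x <= moll G x.
Proof.
have [C [_ CP]] := kapC.
move=> iF iG FG; rewrite ler_wpM2r ?invr_ge0 ?(ltW mass_gt0)//.
apply: (convol_le (continuous_kern _) CP) => //; first by move=> z; exact: (kern0_ge0 bP).
by move=> y /kap_cube /FG.
Qed.

Lemma moll_norm_le F x : L1 F -> `|moll F x| <= moll (fun y => `|F y|) x.
Proof.
have [C [_ CP]] := kapC.
move=> iF; rewrite normrM [`|mass^-1|]gtr0_norm ?invr_gt0 ?mass_gt0//.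
rewrite ler_wpM2r ?invr_ge0 ?(ltW mass_gt0)//.
by apply: (convol_norm_le (continuous_kern _) CP) => // z; exact: (kern0_ge0 bP).
Qed.

Lemma moll_cst (c : R) F x : (forall y, cube x eta y -> F y = c) -> moll F x = c.
Proof.
move=> Fc; rewrite /moll; apply: (canLR (mulfK (lt0r_neq0 mass_gt0))).
rewrite (@eq_convol _ _ _ _ (fun=> c)); last by move=> y /kap_cube /Fc.
rewrite /convol RintegralZl//; last exact: L1_kern_shift.
rewrite /mass; congr (_ * _); rewrite /Rintegral; congr fine.
rewrite -[RHS](integral_rV_shift (- x))//.
  by apply/measurable_EFinP; apply: continuous_measurable_rV_R; exact: continuous_kern.
by move=> y; rewrite lee_fin; exact: (kern0_ge0 bP).
Qed.

Lemma integral_moll F : L1 F -> (forall y, 0 <= F y) ->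
  (\int[leb]_x (moll F x)%:E = \int[leb]_y (F y)%:E)%E.
Proof.
move=> iF F0; have [C [_ CP]] := kapC.
have m0 := mass_gt0.
have cc : continuous (convol kap F).
  have [L _ LP] := kern_lipschitz (d := d) bP (fun=> 0%N).
  have [M MP] := convol_lipschitz (continuous_kern _) CP iF LP.
  exact: continuous_lipschitz MP.
rewrite /moll; under eq_integral do rewrite mulrC EFinM.
rewrite ge0_integralZl_EFin//; first last.
- by rewrite invr_ge0 ltW.
- by apply/measurable_EFinP; exact: (continuous_measurable_rV_R cc).
- move=> x _; rewrite lee_fin; apply: Rintegral_ge0 => y _.
  by rewrite mulr_ge0//; exact: (kern0_ge0 bP).
rewrite (integral_convol (continuous_kern _) CP)//.
- by rewrite muleA -EFinM mulVf ?gt_eqF// mul1e.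
- by move=> z; exact: (kern0_ge0 bP).
- by move=> z; exact: (kern0_even bP).
- exact: (L1_kern (fun=> 0%N)).
Qed.

End family.
End moll.
Arguments continuous_kern {R d eta b} bP m.

(** * Convergence of mollifications in L1 *)

Section moll_cvg.
Context {R : realType} {d : nat}.
Local Notation leb := (@lebesgue_rV R d).
Implicit Types (F G : 'rV[R]_d -> R) (b : nat -> R -> R) (x y z : 'rV[R]_d).

Definition nrm F : R := \int[leb]_y `|F y|.

Lemma nrm_ge0 F : 0 <= nrm F.
Proof. exact: Rintegral_ge0. Qed.

Lemma nrmE F : L1 F -> (\int[leb]_y `|F y|%:E)%E = (nrm F)%:E.
Proof.
by move=> iF; rewrite /nrm /Rintegral fineK//; exact: (integrable_fin_num measurableT (L1_norm iF)).
Qed.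

Lemma nrm_le F G : L1 F -> L1 G -> (forall x, `|F x| <= G x) -> nrm F <= \int[leb]_x G x.
Proof. by move=> iF iG FG; apply: le_Rintegral => //; exact: L1_norm. Qed.

Lemma ler_nrmD F G : L1 F -> L1 G -> nrm (fun x => F x + G x) <= nrm F + nrm G.
Proof.
move=> iF iG; rewrite /nrm -RintegralD//; [|exact: L1_norm|exact: L1_norm].
apply: nrm_le; [exact: L1D|by apply: L1D; exact: L1_norm|].
by move=> x; exact: ler_normD.
Qed.

Lemma nrmZ (c : R) F : L1 F -> nrm (fun x => c * F x) = `|c| * nrm F.
Proof.
move=> iF; rewrite /nrm -RintegralZl//; last exact: L1_norm.
by apply: eq_Rintegral => x _; rewrite normrM.
Qed.

Section L1_moll.
Variables (eta : R) (b : nat -> R -> R).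
Hypothesis eta0 : 0 < eta.
Hypothesis bP : bump_family eta b.

Lemma measurable_moll F : L1 F -> measurable_fun setT (moll b F).
Proof.
by move=> iF; apply: continuous_measurable_rV_R; exact: (continuous_moll eta0 bP).
Qed.

Lemma L1_moll F : L1 F -> L1 (moll b F).
Proof.
move=> iF; apply/integrableP; split.
  by apply/measurable_EFinP; exact: measurable_moll.
have iF' := L1_norm iF.
apply: (@le_lt_trans _ _ (\int[leb]_x (moll b (fun y => `|F y|) x)%:E)%E).
  apply: ge0_le_integral => //.
  - by apply: measurableT_comp => //; apply/measurable_EFinP; exact: measurable_moll.
  - by apply/measurable_EFinP; exact: measurable_moll.
  - by move=> x _; rewrite /= lee_fin; exact: (moll_norm_le eta0 bP).
by rewrite (integral_moll eta0 bP)// (nrmE iF) ltry.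
Qed.

Lemma Rintegral_moll F : L1 F -> (forall y, 0 <= F y) ->
  \int[leb]_x moll b F x = \int[leb]_x F x.
Proof. by move=> iF F0; rewrite /Rintegral (integral_moll eta0 bP). Qed.

Lemma nrm_moll F : L1 F -> nrm (moll b F) <= nrm F.
Proof.
move=> iF; rewrite -[leRHS]Rintegral_moll//; last exact: L1_norm.
apply: nrm_le; [exact: L1_moll|exact/L1_moll/L1_norm|].
by move=> x; exact: (moll_norm_le eta0 bP).
Qed.
End L1_moll.

(** Convergence in L1, uniform over all kernels of small radius: one kernel has to serve
    for [u] and for all its derivatives. *)
Definition moll_cvg F := forall e, 0 < e -> exists2 eta1, 0 < eta1 &
  forall eta b, 0 < eta -> eta <= eta1 -> bump_family eta b ->
    nrm (fun x => moll b F x - F x) <= e.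

(** Mollification does not increase the L1 norm, so the three terms of [moll b (F - G) +
    (moll b G - G) + (G - F)] are small. *)
Lemma moll_cvg_lim F : L1 F ->
  (forall e, 0 < e -> exists G, [/\ L1 G, moll_cvg G & nrm (fun x => F x - G x) <= e]) ->
  moll_cvg F.
Proof.
move=> iF FG e e0; have e3 : 0 < e / 3 by rewrite divr_gt0.
have [G [iG cG FGe]] := FG _ e3; have [eta1 eta10 P] := cG _ e3.
exists eta1 => // eta b eta0 le1 bP; have {}P := P _ _ eta0 le1 bP.
have iFG : L1 (fun x => F x - G x) by exact: L1B.
have iH : L1 (fun x => moll b (fun x => F x - G x) x) by exact: (L1_moll eta0 bP).
have iGF : L1 (fun x => - 1 * (F x - G x)) by exact: L1Z.
have imG : L1 (fun x => moll b G x - G x) by apply: L1B => //; exact: (L1_moll eta0 bP).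
rewrite (_ : (fun x => _) = (fun x => moll b (fun x => F x - G x) x +
    ((moll b G x - G x) + - 1 * (F x - G x)))); last first.
  by apply/funext => x; rewrite (mollB bP)//; ring.
rewrite (le_trans (ler_nrmD _ _))//; first exact: L1D.
have -> : e = e / 3 + (e / 3 + e / 3) by lra.
rewrite lerD//; first exact: le_trans (nrm_moll eta0 bP iFG) FGe.
rewrite (le_trans (ler_nrmD _ _))// lerD// nrmZ// normrN1 mul1r//.
Qed.

Lemma moll_cvgZ (c : R) F : L1 F -> moll_cvg F -> moll_cvg (fun x => c * F x).
Proof.
move=> iF cF e e0; have c0 : 0 < `|c| + 1 by rewrite ltr_wpDl.
have [eta1 eta10 P] := cF _ (divr_gt0 e0 c0); exists eta1 => // eta b eta0 le1 bP.
have {}P := P _ _ eta0 le1 bP.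
rewrite (_ : (fun x => _) = (fun x => c * (moll b F x - F x))); last first.
  by apply/funext => x; rewrite (mollZ bP)//; ring.
rewrite nrmZ; last by apply: L1B => //; exact: (L1_moll eta0 bP).
rewrite ler_pdivlMr// mulrC in P; apply: le_trans P; rewrite ler_wpM2r ?nrm_ge0//.
by rewrite lerDl.
Qed.

Lemma moll_cvgD F G : L1 F -> L1 G -> moll_cvg F -> moll_cvg G ->
  moll_cvg (fun x => F x + G x).
Proof.
move=> iF iG cF cG e e0; have e2 : 0 < e / 2 by rewrite divr_gt0.
have [eta1 eta10 P1] := cF _ e2; have [eta2 eta20 P2] := cG _ e2.
exists (Num.min eta1 eta2); first by rewrite lt_min eta10.
move=> eta b eta0; rewrite le_min => /andP[le1 le2] bP.
have {}P1 := P1 _ _ eta0 le1 bP; have {}P2 := P2 _ _ eta0 le2 bP.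
rewrite (_ : (fun x => _) = (fun x => (moll b F x - F x) + (moll b G x - G x))); last first.
  by apply/funext => x; rewrite (mollD bP)//; ring.
rewrite (le_trans (ler_nrmD _ _))//; try (apply: L1B => //; exact: (L1_moll eta0 bP)).
by rewrite [e]splitr lerD.
Qed.

Lemma moll_cvg_sum (I : Type) (r : seq I) (F : I -> 'rV[R]_d -> R) :
  (forall i, L1 (F i)) -> (forall i, moll_cvg (F i)) ->
  moll_cvg (fun y => \sum_(i <- r) F i y).
Proof.
move=> iF cF; elim: r => [|i r IH].
  under eq_fun do rewrite big_nil.
  move=> e e0; exists 1 => // eta b eta0 _ bP.
  rewrite (_ : (fun x => _ - _) = cst 0); last first.
    by apply/funext => x; rewrite /= subr0; exact: (moll_cst eta0 bP).
  by rewrite /nrm /Rintegral integral0_eq ?ltW// => x _; rewrite normr0.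
under eq_fun do rewrite big_cons; apply: moll_cvgD => //; exact: L1_sum.
Qed.

Lemma nrm_indicB (A B : set 'rV[R]_d) : measurable A -> measurable B -> A `<=` B ->
  (leb B < +oo)%E -> nrm (fun x => \1_B x - \1_A x) = fine (leb B) - fine (leb A).
Proof.
move=> mA mB AB B1; have A1 : (leb A < +oo)%E by apply: le_lt_trans B1; apply: le_measure; rewrite ?inE.
rewrite -!Rintegral_indic// -RintegralB//; [|exact: L1_indic|exact: L1_indic].
apply: eq_Rintegral => x _; rewrite ger0_norm// subr_ge0 !indicE ler_nat.
by have [/set_mem/AB/mem_set -> //|_] := boolP (x \in A).
Qed.

(** For a small radius the mollified indicator of [A] is below the indicator of a
    neighbourhood [U n] of [A], and it has the same integral as the indicator of [A]. So
    the L1 distance is at most twice the measure of the difference of [U n] and [A],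
    which tends to 0 because [A] is the intersection of the [U n]. *)
Lemma moll_cvg_compact (A : set 'rV[R]_d) : compact A -> moll_cvg (\1_A : _ -> R).
Proof.
move=> cA e e0.
have [M AM] : exists M, A `<=` cube 0 M.
  have [M [_ HM]] := compact_bounded cA; exists (M + 1) => x Ax.
  by rewrite /cube/= subr0; apply: HM => //; rewrite ltrDl.
have clA : closed A by exact: compact_closed (@norm_hausdorff _ _) cA.
have mA : measurable A by exact: measurable_closed_rV.
pose U n := \bigcup_(y in A) ball y (n.+1%:R^-1 : R).
have oU n : open (U n) by apply: bigcup_open => y _; exact: ball_open.
have mU n : measurable (U n) by exact: measurable_open_rV.
have AU n : A `<=` U n by move=> y Ay; exists y => //; exact: ballxx.
have UM n : U n `<=` cube 0 (M + 1).
  move=> x [y Ay]; rewrite -ball_normE /= => yx; rewrite /cube/= subr0.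
  rewrite -[x](subrK y) addrC (le_trans (ler_normD _ _))// lerD//.
    by have := AM _ Ay; rewrite /cube/= subr0.
  rewrite distrC (le_trans (ltW yx))// invf_le1 ?ler1n// ltr0n//.
have Uoo n : (leb (U n) < +oo)%E.
  apply: le_lt_trans (cube_ltoo 0 (M + 1)).
  by apply: le_measure; rewrite ?inE//; exact: measurable_cube.
have Aoo : (leb A < +oo)%E.
  by apply: le_lt_trans (Uoo 0%N); apply: le_measure; rewrite ?inE.
have capU : \bigcap_n U n = A.
  apply/seteqP; split => [x Ux|x Ax n _]; last exact: AU.
  apply: clA => B /nbhs_ballP[r /= r0 rB].
  have [n nr] : exists n, n.+1%:R^-1 < r.
    by have [k _ /(_ k (leqnn k)) /= ?] := near_infty_natSinv_lt (PosNum r0); exists k.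
  have [y Ay yx] := Ux n I; exists y; split => //; apply: rB.
  by apply: ball_sym; exact: le_ball (ltW nr) _ yx.
have : (leb \o U) n @[n --> \oo] --> leb A.
  rewrite -capU; apply: nonincreasing_cvg_mu => //.
    exact: Uoo.
    by rewrite capU.
  move=> n m nm; apply/subsetPset => x [y Ay yx]; exists y => //.
  by apply: le_ball yx; rewrite lef_pV2 ?posrE ?ltr0n// ler_nat ltnS.
have Afin : leb A \is a fin_num by rewrite ge0_fin_numE.
have e2 : 0 < e / 2 by rewrite divr_gt0.
rewrite -(fineK Afin) => /fine_cvgP[_] /cvgrPdist_le /(_ _ e2)[n _ /(_ n (leqnn n)) /= Une].
exists (n.+1%:R^-1 / 2); first by rewrite divr_gt0// invr_gt0 ltr0n.
move=> eta b eta0 eta1 bP.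
have iA := L1_indic mA Aoo; have iU := L1_indic (mU n) (Uoo n).
have imA := L1_moll eta0 bP iA.
have mAU x : moll b \1_A x <= \1_(U n) x.
  rewrite indicE; have [xU|xU] := boolP (x \in U n).
    have ic := L1_indic (measurable_cube x eta) (cube_ltoo x eta).
    rewrite -[leRHS](moll_cst eta0 bP (F := \1_(cube x eta)) (x := x)); last first.
      by move=> y xy; rewrite indicE mem_set.
    apply: (moll_le eta0 bP) => // y xy; rewrite !indicE (mem_set xy).
    by case: (y \in A); rewrite ?ler01.
  rewrite (moll_cst eta0 bP (c := 0))// => y xy; rewrite indicE memNset// => Ay.
  move/negP: xU; apply; apply/mem_set; exists y => //.
  rewrite -ball_normE /=; apply: le_lt_trans xy _; apply: le_lt_trans eta1 _.
  by rewrite ltr_pdivrMr// ltr_pMr ?invr_gt0 ?ltr0n// ltr1n.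
have i1 : L1 (fun x => \1_(U n) x - moll b \1_A x) by exact: L1B.
have i2 : L1 (fun x => \1_(U n) x - \1_A x) by exact: L1B.
have AUx x : 0 <= \1_(U n) x - \1_A x :> R.
  rewrite subr_ge0 !indicE ler_nat.
  by have [/set_mem/(AU n)/mem_set -> //|_] := boolP (x \in A).
have i3 : L1 (fun x => moll b \1_A x - \1_A x) by exact: L1B.
apply: le_trans (nrm_le i3 (L1D i1 i2) _) _.
  move=> x; rewrite ler_norml; apply/andP; split.
    by rewrite lerNl opprB; have := mAU x; have := AUx x; lra.
  by have := mAU x; have := AUx x; lra.
rewrite RintegralD// !RintegralB// !Rintegral_indic// (Rintegral_moll eta0 bP)//.
rewrite Rintegral_indic//; move: Une; rewrite ler_distl => /andP[]; lra.
Qed.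

End moll_cvg.

Section moll_cvg_L1.
Context {R : realType} {d : nat}.
Local Notation leb := (@lebesgue_rV R d).
Implicit Types (F G : 'rV[R]_d -> R) (b : nat -> R -> R) (x y z : 'rV[R]_d).

Lemma measurable_rV_closed :
  @measurable _ 'rV[R]_d = <<s (@closed 'rV[R]_d) >>.
Proof.
apply/seteqP; split => A.
  apply: smallest_sub; first exact: smallest_sigma_algebra.
  move=> U oU; rewrite -[U]setCK; apply: (@sigma_algebraC _ closed).
  by apply: sub_sigma_algebra; exact: open_closedC.
apply: smallest_sub; first exact: sigma_algebra_measurable.
by move=> C; exact: measurable_closed_rV.
Qed.

Variables (x0 : 'rV[R]_d) (r0 : R).
Let C := cube x0 r0.
Let mC : measurable C := measurable_cube x0 r0.

Let fin_sub (A : set 'rV[R]_d) : measurable A -> (leb (A `&` C) < +oo)%E.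
Proof.
move=> mA; apply: le_lt_trans (cube_ltoo x0 r0); apply: le_measure; rewrite ?inE//.
by exact: measurableI.
Qed.

Let L1_sub (A : set 'rV[R]_d) : measurable A -> L1 (\1_(A `&` C) : _ -> R).
Proof. by move=> mA; apply: L1_indic; [exact: measurableI|exact: fin_sub]. Qed.

(** Induction on Borel sets from the closed sets, which are stable by intersection and
    generate them. The trace on a cube keeps all measures finite, so that disjoint
    unions are approximated in L1 by finite ones. *)
Lemma moll_cvg_indic (A0 : set 'rV[R]_d) : measurable A0 -> moll_cvg (\1_(A0 `&` C) : _ -> R).
Proof.
rewrite {1}measurable_rV_closed.
refine (@dynkin_induction _ 'rV[R]_d (@closed 'rV[R]_d) (fun A => moll_cvg (\1_(A `&` C) : _ -> R)) _ _ _ _ _ _ A0) => //.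
- exact: measurable_rV_closed.
- by move=> A B; exact: closedI.
- by rewrite setTI; apply: moll_cvg_compact; exact: compact_cube.
- move=> A cA; apply: moll_cvg_compact.
  apply: (@closed_cube_compact _ _ _ x0 r0); last exact: subIsetr.
  by apply: closedI => //; exact: closed_cube.
- move=> A mA cA.
  have iC : L1 (\1_C : _ -> R) by apply: L1_indic => //; exact: cube_ltoo.
  have cC : moll_cvg (\1_C : _ -> R) by apply: moll_cvg_compact; exact: compact_cube.
  rewrite (_ : (\1_(~` A `&` C) : _ -> R) = (fun x => \1_C x + - 1 * \1_(A `&` C) x)).
    by apply: moll_cvgD => //; [exact/L1Z/L1_sub|apply: moll_cvgZ => //; exact: L1_sub].
  apply/funext => x; rewrite !indicE !in_setI in_setC.
  by case: (x \in A); case: (x \in C); rewrite /=; ring.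
- move=> F mF tF cF.
  have mU : measurable (\bigcup_k F k) by exact: bigcup_measurable.
  pose S n := \big[setU/set0]_(k < n) F k.
  have mS n : measurable (S n) by apply: bigsetU_measurable.
  apply: moll_cvg_lim; first exact: L1_sub.
  move=> e e0.
  have SU n : S n `&` C `<=` (\bigcup_k F k) `&` C.
    by move=> x [Sx Cx]; split => //; move: Sx; rewrite /S -bigcup_mkord => -[k _ Fx]; exists k.
  have : (leb \o (fun n => S n `&` C)) n @[n --> \oo] --> leb (\bigcup_k F k `&` C).
    rewrite (_ : \bigcup_k F k `&` C = \bigcup_n (S n `&` C)).
      apply: nondecreasing_cvg_mu => //.
      - by move=> n; exact: measurableI.
      - by apply: bigcup_measurable => n _; exact: measurableI.
      - move=> n m nm; apply/subsetPset; apply: setSI.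
        exact: subset_bigsetU.
    rewrite -setI_bigcupl; congr (_ `&` _); apply/seteqP; split => x [k _].
      by move=> Fx; exists k.+1 => //; rewrite /S big_ord_recr/=; right.
    by rewrite /S -bigcup_mkord => -[j _ Fx]; exists j.
  have Ufin : leb (\bigcup_k F k `&` C) \is a fin_num by rewrite ge0_fin_numE// fin_sub.
  rewrite -(fineK Ufin) => /fine_cvgP[_] /cvgrPdist_le /(_ _ e0)[n _ /(_ n (leqnn n)) /= Sn].
  exists (\1_(S n `&` C)); split; first exact: L1_sub.
    rewrite (_ : \1_(S n `&` C) = (fun x => \sum_(k < n) \1_(F k `&` C) x)).
      by apply: moll_cvg_sum => k; [exact: L1_sub|exact: cF].
    apply/funext => x; rewrite /S; elim: n {Sn} => [|n IH].
      by rewrite !big_ord0 indicE set0I in_set0.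
    rewrite !big_ord_recr /= -IH !indicE !in_setI in_setU -natrD; congr _%:R.
    case: (boolP (x \in C)) => xC; rewrite ?andbF// !andbT.
    case: (boolP (x \in F n)) => xF; last by rewrite orbF addn0.
    rewrite orbT; suff -> : (x \in \big[setU/set0]_(i < n) F i) = false by [].
    apply/negbTE/negP; rewrite inE -bigcup_mkord => -[k /= kn Fk].
    have kE : k = n by apply: tF => //; exists x; split => //; exact: set_mem xF.
    by rewrite kE ltnn in kn.
  rewrite nrm_indicB//; try exact: measurableI; last exact: fin_sub.
  by rewrite (le_trans (ler_norm _)).
Qed.

Import HBSimple.

(** Simple functions are dense in L1. *)
Lemma moll_cvg_L1 F : L1 F -> (forall x, ~ C x -> F x = 0) -> moll_cvg F.
Proof.
move=> iF F0; apply: moll_cvg_lim => // e e0.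
have [g [ig _ gF]] := approximation_sfun_integrable measurableT iF.
have : \forall n \near \oo, (\int[leb]_z `|(F z)%:E - (g n z)%:E| < e%:E)%E.
  apply: (gF [set z | (z < e%:E)%E]); apply: open_nbhs_nbhs; split.
    exact: open_ereal_lt_ereal.
  by rewrite /= lte_fin.
move=> [n _ /(_ n (leqnn n)) /= gn].
have gE x : g n x = \sum_(y <- finmap.enum_fset (fset_set (range (g n)))) y * \1_(g n @^-1` [set y]) x.
  by rewrite {1}fimfunE fsbig_finite.
pose G x := \sum_(y <- finmap.enum_fset (fset_set (range (g n)))) y * \1_(g n @^-1` [set y] `&` C) x.
have mg (y : R) : measurable (g n @^-1` [set y]).
  by rewrite -[X in measurable X]setTI; exact: measurable_funP.
have iG : L1 G by apply: L1_sum => y; apply: L1Z; exact: L1_sub.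
exists G; split => //.
  apply: moll_cvg_sum => y; first by apply: L1Z; exact: L1_sub.
  by apply: moll_cvgZ; [exact: L1_sub|exact: moll_cvg_indic].
have iFg : L1 (fun x => F x - g n x) by apply: L1B => //; exact: ig.
apply: (@le_trans _ _ (nrm (fun x => F x - g n x))).
  apply: le_Rintegral => //; [by apply: L1_norm; exact: L1B|exact: L1_norm|].
  move=> x _; have [Cx|Cx] := pselect (C x).
    rewrite (_ : G x = g n x)// gE; apply: eq_bigr => y _.
    by rewrite !indicE in_setI (mem_set Cx) andbT.
  rewrite F0// (_ : G x = 0) ?subrr ?normr0//.
  by rewrite /G big1 // => y _; rewrite indicE in_setI (memNset Cx) andbF mulr0.
by rewrite -lee_fin -nrmE//; exact: ltW.
Qed.

End moll_cvg_L1.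

(** * Mollification of weak derivatives *)

Section moll_derive.
Context {R : realType} {d : nat}.
Local Notation leb := (@lebesgue_rV R d).
Implicit Types (F G : 'rV[R]_d -> R) (x y z v : 'rV[R]_d).

Variables (eta : R) (b : nat -> R -> R).
Hypothesis eta0 : 0 < eta.
Hypothesis bP : bump_family eta b.

(** Differentiation under the integral sign along a line, dominated by a multiple of
    [`|F|]; the sign comes from the argument [y - x] of the kernel. *)
Lemma is_derive_convol m F x v : L1 F ->
  is_derive x v (convol (kern b m) F) (- \sum_i v 0 i * convol (kern b (incr m i)) F x).
Proof.
move=> iF; apply/is_derive_line.
pose f (s : R) y := F y * kern b m (y - (x + s *: v)).
have [C /all_and2[C0 CP]] := choice (fun i => kern_bounded (d := d) bP (incr m i)).
have [C1 [_ C1P]] := kern_bounded (d := d) bP m.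
have E s y : y - x + s *: - v = y - (x + s *: v) by rewrite scalerN opprD addrA.
have D s y : is_derive s (1 : R) (f ^~ y)
    (F y * - \sum_i v 0 i * kern b (incr m i) (y - (x + s *: v))).
  have := is_derive_kern bP m (y - x + s *: - v) (- v).
  move=> /is_derive_line_shift h.
  have -> : f ^~ y = (F y *: (fun s => kern b m (y - x + s *: - v)))%R.
    by apply/funext => t; rewrite /f -E.
  apply: is_derive_eq; rewrite /GRing.scale/=; congr (_ * _); rewrite -sumrN.
  apply: eq_bigr => i _; rewrite mxE mulNr; by rewrite E.
have dE s y : partial1of2 f s y = F y * - \sum_i v 0 i * kern b (incr m i) (y - (x + s *: v)).
  by rewrite partial1of2E; have [_] := D s y.
pose G y := (\sum_i `|v 0 i| * C i) * `|F y|.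
have G0 y : 0 <= G y by rewrite mulr_ge0// sumr_ge0// => i _; rewrite mulr_ge0.
have iG : L1 G by apply/L1Z/L1_norm.
have intf s : `]-1, 1[%classic s -> L1 (f s).
  by move=> _; apply: (L1_convol (continuous_kern bP m) C1P).
have GB s y : `]-1, 1[%classic s -> [set: 'rV[R]_d] y -> `|partial1of2 f s y| <= G y.
  move=> _ _; rewrite dE normrM mulrC normrN ler_wpM2r//.
  rewrite (le_trans (ler_norm_sum _ _ _))// ler_sum// => i _.
  by rewrite normrM ler_wpM2l.
have I0 : `]-1, 1[%classic (0 : R) by rewrite /= in_itv/= ltrN10 ltr01.
have df s y : `]-1, 1[%classic s -> [set: 'rV[R]_d] y -> derivable (f ^~ y) s 1.
  by move=> _ _; have [] := D s y.
split.
  exact: (derivable_under_integral measurableT I0 intf df G0 iG GB).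
rewrite -derive1E (differentiation_under_integral measurableT I0 intf df G0 iG GB).
rewrite (eq_Rintegral _ _ (g := fun y => - \sum_i v 0 i * (F y * kern b (incr m i) (y - x)))); last first.
  move=> y _; rewrite dE scale0r addr0 mulrN mulr_sumr; congr (- _).
  by apply: eq_bigr => i _; rewrite mulrCA.
have iK i : L1 (fun y => F y * kern b (incr m i) (y - x)).
  by apply: (L1_convol (continuous_kern bP _) (CP i)).
under eq_Rintegral do rewrite -mulN1r.
rewrite RintegralZl//; last by apply: L1_sum => i; exact: L1Z.
rewrite mulN1r; congr (- _).
have RS (r : seq 'I_d) : \int[leb]_y (\sum_(i <- r) v 0 i * (F y * kern b (incr m i) (y - x))) =
    \sum_(i <- r) v 0 i * convol (kern b (incr m i)) F x.
  elim: r => [|i r IH].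
    by under eq_Rintegral do rewrite big_nil; rewrite big_nil /Rintegral integral0_eq.
  under eq_Rintegral do rewrite big_cons.
  rewrite RintegralD//; [|exact: L1Z|by apply: L1_sum => j; exact: L1Z].
  by rewrite IH big_cons RintegralZl//; exact: iK.
exact: RS.
Qed.

(** Convexity of the power: in the induction, multiplying by [a] leaves the square [n.+1
    * m ^+ n * (a - m) ^+ 2]. *)
Lemma tangent_pow n (a m : R) : 0 <= a -> 0 <= m ->
  m ^+ n.+1 + n.+1%:R * m ^+ n * (a - m) <= a ^+ n.+1.
Proof.
move=> a0 m0; elim: n => [|n IH].
  by rewrite !expr1 expr0 mulr1 mul1r addrC subrK.
rewrite [leRHS]exprS; apply: le_trans (ler_wpM2l a0 IH).
rewrite -subr_ge0 (_ : _ - _ = n.+1%:R * m ^+ n * (a - m) ^+ 2).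
  by rewrite mulr_ge0 ?sqr_ge0// mulr_ge0// exprn_ge0.
by rewrite !exprS -[n.+2%:R]natr1; ring.
Qed.

(** Jensen's inequality for the probability density [kern / mass]: average the tangent
    inequality at the mean value of [F]. *)
Lemma moll_jensen n F x : L1 F -> (forall y, 0 <= F y) -> L1 (fun y => F y ^+ n.+1) ->
  moll b F x ^+ n.+1 <= moll b (fun y => F y ^+ n.+1) x.
Proof.
move=> iF F0 iFn.
have m0 : 0 <= moll b F x.
  apply: le_trans (normr_ge0 (moll b F x)) _; apply: le_trans (moll_norm_le eta0 bP x iF) _.
  by rewrite (eq_moll eta0 bP (G := F))// => y _; rewrite ger0_norm.
set m := moll b F x in m0 *.
have ic := L1_indic (measurable_cube x eta) (cube_ltoo x eta).
have m1 : moll b \1_(cube x eta) x = 1.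
  by apply: (moll_cst eta0 bP) => y xy; rewrite indicE mem_set.
have i1 : L1 (fun y => m ^+ n.+1 * \1_(cube x eta) y) by exact: L1Z.
have i2 : L1 (fun y => F y - m * \1_(cube x eta) y) by apply: L1B => //; exact: L1Z.
have i3 : L1 (fun y => (n.+1%:R * m ^+ n) * (F y - m * \1_(cube x eta) y)) by exact: L1Z.
have -> : m ^+ n.+1 = moll b (fun y => m ^+ n.+1 * \1_(cube x eta) y +
    (n.+1%:R * m ^+ n) * (F y - m * \1_(cube x eta) y)) x.
  rewrite (mollD bP)// (mollZ bP)// m1 mulr1 (mollZ bP)// (mollB bP)//; last exact: L1Z.
  by rewrite (mollZ bP)// m1 mulr1 -/m subrr mulr0 addr0.
apply: (moll_le eta0 bP) => //; first exact: L1D.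
move=> y xy; rewrite indicE mem_set// !mulr1; exact: tangent_pow.
Qed.

(** Testing a weak derivative with translates of the kernel moves the derivations to the
    kernel. *)
Lemma weak_derivative_convol (D K : set 'rV[R]_d) (s : seq 'I_d) m f g x :
  open D -> K `<=` D -> weak_derivative D s f g -> cube x eta `<=` K ->
  convol (kern b (fun i => count_mem i s + m i)%N) (f \_ K) x =
  (-1) ^+ size s * convol (kern b m) (g \_ K) x.
Proof.
move=> oD KD [_ _ W] xK.
have := W _ (kern_test_function eta0 bP m (subset_trans xK KD)).
rewrite (partials_kern bP) => E.
have pE (h : 'rV[R]_d -> R) k : \int[leb]_y ((h \_ K) y * kern b k (y - x)) =
    \int[leb]_(y in D) (h y * kern b k (y - x)).
  rewrite [RHS]Rintegral_mkcond; apply: eq_Rintegral => y _; rewrite /patch.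
  have [yK|yK] := boolP (y \in K).
    by rewrite ifT// inE; apply: KD; exact: set_mem.
  rewrite mul0r; case: ifP => // _.
  rewrite (kern_out eta0 bP) ?mulr0// leNgt; apply: contra yK => /ltW yx.
  by apply/mem_set/xK.
by rewrite /convol !pE.
Qed.

(** The sign in [is_derive_convol] cancels the one of [weak_derivative_convol]. *)
Lemma is_derive_moll (D K : set 'rV[R]_d) f (g : 'I_d -> 'rV[R]_d -> R) x v :
  open D -> K `<=` D -> L1 (f \_ K) -> (forall i, weak_derivative D [:: i] f (g i)) ->
  cube x eta `<=` K ->
  is_derive x v (moll b (f \_ K)) (\sum_i v 0 i * moll b (g i \_ K) x).
Proof.
move=> oD KD iF W xK.
have h := is_derive_convol (fun=> 0%N) x v iF.
have -> : moll b (f \_ K) = ((@mass R d b)^-1 *: convol (kern b (fun=> 0%N)) (f \_ K))%R.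
  by apply/funext => y; rewrite /moll /= mulrC.
apply: is_derive_eq; rewrite /GRing.scale/= mulrN -mulrN -sumrN mulr_sumr.
apply: eq_bigr => i _; rewrite /moll.
have := weak_derivative_convol (fun=> 0%N) oD KD (W i) xK.
rewrite (_ : (fun _ => _) = incr (fun=> 0%N) i); last first.
  by apply/funext => j; rewrite /incr /= addn0.
move=> ->; rewrite /= expr1 mulN1r; ring.
Qed.

(** The second derivatives are given as weak derivatives of [f], not of the first
    derivative [g]; both sides are therefore computed as integrals of [f] against second
    derivatives of the kernel. *)
Lemma weak_derivative_step (D K : set 'rV[R]_d) f g (h : 'I_d -> 'I_d -> 'rV[R]_d -> R) i x v :
  open D -> K `<=` D -> L1 (g \_ K) -> weak_derivative D [:: i] f g ->
  (forall j, weak_derivative D [:: i; j] f (h i j)) ->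
  cube x eta `<=` K ->
  is_derive x v (moll b (g \_ K)) (\sum_j v 0 j * moll b (h i j \_ K) x).
Proof.
move=> oD KD iG W1 W2 xK.
have D1 := is_derive_convol (fun=> 0%N) x v iG.
have -> : moll b (g \_ K) = ((@mass R d b)^-1 *: convol (kern b (fun=> 0%N)) (g \_ K))%R.
  by apply/funext => y; rewrite /moll /= mulrC.
apply: is_derive_eq; rewrite /GRing.scale/= mulrN -mulrN -sumrN mulr_sumr.
apply: eq_bigr => j _; rewrite /moll.
have E1 := weak_derivative_convol (incr (fun=> 0%N) j) oD KD W1 xK.
have E2 := weak_derivative_convol (fun=> 0%N) oD KD (W2 j) xK.
have e1 : (fun k => count_mem k [:: i] + incr (fun=> 0) j k)%N = incr (incr (fun=> 0%N) j) i.
  by apply/funext => k; rewrite /incr /= !addn0.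
have e2 : (fun k => count_mem k [:: i; j] + 0)%N = incr (incr (fun=> 0%N) j) i.
  by apply/funext => k; rewrite /incr /= !addn0.
move: E1 E2; rewrite e1 e2 /= expr1 mulN1r sqrrN expr1n mul1r.
by move=> -> <-; ring.
Qed.

(** Both sides are integrals of [f] against the same second derivative of the kernel,
    since a multi-index forgets the order of derivation. *)
Lemma moll_hessian_sym (D K : set 'rV[R]_d) f (h : 'I_d -> 'I_d -> 'rV[R]_d -> R) i j x :
  open D -> K `<=` D -> (forall i j, weak_derivative D [:: i; j] f (h i j)) ->
  cube x eta `<=` K -> moll b (h i j \_ K) x = moll b (h j i \_ K) x.
Proof.
move=> oD KD W xK; rewrite /moll; congr (_ / _).
have E1 := weak_derivative_convol (fun=> 0%N) oD KD (W i j) xK.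
have E2 := weak_derivative_convol (fun=> 0%N) oD KD (W j i) xK.
move: E1 E2; rewrite /= sqrrN expr1n !mul1r => <- <-.
by congr convol; congr kern; apply/funext => k; rewrite addnCA.
Qed.

(** Any representative of a weak derivative has the same mollification, so the one of
    class [locLp D p] may be exchanged with the given one. *)
Lemma moll_same_weak (D K : set 'rV[R]_d) (s : seq 'I_d) f g g' x :
  open D -> K `<=` D -> weak_derivative D s f g -> weak_derivative D s f g' ->
  cube x eta `<=` K -> moll b (g \_ K) x = moll b (g' \_ K) x.
Proof.
move=> oD KD W W' xK; rewrite /moll; congr (_ / _).
have E1 := weak_derivative_convol (fun=> 0%N) oD KD W xK.
have E2 := weak_derivative_convol (fun=> 0%N) oD KD W' xK.
by apply: (@mulfI _ ((-1) ^+ size s)); rewrite ?signr_eq0 // -E1 -E2.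
Qed.

Lemma moll_close F (tau : R) x : L1 F ->
  (forall y, cube x eta y -> `|F y - F x| <= tau) -> `|moll b F x - F x| <= tau.
Proof.
move=> iF Ft.
have ic := L1_indic (measurable_cube x eta) (cube_ltoo x eta).
have mc c : moll b (fun y => c * \1_(cube x eta) y) x = c.
  by apply: (moll_cst eta0 bP) => y xy; rewrite indicE mem_set// mulr1.
rewrite ler_distl; apply/andP; split.
  rewrite -[leLHS]mc; apply: (moll_le eta0 bP) => //; first exact: L1Z.
  by move=> y xy; rewrite indicE mem_set// mulr1; have := Ft _ xy; rewrite ler_distl => /andP[].
rewrite -[leRHS]mc; apply: (moll_le eta0 bP) => //; first exact: L1Z.
by move=> y xy; rewrite indicE mem_set// mulr1; have := Ft _ xy; rewrite ler_distl => /andP[].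
Qed.

End moll_derive.

(** * The area estimate *)

Section area.
Context {R : realType} {d : nat}.
Local Notation leb := (@lebesgue_rV R d).
Implicit Types (x y z : 'rV[R]_d) (S E : set 'rV[R]_d).

(** The cube of side [n.+1^-1] and corner [a / n.+1 - N]; half-open, so that cells are
    disjoint. *)
Definition cell N n (a : 'I_d -> nat) : set 'rV[R]_d :=
  [set x | forall i, (a i)%:R <= (x 0 i + N%:R) * n.+1%:R < (a i).+1%:R].

Lemma cellE N n a : cell N n a = [set x | forall i,
  `[(a i)%:R / n.+1%:R - N%:R, (a i).+1%:R / n.+1%:R - N%:R[%classic (x 0 i)].
Proof.
have n0 : 0 < n.+1%:R :> R by rewrite ltr0n.
by apply/seteqP; split => x h i; have := h i; rewrite /= in_itv/= lerBlDr ltrBrDr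
  ler_pdivrMr// ltr_pdivlMr.
Qed.

Lemma measurable_box (A : 'I_d -> set R) : (forall i, measurable (A i)) ->
  measurable [set x : 'rV[R]_d | forall i, A i (x 0 i)].
Proof.
move=> mA; have -> : [set x : 'rV[R]_d | forall i, A i (x 0 i)] =
    \big[setI/setT]_(i < d) ((fun x : 'rV[R]_d => x 0 i) @^-1` A i).
  rewrite -bigcap_seq; apply/seteqP; split=> [x xA i _|x xA i]; first exact: xA.
  by apply: xA; rewrite /= mem_index_enum.
apply: bigsetI_measurable => i _; rewrite -[X in measurable X]setTI.
by apply: continuous_measurable_rV_R => //; exact: coord_continuous.
Qed.

Lemma measurable_cell N n a : measurable (cell N n a).
Proof. by rewrite cellE; apply: (measurable_box (A := fun i => `[_, _[%classic)). Qed.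

Lemma lebesgue_cell N n a : leb (cell N n a) = (n.+1%:R^-1 ^+ d)%:E.
Proof.
rewrite cellE (lebesgue_rV_box (A := fun i => `[(a i)%:R / n.+1%:R - N%:R,
  (a i).+1%:R / n.+1%:R - N%:R[%classic)); last by [].
under eq_bigr => i _.
  rewrite lebesgue_measure_itv/= (_ : (if _ then _ else _) = (n.+1%:R^-1)%:E); last first.
    rewrite lte_fin ltrD2r ltr_pM2r ?invr_gt0 ?ltr0n// ltr_nat ltnSn -EFinB.
    by congr EFin; rewrite -[(a i).+1%:R]natr1; ring.
  over.
by rewrite prodEFin prodr_const card_ord.
Qed.

Lemma cell_diam N n a x y : cell N n a x -> cell N n a y -> `|x - y| <= n.+1%:R^-1.
Proof.
move=> xa ya; apply/rV_norm_leP => // i; have := xa i; have := ya i; rewrite !mxE.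
have n0 : 0 < n.+1%:R :> R by rewrite ltr0n.
rewrite -[(a i).+1%:R]natr1 => /andP[y1 y2] /andP[x1 x2].
rewrite -(ler_pM2r n0) mulVf ?gt_eqF// -[X in _ * X <= _](gtr0_norm n0) -normrM ler_norml.
apply/andP; split; lra.
Qed.

Lemma cell_disjoint N n a a' x : cell N n a x -> cell N n a' x -> a =1 a'.
Proof.
move=> xa xa' i; have /andP[h1 h2] := xa i; have /andP[h3 h4] := xa' i.
have := le_lt_trans h1 h4; have := le_lt_trans h3 h2; rewrite !ltr_nat !ltnS => ? ?.
by apply/eqP; rewrite eqn_leq; apply/andP.
Qed.

Lemma cell_cover N n x : `|x| <= N%:R ->
  exists a : {ffun 'I_d -> 'I_((N + N) * n.+1).+1}, cell N n (fun i => a i) x.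
Proof.
move=> xN; have n0 : 0 < n.+1%:R :> R by rewrite ltr0n.
have h i : 0 <= (x 0 i + N%:R) * n.+1%:R <= ((N + N) * n.+1)%:R.
  have := le_trans (rV_coord_le x i) xN; rewrite ler_norml => /andP[x1 x2].
  rewrite mulr_ge0//; last by rewrite -lerBlDr sub0r.
  by rewrite natrM ler_pM2r// natrD lerD2r.
have k i : exists k : 'I_((N + N) * n.+1).+1,
    k%:R <= (x 0 i + N%:R) * n.+1%:R < k.+1%:R.
  have /andP[h0 h1] := h i; have /andP[t1 t2] := truncn_itv h0.
  have tk : (Num.Def.trunc ((x 0 i + N%:R) * n.+1%:R)%R < ((N + N) * n.+1).+1)%N.
    by rewrite ltnS -(ler_nat R) (le_trans t1).
  by exists (Ordinal tk); rewrite /= t1 t2.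
have [a aP] := choice k; exists [ffun i => a i] => i /=.
by rewrite ffunE.
Qed.

Lemma measure_bigsetU_le (T : Type) (s : seq T) (A : T -> set 'rV[R]_d) :
  (forall a, measurable (A a)) ->
  (leb (\big[setU/set0]_(a <- s) A a) <= \sum_(a <- s) leb (A a))%E.
Proof.
move=> mA; elim: s => [|a s IH]; first by rewrite !big_nil measure0.
rewrite !big_cons; apply: le_trans (measureU2 _ _ _) _ => //; first exact: bigsetU_measurable.
exact: leeD2l.
Qed.

Variables (f : 'rV[R]_d -> 'rV[R]_d) (H : 'rV[R]_d -> R) (E S : set 'rV[R]_d) (L : R).
Hypothesis L0 : 0 <= L.
Hypothesis H0 : forall x, 0 <= H x.
Hypothesis HL : forall x y, `|H x - H y| <= L * `|x - y|.
Hypothesis mS : measurable S.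
Hypothesis SE : S `<=` f @` E.

(** Cover [E] by the cells of side [n.+1^-1] that it meets. The image of such a cell is
    in a cube centered at the image of one of its points of [E]; its side is at most
    twice the side of the cell times the local Lipschitz constant, whence the factor [2
    ^+ d]. In [2 * L / n.+1] one half is the correction of that constant and the other
    one the oscillation of [H] on the cell. *)
Lemma area_step N n : E `<=` cube 0 N%:R ->
  (forall x y, E x -> E y -> `|x - y| <= n.+1%:R^-1 -> `|f x - f y| <= `|x - y| * (H x + L * `|x - y|)) ->
  exists G, [/\ measurable G, E `<=` G,
    forall y, G y -> exists2 x, E x & `|x - y| <= n.+1%:R^-1 &
    (leb S <= (2 ^+ d)%:E * \int[leb]_(y in G) ((H y + 2 * L / n.+1%:R) ^+ d)%:E)%E].
Proof.
move=> EN fE; set e := n.+1%:R^-1 : R.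
have e0 : 0 < e by rewrite invr_gt0 ltr0n.
pose T := {ffun 'I_d -> 'I_((N + N) * n.+1).+1}.
pose P (a : T) := `[< E `&` cell N n (fun i => a i) !=set0 >].
pose s := [seq a <- enum T | P a].
have us : uniq s by rewrite filter_uniq// enum_uniq.
have cP (a : T) : exists x, P a -> E x /\ cell N n (fun i => a i) x.
  rewrite /P; case: asboolP => [[x [Ex ax]]|_]; first by exists x.
  by exists 0.
have [c cE] := choice cP.
pose G := \big[setU/set0]_(a <- s) cell N n (fun i => a i).
have mcell (a : T) : measurable (cell N n (fun i => a i)) by exact: measurable_cell.
have GP y : G y <-> exists2 a : T, P a & cell N n (fun i => a i) y.
  rewrite /G -bigcup_seq; split => [[a /=]|[a Pa ya]].
    by rewrite mem_filter => /andP[Pa _] ya; exists a.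
  by exists a => //=; rewrite mem_filter Pa mem_enum.
have EG : E `<=` G.
  move=> x Ex; have [a ax] : exists a : T, cell N n (fun i => a i) x.
    by apply: cell_cover; have := EN _ Ex; rewrite /cube/= subr0.
  by apply/GP; exists a => //; apply/asboolP; exists x.
exists G; split => //.
- exact: bigsetU_measurable.
- move=> y /GP[a Pa ya]; exists (c a); first by have [] := cE _ Pa.
  by apply: (@cell_diam N n (fun i => a i)) => //; have [] := cE _ Pa.
have mg D' : measurable D' ->
    measurable_fun D' (fun y => ((H y + 2 * L / n.+1%:R) ^+ d)%:E).
  move=> mD'; apply: (@measurable_funS _ _ _ _ setT) => //.
  apply/measurable_EFinP/measurable_funX/measurable_funD => //.
  by apply: continuous_measurable_rV_R; exact: continuous_lipschitz HL.
have g0 y : 0 <= H y + 2 * L / n.+1%:R by rewrite addr_ge0// divr_ge0// mulr_ge0.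
pose rad a := e * (H (c a) + L * e).
have rad0 a : 0 <= rad a by rewrite mulr_ge0 ?addr_ge0 ?mulr_ge0 ?(ltW e0).
have Scov : S `<=` \big[setU/set0]_(a <- s) cube (f (c a)) (rad a).
  move=> z /SE[x Ex <-]; rewrite -bigcup_seq.
  have /GP[a Pa ax] := EG _ Ex; exists a; first by rewrite /= mem_filter Pa mem_enum.
  have [Ec ac] := cE _ Pa; rewrite /cube /= distrC.
  have ce := cell_diam ac ax; rewrite (le_trans (fE _ _ Ec Ex ce))//.
  rewrite ler_pM ?addr_ge0 ?mulr_ge0// lerD2l ler_wpM2l//.
apply: (@le_trans _ _ (\sum_(a <- s) leb (cube (f (c a)) (rad a)))%E).
  apply: le_trans (measure_bigsetU_le _ _); last by move=> a; exact: measurable_cube.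
  by apply: le_measure; rewrite ?inE//; apply: bigsetU_measurable => a _; exact: measurable_cube.
have tI : trivIset [set` s] (fun a : T => cell N n (fun i => a i)).
  move=> a a' _ _ [x [ax a'x]]; apply/ffunP => i; apply/val_inj.
  exact: (cell_disjoint ax a'x i).
have mG : measurable G by exact: bigsetU_measurable.
rewrite (ge0_integral_bigsetU leb mcell us tI (mg _ mG)); last first.
  by move=> x _; rewrite lee_fin exprn_ge0.
rewrite ge0_sume_distrr; last first.
  by move=> a _; apply: integral_ge0 => x _; rewrite lee_fin exprn_ge0.
rewrite big_seq [leRHS]big_seq; apply: lee_sum => a.
rewrite mem_filter => /andP[Pa _].
rewrite lebesgue_rV_cube// exprMn EFinM lee_pmul2l//.
apply: (@le_trans _ _ (\int[leb]_(y in cell N n (fun i => a i)) (cst ((H (c a) + L * e) ^+ d)%:E) y)%E).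
  rewrite integral_cst// [X in (_ * X)%E]lebesgue_cell -EFinM lee_fin /rad exprMn.
  by rewrite mulrC.
apply: ge0_le_integral => //.
- by move=> y _; rewrite lee_fin exprn_ge0// addr_ge0// mulr_ge0// ltW.
- exact: mg.
- move=> y ya; rewrite lee_fin lerXn2r ?nnegrE//; first by rewrite addr_ge0// mulr_ge0// ltW.
  have [Ec ac] := cE _ Pa; have := HL (c a) y; have ce := cell_diam ac ya.
  have := ler_wpM2l L0 ce; rewrite -/e ler_distl => h1 /andP[_ h2].
  rewrite -mulrA -/e; lra.
Qed.

(** A one-sided area formula: [H] is a local Lipschitz constant of [f], and [2 ^+ d]
    comes from covering images by cubes. The unions of cells in [area_step] shrink to
    the closed set [E], and dominated convergence applies. *)
Lemma area_estimate : compact E ->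
  (exists2 e, 0 < e & forall x y, E x -> E y -> `|x - y| <= e ->
     `|f x - f y| <= `|x - y| * (H x + L * `|x - y|)) ->
  (leb S <= (2 ^+ d)%:E * \int[leb]_(y in E) (H y ^+ d)%:E)%E.
Proof.
move=> cE [e e0 fE].
have clE : closed E by exact: compact_closed (@norm_hausdorff _ _) cE.
have mE : measurable E by exact: measurable_closed_rV.
have [N EN] : exists N : nat, E `<=` cube 0 N%:R.
  have [M [_ HM]] := compact_bounded cE.
  exists (Num.Def.trunc (`|M| + 1)).+1 => x Ex.
  rewrite /cube/= subr0; apply: le_trans (HM (`|M| + 1) _ _ Ex) _.
    by rewrite (le_lt_trans (ler_norm _))// ltrDl.
  have /truncn_itv /andP[_ /ltW] : 0 <= `|M| + 1 by rewrite addr_ge0.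
  by [].
have [n0 n0e] : exists n0 : nat, forall n, (n0 <= n)%N -> n.+1%:R^-1 <= e.
  have [k _ kP] := near_infty_natSinv_lt (PosNum e0); exists k => n /kP /= /ltW; exact.
have G_ n : exists G, [/\ measurable G, E `<=` G,
    forall y, G y -> exists2 x, E x & `|x - y| <= (n0 + n).+1%:R^-1 &
    (leb S <= (2 ^+ d)%:E * \int[leb]_(y in G) ((H y + 2 * L / (n0 + n).+1%:R) ^+ d)%:E)%E].
  apply: area_step EN _ => x y Ex Ey xy; apply: fE => //.
  by apply: le_trans xy _; apply: n0e; exact: leq_addr.
have [G GP] := choice G_.
have mH : measurable_fun setT H.
  by apply: continuous_measurable_rV_R; exact: continuous_lipschitz HL.
(* shifting by [n0] makes the cells smaller than the scale [e] of the local estimate *)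
pose g n y : \bar R := (((H y + 2 * L / (n0 + n).+1%:R) ^+ d) * \1_(G n) y)%:E.
pose g' y : \bar R := (H y ^+ d * \1_E y)%:E.
pose B := (H 0 + L * (N%:R + 1) + 2 * L) ^+ d.
have gE (G' : set 'rV[R]_d) (h : 'rV[R]_d -> R) : (\int[leb]_y (h y * \1_G' y)%:E = \int[leb]_(y in G') (h y)%:E)%E.
  rewrite [RHS]integral_mkcond; apply: eq_integral => y _; rewrite /patch indicE.
  by case: ifPn => _; rewrite ?mulr1 ?mulr0.
have cv : (\int[leb]_y g n y @[n --> \oo] --> \int[leb]_y g' y)%E.
  apply: (@dominated_cvg _ _ _ leb _ measurableT g g' (fun y => (B * \1_(cube 0 (N%:R + 1)) y)%:E)) => //.
  - move=> n; apply/measurable_EFinP/measurable_funM.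
      by apply/measurable_funX/measurable_funD.
    by apply: measurable_indic; have [] := GP n.
  - move=> y _; apply: cvg_EFin; first exact: nearW.
    have [Ey|Ey] := pselect (E y).
      have h : (fun n => H y + 2 * L * (n0 + n).+1%:R^-1) @ \oo --> H y + 2 * L * 0.
        apply: cvgD; [exact: cvg_cst|apply: cvgMr].
        have := @cvg_harmonic R; rewrite -(cvg_shiftn n0).
        by under eq_fun do rewrite /harmonic addnC.
      move: h; rewrite mulr0 addr0 => /(continuous_cvg _ (@exprn_continuous _ d (H y))) h.
      rewrite indicE mem_set// mulr1; apply: cvg_trans h.
      apply: near_eq_cvg; apply: nearW => n; rewrite /g /= indicE mem_set ?mulr1//.
      by have [_ + _ _] := GP n; apply.
    rewrite indicE memNset// mulr0.
    have [r r0 rE] : exists2 r, 0 < r & forall x, E x -> r <= `|x - y|.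
      have /nbhs_ballP[r /= r0 rE] : nbhs y (~` E).
        by apply: open_nbhs_nbhs; split => //; exact: closed_openC.
      exists r => // x Ex; rewrite leNgt; apply/negP => xy.
      by apply: (rE x) => //; rewrite -ball_normE /= distrC.
    apply: (@cvg_trans _ ((fun=> 0 : R) @ \oo)); last exact: cvg_cst.
    apply: near_eq_cvg; have [k _ kP] := near_infty_natSinv_lt (PosNum r0).
    exists k => // n kn; rewrite /g /= indicE memNset ?mulr0// => Gy.
    have [_ _ /(_ _ Gy)[x Ex xy] _] := GP n.
    have := kP (n0 + n)%N (leq_trans kn (leq_addl _ _)); rewrite /= => /(le_lt_trans xy).
    by rewrite ltNge rE.
  - by apply: L1Z; apply: L1_indic; [exact: measurable_cube|exact: cube_ltoo].
  - move=> n y _; rewrite /g lee_fin.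
    have p0 : 0 <= H y + 2 * L / (n0 + n).+1%:R by rewrite addr_ge0// divr_ge0// mulr_ge0.
    rewrite ger0_norm; last by rewrite mulr_ge0// exprn_ge0.
    have B0 : 0 <= H 0 + L * (N%:R + 1) + 2 * L by rewrite !addr_ge0// !mulr_ge0// addr_ge0.
    have [Gy|Gy] := pselect (G n y); last first.
      by rewrite indicE memNset// mulr0 mulr_ge0// exprn_ge0.
    have i1 : (n0 + n).+1%:R^-1 <= 1 :> R by rewrite invf_le1 ?ler1n ?ltr0n.
    have yN : `|y| <= N%:R + 1.
      have [_ _ /(_ _ Gy)[x Ex xy] _] := GP n.
      rewrite -[y](subrK x) addrC (le_trans (ler_normD _ _))// lerD//.
        by have := EN _ Ex; rewrite /cube/= subr0.
      by rewrite distrC (le_trans xy).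
    rewrite !indicE !mem_set//; last by rewrite /cube/= subr0.
    rewrite !mulr1 lerXn2r ?nnegrE// lerD//; last by rewrite -[leRHS]mulr1 ler_wpM2l// mulr_ge0.
    have := HL y 0; rewrite subr0 ler_distl => /andP[_ h]; apply: le_trans h _.
    by rewrite lerD2l ler_wpM2l.
have -> : (\int[leb]_(y in E) (H y ^+ d)%:E = \int[leb]_y g' y)%E by rewrite /g' gE.
have cv2 : ((2 ^+ d)%:E * \int[leb]_y g n y @[n --> \oo] --> (2 ^+ d)%:E * \int[leb]_y g' y)%E.
  exact: cvgeZl.
rewrite -(cvg_lim _ cv2)//; apply: lime_ge; first by apply/cvg_ex; eexists; exact: cv2.
by apply: nearW => n; rewrite /g gE; have [] := GP n.
Qed.

End area.

(** * Trace of a product of nonnegative forms *)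

Section trace.
Context {R : realFieldType} {n : nat}.
Implicit Types (P q : 'I_n -> 'I_n -> R) (x : 'I_n -> R).

Definition quad P x : R := \sum_i \sum_j P i j * x i * x j.

Lemma sum_delta (f : 'I_n -> R) k : \sum_i f i * (i == k)%:R = f k.
Proof.
by rewrite (bigD1 k)//= eqxx mulr1 big1 ?addr0// => i /negPf ->; rewrite mulr0.
Qed.

Lemma quad_shift P x t k : (forall i j, P i j = P j i) ->
  quad P (fun i => x i + t * (i == k)%:R) =
  quad P x + 2 * t * (\sum_j P k j * x j) + t ^+ 2 * P k k.
Proof.
move=> Psym; rewrite /quad.
have -> : \sum_i \sum_j P i j * (x i + t * (i == k)%:R) * (x j + t * (j == k)%:R) =
  \sum_i \sum_j P i j * x i * x j + \sum_i (t * x i * P i k)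
  + \sum_i (\sum_j t * P i j * x j) * (i == k)%:R + \sum_i (t ^+ 2 * P i k) * (i == k)%:R.
  rewrite -!big_split/=; apply: eq_bigr => i _.
  rewrite -(sum_delta (fun j => t * x i * P i j)).
  rewrite -(sum_delta (fun j => t ^+ 2 * P i j)) !mulr_suml -!big_split/=.
  by apply: eq_bigr => j _; ring.
rewrite !sum_delta; congr (_ + _); rewrite -addrA; congr (_ + _).
rewrite -mulrA mulr2n mulrDl mul1r; congr (_ + _).
  by rewrite mulr_sumr; apply: eq_bigr => i _; rewrite Psym; ring.
by rewrite mulr_sumr; apply: eq_bigr => i _; ring.
Qed.

Lemma quad_delta P k : (forall i j, P i j = P j i) ->
  quad P (fun i => (i == k)%:R) = P k k.
Proof.
move=> Ps; have := quad_shift (fun=> 0) 1 k Ps.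
have -> : quad P (fun=> 0) = 0.
  by rewrite /quad big1// => i _; rewrite big1// => j _; rewrite mulr0.
have -> : \sum_j P k j * 0 = 0 by rewrite big1// => j _; rewrite mulr0.
rewrite expr1n mul1r mulr0 !add0r => <-.
by apply: eq_bigr => i _; apply: eq_bigr => j _; rewrite !add0r !mul1r.
Qed.

(** Eliminating one variable at a time writes the symmetric form as a sum of squares of
    linear forms, and the square of a linear form contributes the value of [q] at its
    coefficients. *)
Lemma trace_mul_ge0 q P : (forall x, 0 <= quad q x) ->
  (forall i j, P i j = P j i) -> (forall x, 0 <= quad P x) ->
  0 <= \sum_i \sum_j q i j * P i j.
Proof.
move=> q0; suff H m : (m <= n)%N -> forall P, (forall i j, P i j = P j i) ->
    (forall x, 0 <= quad P x) -> (forall i j : 'I_n, (i < n - m)%N -> P i j = 0) ->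
    0 <= \sum_i \sum_j q i j * P i j.
  by move=> Ps P0; apply: (H n) => // i j; rewrite subnn.
elim: m => [_ {}P Ps P0 Pz|m IH mn {}P Ps P0 Pz].
  by apply: sumr_ge0 => i _; apply: sumr_ge0 => j _; rewrite Pz ?mulr0// subn0.
have kn : (n - m.+1 < n)%N by rewrite ltn_subrL (leq_ltn_trans _ mn).
pose k := Ordinal kn.
have rowS (Q : 'I_n -> 'I_n -> R) : (forall i j : 'I_n, (i < n - m.+1)%N -> Q i j = 0) ->
    (forall j, Q k j = 0) -> forall i j : 'I_n, (i < n - m)%N -> Q i j = 0.
  move=> Q1 Q2 i j; rewrite -(subnSK mn) ltnS leq_eqVlt => /predU1P[ik|]; last exact: Q1.
  by rewrite (_ : i = k)//; exact/val_inj.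
have Pkk : 0 <= P k k by rewrite -quad_delta.
have [Pk0|Pk] := eqVneq (P k k) 0.
  apply: (IH (ltnW mn) P) => //; apply: rowS => // j; apply/eqP/negPn/negP => c0.
  (* a zero on the diagonal forces a zero row: otherwise the form is -1 at [e_j + t e_k] *)
  pose t := - (P j j + 1) / (2 * P k j).
  have := P0 (fun i => (i == j)%:R + t * (i == k)%:R).
  rewrite quad_shift// quad_delta// Pk0 mulr0 addr0 sum_delta.
  have -> : P j j + 2 * t * P k j = - 1 by rewrite /t; field.
  by rewrite oppr_ge0 ler10.
have a0 : 0 < P k k by rewrite lt_def Pk.
(* completing the square: the Schur complement is nonnegative and has a zero row [k] *)
pose P' i j := P i j - P k i * P k j / P k k.
have P's i j : P' i j = P' j i by rewrite /P' Ps [P k i * _]mulrC.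
have E : \sum_i \sum_j q i j * P i j =
    \sum_i \sum_j q i j * P' i j + (P k k)^-1 * quad q (P k).
  rewrite /quad mulr_sumr -big_split/=; apply: eq_bigr => i _.
  rewrite mulr_sumr -big_split/=; apply: eq_bigr => j _; rewrite /P'; ring.
rewrite E addr_ge0//; last by rewrite mulr_ge0// invr_ge0.
apply: (IH (ltnW mn)) => //.
  move=> x; set s := \sum_j P k j * x j.
  have := P0 (fun i => x i + - (s / P k k) * (i == k)%:R).
  rewrite quad_shift// -/s (_ : quad P' x = quad P x - s ^+ 2 / P k k).
    by rewrite (_ : _ + _ + _ = quad P x - s ^+ 2 / P k k)//; field.
  have -> : s ^+ 2 / P k k = \sum_i P k i * x i * (s / P k k).
    by rewrite -mulr_suml -/s; ring.
  rewrite /quad -sumrB; apply: eq_bigr => i _.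
  rewrite /s mulr_suml mulr_sumr -sumrB; apply: eq_bigr => j _.
  by rewrite /P'; ring.
apply: rowS => [i j ik|j]; rewrite /P'.
  by rewrite Pz// Ps Pz// !mul0r subrr.
by rewrite mulrAC divff// mul1r subrr.
Qed.
End trace.

(** * The jump part at a contact point *)

Section jump.
Context {R : realType} {d : nat}.
Implicit Types (x y z : 'rV[R]_d).

Definition sqnorm y : R := \sum_i y 0 i ^+ 2.

Lemma enorm_sqr y : enorm y ^+ 2 = sqnorm y.
Proof. by rewrite /enorm sqr_sqrtr// sumr_ge0// => i _; exact: sqr_ge0. Qed.

Lemma sqnorm_ge0 y : 0 <= sqnorm y.
Proof. by rewrite sumr_ge0// => i _; exact: sqr_ge0. Qed.

Lemma norm_le_enorm y : `|y| <= enorm y.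
Proof.
apply/rV_norm_leP; first exact: sqrtr_ge0.
move=> i; rewrite -sqrtr_sqr; apply: ler_wsqrtr.
by rewrite (bigD1 i)//= lerDl sumr_ge0// => j _; exact: sqr_ge0.
Qed.

Lemma sqr_norm_le_sqnorm y : `|y| ^+ 2 <= sqnorm y.
Proof.
rewrite -enorm_sqr lerXn2r ?nnegrE ?normr_ge0//; first exact: sqrtr_ge0.
exact: norm_le_enorm.
Qed.

Lemma sqnorm_le y : sqnorm y <= d%:R * `|y| ^+ 2.
Proof.
rewrite (_ : d%:R * `|y| ^+ 2 = \sum_(i < d) `|y| ^+ 2); last first.
  by rewrite sumr_const card_ord mulr_natl.
apply: ler_sum => i _.
by rewrite -real_normK ?num_real// lerXn2r ?nnegrE//; exact: rV_coord_le.
Qed.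

Lemma sqnormD x y : sqnorm (x + y) = sqnorm x + \sum_i 2 * x 0 i * y 0 i + sqnorm y.
Proof.
rewrite /sqnorm -!big_split/=; apply: eq_bigr => i _; rewrite mxE; ring.
Qed.

(** The complement of the support is the union of the null balls with rational center
    and radius [n.+1^-1], which are countably many. *)
Lemma measure_support_setC (mu : {measure set 'rV[R]_d -> \bar R}) :
  measurable (measure_support mu) /\ mu (~` measure_support mu) = 0%E.
Proof.
pose B (p : 'rV[rat]_d * nat) : set 'rV[R]_d := ball (map_mx ratr p.1 : 'rV[R]_d) (p.2.+1%:R^-1 : R).
have E : ~` measure_support mu = \bigcup_(p in [set p | mu (B p) = 0%E]) B p.
  apply/seteqP; split => y.
    rewrite /measure_support /= -existsNE => -[U /not_implyP[oU /not_implyP[Uy]]].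
    move=> /negP; rewrite -leNgt measure_le0 => /eqP U0.
    have := Uy; rewrite {1}(open_bigcup_ball_rV oU) => -[p /= pU yp]; exists p => //=.
    apply/eqP; rewrite -measure_le0 -U0; apply: le_measure => //; rewrite inE.
      by apply: measurable_open_rV; exact: ball_open.
    exact: measurable_open_rV.
  move=> [p /= p0 yp] /(_ (B p)); rewrite p0 ltxx => h; apply: notF; apply: h => //.
  exact: ball_open.
have mB p : measurable (B p) by apply: measurable_open_rV; exact: ball_open.
have mC : measurable (~` measure_support mu).
  by apply: measurable_open_rV; rewrite E; apply: bigcup_open => p _; exact: ball_open.
split; first by rewrite -[measure_support mu]setCK; exact: measurableC.
(* an enumeration of the null rational balls *)
pose F n := if unpickle n is Some p then (if mu (B p) == 0%E then B p else set0) else set0.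
have mF n : measurable (F n).
  by rewrite /F; case: unpickle => [p|//]; case: ifP.
have F0 n : mu (F n) = 0%E.
  by rewrite /F; case: unpickle => [p|]; rewrite ?measure0//; case: ifP => [/eqP//|]; rewrite measure0.
have EF : ~` measure_support mu = \bigcup_n F n.
  rewrite E; apply/seteqP; split => y [].
    by move=> p /= p0 yp; exists (pickle p) => //; rewrite /F pickleK p0 eqxx.
  move=> n _; rewrite /F; case: unpickle => [p|//]; case: ifP => // /eqP p0 yp.
  by exists p.
apply/eqP; rewrite -measure_le0 EF; apply: le_trans (generalized_Boole_inequality _ _ _) _ => //.
  by rewrite -EF.
by rewrite eseries0.
Qed.

(** The function [f] need not be integrable: the integral of its negative part can be
    infinite, but discarding it only increases the integral. *)
Lemma integral_le_almost (mu : {measure set 'rV[R]_d -> \bar R}) (A : set 'rV[R]_d)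
    (f g : 'rV[R]_d -> R) :
  measurable A -> mu (~` A) = 0%E -> measurable_fun setT f -> measurable_fun setT g ->
  (forall y, 0 <= g y) -> (forall y, A y -> f y <= g y) ->
  (\int[mu]_y (f y)%:E <= \int[mu]_y (g y)%:E)%E.
Proof.
move=> mA A0 mf mg g0 fg.
rewrite integralE; apply: (@le_trans _ _ (\int[mu]_y ((EFin \o f)^\+ y))%E).
  rewrite -[leRHS]sube0; apply: leeB => //.
  by apply: integral_ge0 => y _; exact: funeneg_ge0.
have mfp : measurable_fun setT ((EFin \o f)^\+)%E.
  by apply: measurable_funepos; exact/measurable_EFinP.
apply: ae_ge0_le_integral => //.
- by move=> y _; rewrite lee_fin.
- exact/measurable_EFinP.
- exists (~` A); split => //; first exact: measurableC.
  move=> y /= h Ay; apply: h => _.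
  by rewrite funeposE ge_max !lee_fin fg//= g0.
Qed.

Lemma div1D_le_min (Z : R) : 0 <= Z -> Z / (1 + Z) <= Num.min 1 Z.
Proof.
move=> Z0; have Z1 : 0 < 1 + Z by lra.
by rewrite le_min ler_pdivrMr// ler_pdivrMr// mul1r; apply/andP; split; [lra|nra].
Qed.

(** If [x + y] stays within [r] of [xh], the contact inequality applies at [x + y]; the
    compensator leaves [G - G / (1 + Z) = G * Z / (1 + Z)], where [Z = sqnorm y] and [G]
    is the dot product of [y] and [g]; this is of order [delta * min 1 Z]. Otherwise
    [`|y|] is at least [r / 2]; the contact inequality at [xh] bounds [u xh - u x],
    hence [u (x + y) - u x], by [d * s0 * r / 2], which the smallness of [s0] compares
    with [delta * r ^+ 2]. *)
Lemma jump_pointwise (u : 'rV[R]_d -> R) (xh x y : 'rV[R]_d) (g : 'I_d -> R) (delta r s0 : R) :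
  (0 < d)%N -> 0 < delta -> 0 < r -> r <= 1 -> 0 <= s0 -> d%:R * s0 <= delta * r / 8 ->
  `|x - xh| <= r / 2 ->
  (forall i, `|g i - 2 * delta * (x - xh) 0 i| <= s0) ->
  (forall z, `|z - xh| <= r ->
    u z - delta * sqnorm (z - xh) - \sum_i (g i - 2 * delta * (x - xh) 0 i) * (z - x) 0 i <=
    u x - delta * sqnorm (x - xh)) ->
  u (x + y) <= u xh ->
  u (x + y) - u x - \sum_i y 0 i * g i / (1 + enorm y ^+ 2) <=
  9 * d%:R * delta * Num.min 1 (enorm y ^+ 2).
Proof.
move=> d0 de0 r0 r1 s00 ds xr gs C uxy; rewrite enorm_sqr -mulr_suml.
set G := \sum_i _; set Z := sqnorm y; set m := Num.min 1 Z.
have d1 : 1 <= d%:R :> R by rewrite ler1n.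
have Z0 : 0 <= Z by exact: sqnorm_ge0.
have Z1 : 0 < 1 + Z by rewrite ltr_pwDl.
have zm := div1D_le_min Z0; rewrite -/m in zm.
have m0 : 0 <= m by rewrite le_min ler01.
have s0d : s0 <= delta * r / 8 by apply: le_trans ds; rewrite ler_peMl.
have gB i : `|g i| <= 2 * delta * r.
  have := rV_coord_le (x - xh) i => /le_trans/(_ xr); rewrite ler_norml => /andP[a1 a2].
  have := gs i; rewrite !ler_norml => /andP[b1 b2]; apply/andP; split; nra.
have GB : `|G| <= d%:R * `|y| * (2 * delta * r).
  rewrite (le_trans (ler_norm_sum _ _ _))//; apply: le_trans (ler_wpM2r _ (rV_sum_norm_le y)).
    by rewrite mulr_suml ler_sum// => i _; rewrite normrM ler_wpM2l.
  by rewrite !mulr_ge0// ltW.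
(* near jumps first, then jumps that leave the cube *)
have [xyr|xyr] := leP `|x + y - xh| r.
  have := C _ xyr; rewrite (_ : x + y - xh = (x - xh) + y); last by rewrite addrAC.
  rewrite sqnormD -/Z (_ : x + y - x = y); last by rewrite addrC addKr.
  have -> : \sum_i (g i - 2 * delta * (x - xh) 0 i) * y 0 i =
      G - delta * \sum_i 2 * (x - xh) 0 i * y 0 i.
    by rewrite /G mulr_sumr -sumrB; apply: eq_bigr => i _; ring.
  set W := \sum_i 2 * _ * _; move=> h.
  have yr : `|y| <= 3 / 2 * r.
    have -> : y = (x + y - xh) - (x - xh) by rewrite opprB addrA subrK addrAC subrr add0r.
    rewrite (le_trans (ler_normB _ _))//; lra.
  have G4 : `|G| <= 4 * d%:R * delta.
    apply: le_trans GB _; have y0 := normr_ge0 y.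
    have : `|y| * (2 * delta * r) <= 4 * delta by nra.
    by move=> /(ler_wpM2l (ler0n R d)); rewrite !mulrA => h1; nra.
  have Z4 : Z <= 4 * d%:R * m.
    rewrite /m; case: (leP 1 Z) => _; last by rewrite -[leLHS]mul1r ler_wpM2r//; lra.
    apply: le_trans (sqnorm_le y) _; rewrite mulr1 mulrC ler_wpM2r//.
    by have y0 := normr_ge0 y; nra.
  have e1 : G / (1 + Z) = G - G * (Z / (1 + Z)) by field; rewrite gt_eqF.
  have gz : G * (Z / (1 + Z)) <= 4 * d%:R * delta * m.
    apply: le_trans (ler_norm _) _; rewrite normrM ler_pM//.
    by rewrite ger0_norm// divr_ge0// ltW.
  rewrite e1; have dm : 0 <= d%:R * delta * m by rewrite !mulr_ge0// ltW.
  have : delta * Z <= delta * (4 * d%:R * m) by rewrite ler_wpM2l// ltW.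
  lra.
have yr : r / 2 <= `|y|.
  have := le_trans (ltW xyr) _; rewrite (_ : x + y - xh = (x - xh) + y); last by rewrite addrAC.
  move=> /(_ _ (ler_normD _ _)); lra.
have rm : r ^+ 2 / 4 <= m.
  rewrite le_min; apply/andP; split; first by nra.
  apply: le_trans (sqr_norm_le_sqnorm y); nra.
have := C xh; rewrite subrr normr0 => /(_ (ltW r0)).
have -> : sqnorm (0 : 'rV[R]_d) = 0 by rewrite /sqnorm big1// => i _; rewrite mxE expr0n.
set W := \sum_i _; have WB : W <= d%:R * s0 * (r / 2).
  apply: le_trans (ler_norm _) _; rewrite (le_trans (ler_norm_sum _ _ _))//.
  rewrite (_ : d%:R * s0 * (r / 2) = \sum_(i < d) s0 * (r / 2)); last first.
    by rewrite sumr_const card_ord -mulrA mulr_natl.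
  apply: ler_sum => i _.
  rewrite normrM ler_pM//; apply: le_trans (rV_coord_le _ i) _; by rewrite distrC.
have q0 := sqnorm_ge0 (x - xh).
have gz : - (G / (1 + Z)) <= 4 * d%:R * delta * m.
  apply: le_trans (ler_norm _) _; rewrite normrN normrM [`|_^-1|]gtr0_norm ?invr_gt0//.
  have yZ := sqr_norm_le_sqnorm y; rewrite -/Z in yZ.
  have GZ : `|G| <= 4 * d%:R * delta * Z.
    apply: le_trans GB _.
    have : `|y| * (2 * delta * r) <= 4 * delta * Z.
      apply: (@le_trans _ _ (4 * delta * `|y| ^+ 2)); last by rewrite ler_wpM2l// mulr_ge0// ltW.
      rewrite [leRHS](_ : _ = `|y| * (2 * delta * (2 * `|y|))); last by ring.
      by rewrite ler_wpM2l// ler_wpM2l ?mulr_ge0 ?(ltW de0)//; lra.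
    by move=> /(ler_wpM2l (ler0n R d)); nra.
  apply: le_trans (ler_wpM2r _ GZ) _; first by rewrite invr_ge0 ltW.
  by rewrite -[leLHS]mulrA ler_wpM2l// !mulr_ge0// ltW.
have dm : delta * m <= d%:R * delta * m by rewrite -mulrA ler_peMl// mulr_ge0// ltW.
have dm0 : 0 <= delta * m by rewrite mulr_ge0// ltW.
have : d%:R * s0 * (r / 2) <= delta * m.
  apply: (@le_trans _ _ (delta * (r ^+ 2 / 4))); last by rewrite ler_wpM2l// ltW.
  nra.
nra.
Qed.

End jump.

(** * Elementary inequalities and derivative tests *)

Section second_derivative_test.
Context {R : realType}.

(** If [h2 > 0] then [h1 > 0] on the right of 0 and [h] increases there: only the
    derivative of [h1] at 0 is involved. *)
Lemma second_derivative_test (h h1 : R -> R) (h2 rho : R) : 0 < rho ->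
  (forall s : R, `|s| < rho -> is_derive s (1 : R) h (h1 s)) -> is_derive (0 : R) (1 : R) h1 h2 ->
  (forall s, `|s| < rho -> h s <= h 0) -> h1 0 = 0 /\ h2 <= 0.
Proof.
move=> rho0 dh dh1 hmax.
have in_rho s : s \in `]- rho, rho[ -> `|s| < rho by rewrite in_itv/= ltr_norml.
have h10 : h1 0 = 0.
  have d0 : is_derive (0 : R) (1 : R) h 0.
    apply: (@derive1_at_max _ h (- rho) rho 0); first by rewrite ge0_cp// ltW.
    - by move=> t /in_rho /dh [].
    - by rewrite in_itv/= oppr_lt0 rho0.
    - by move=> t /in_rho /hmax.
  have h0 : `|0 : R| < rho by rewrite normr0.
  by have [_ E0] := d0; have [_ E1] := dh _ h0; rewrite -E1 E0.
split=> //; rewrite leNgt; apply/negP => h20.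
have /is_derive1_caratheodory[g [gE cg g0]] := dh1.
have : \forall s \near (0 : R), 0 < g s.
  by apply: (cvgr_gt (g 0) cg); rewrite g0.
move=> /nbhs_ballP[e /= e0 ge].
pose t := Num.min (e / 2) (rho / 2).
have t0 : 0 < t by rewrite lt_min !divr_gt0.
have te : t < e by rewrite gt_min ltr_pdivrMr// ltr_pMr// ltr1n.
have tr : t < rho by rewrite gt_min [rho / 2 < _]ltr_pdivrMr// [X in _ || X]ltr_pMr// ltr1n orbT.
have [||c] := @MVT _ h h1 0 t t0.
- move=> s; rewrite in_itv/= => /andP[s0 st]; apply: dh.
  by rewrite gtr0_norm// (lt_trans st).
- apply: derivable_within_continuous => s; rewrite in_itv/= => /andP[s0 st].
  by have [] : is_derive s (1 : R) h (h1 s) by apply: dh; rewrite ger0_norm// (le_lt_trans st).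
rewrite in_itv/= => /andP[c0 ct] E.
have : h t <= h 0 by apply: hmax; rewrite gtr0_norm.
rewrite -subr_le0 E subr0 leNgt mulr_gt0//.
have := gE c; rewrite h10 !subr0 => ->; rewrite mulr_gt0//; apply: ge.
by rewrite /ball/= sub0r normrN gtr0_norm// (lt_trans ct).
Qed.

Lemma le_of_frequently (a b C : R) : 0 <= C ->
  (forall n, exists2 k : nat, (n <= k)%N & a <= b + C / k.+1%:R) -> a <= b.
Proof.
move=> C0 h; rewrite leNgt; apply/negP => ba.
have C1 : 0 < C + 1 by rewrite ltr_wpDl.
have e0 : 0 < (a - b) / (C + 1) by rewrite divr_gt0// subr_gt0.
have [k _ kP] := near_infty_natSinv_lt (PosNum e0).
have [j kj aj] := h k; have := kP _ kj => /=; rewrite ltr_pdivlMr// => hj.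
have j0 : 0 < j.+1%:R^-1 :> R by rewrite invr_gt0 ltr0n.
have h1 : C / j.+1%:R < a - b.
  by apply: le_lt_trans hj; rewrite mulrC; apply: ler_wpM2l; [exact: ltW|rewrite lerDl].
by move: aj; rewrite -lerBlDl leNgt h1.
Qed.

Lemma sum_pow_le (I : finType) (a : I -> R) n : (forall i, 0 <= a i) ->
  (\sum_i a i) ^+ n.+1 <= #|I|%:R ^+ n.+1 * \sum_i a i ^+ n.+1.
Proof.
move=> a0; have [i0 _|I0] := pickP (@predT I); last first.
  rewrite !big_pred0 ?mulr0 ?expr0n//; by move=> i; have := I0 i.
have [i _ iP] := @arg_maxP _ _ _ i0 predT a isT.
apply: (@le_trans _ _ ((#|I|%:R * a i) ^+ n.+1)).
  rewrite lerXn2r ?nnegrE ?mulr_ge0 ?sumr_ge0//.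
  rewrite (le_trans (ler_sum _ (fun j _ => iP j isT)))//.
  by rewrite sumr_const mulr_natl.
rewrite exprMn ler_wpM2l ?exprn_ge0//.
by rewrite (bigD1 i)//= lerDl sumr_ge0// => j _; rewrite exprn_ge0.
Qed.

End second_derivative_test.

Section analysis.
Context {R : realType} {d : nat}.
Local Notation leb := (@lebesgue_rV R d).
Implicit Types (x y z v xh : 'rV[R]_d).

Lemma unif_continuous_cube (u : 'rV[R]_d -> R) xh r tau : continuous u -> 0 < tau ->
  exists2 eta, 0 < eta &
    forall x, cube xh r x -> forall y, `|y - x| <= eta -> `|u y - u x| <= tau.
Proof.
move=> cu tau0; have /compact_near_coveringP cK := @compact_cube R d xh r.
have : \forall eta \near 0^'+, cube xh r `<=`
    (fun x => forall y, `|y - x| <= eta -> `|u y - u x| <= tau).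
  apply: (cK R (0^'+) (fun eta x => forall y, `|y - x| <= eta -> `|u y - u x| <= tau)).
  move=> x _; have tau2 : 0 < tau / 2 by rewrite divr_gt0.
  have [rho rho0 P] := (continuous_rVP u).1 cu x _ tau2.
  have rho2 : 0 < rho / 2 by rewrite divr_gt0.
  exists (ball x (rho / 2), [set eta | eta < rho / 2]) => /=.
    by split; [exact: nbhsx_ballx|exact: nbhs_right_lt].
  move=> [x' eta] /= []; rewrite -ball_normE /= => xx' eta2 y yx'.
  have h1 : `|x - y| < rho.
    rewrite (_ : x - y = (x - x') + (x' - y)); last by rewrite addrA subrK.
    by rewrite (le_lt_trans (ler_normD _ _))// [rho]splitr ltrD// distrC (le_lt_trans yx').
  have h2 : `|x - x'| < rho by rewrite (lt_trans xx')// ltr_pdivrMr// ltr_pMr// ltr1n.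
  have := P _ h1; have := P _ h2; rewrite !ler_distl => /andP[a1 a2] /andP[a3 a4].
  by apply/andP; split; lra.
move=> [e /= e0 eP]; exists (e / 2); first by rewrite divr_gt0.
apply: eP => /=; last by rewrite divr_gt0.
by rewrite sub0r normrN gtr0_norm ?divr_gt0// ltr_pdivrMr// ltr_pMr// ltr1n.
Qed.

Lemma moll_cvg_family (I : finType) (F : I -> 'rV[R]_d -> R) e : (forall i, moll_cvg (F i)) ->
  0 < e -> exists2 eta1, 0 < eta1 & forall eta b, 0 < eta -> eta <= eta1 -> bump_family eta b ->
    forall i, nrm (fun x => moll b (F i) x - F i x) <= e.
Proof.
move=> cF e0; have h i : exists eta1, 0 < eta1 /\ (forall eta b, 0 < eta -> eta <= eta1 ->
    bump_family eta b -> nrm (fun x => moll b (F i) x - F i x) <= e).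
  by have [eta1 ? ?] := cF i _ e0; exists eta1.
have [g /all_and2[g0 gP]] := choice h.
exists (\big[Num.min/1]_i g i).
  by elim/big_ind : _ => // a b a0 b0; rewrite lt_min a0.
move=> eta b eta0 le1 bP i; apply: gP bP => //; apply: le_trans le1 _.
exact: bigmin_le_cond.
Qed.

Lemma is_derive_sqnorm (a v : 'rV[R]_d) (s : R) :
  is_derive s (1 : R) (fun s : R => sqnorm (a + s *: v)) (\sum_i 2 * (a + s *: v) 0 i * v 0 i).
Proof.
have := is_derive_quadratic (sqnorm a) (\sum_i 2 * a 0 i * v 0 i) (sqnorm v) s.
congr is_derive.
  apply/funext => t; rewrite sqnormD -addrA -addrA; congr (_ + (_ + _)).
    by rewrite mulr_suml; apply: eq_bigr => i _; rewrite mxE; ring.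
  by rewrite /sqnorm mulr_suml; apply: eq_bigr => i _; rewrite mxE; ring.
rewrite /sqnorm mulr_sumr mulr_suml -big_split/=.
by apply: eq_bigr => i _; rewrite !mxE; ring.
Qed.

Lemma is_derive_dot (a v : 'rV[R]_d) (s : R) :
  is_derive s (1 : R) (fun s : R => \sum_i 2 * (a + s *: v) 0 i * v 0 i) (2 * sqnorm v).
Proof.
have := is_derive_quadratic (\sum_i 2 * a 0 i * v 0 i) (2 * sqnorm v) 0 s.
rewrite mulr0 mul0r addr0; congr is_derive.
apply/funext => t; rewrite mul0r addr0 /sqnorm mulr_sumr mulr_suml -big_split/=.
by apply: eq_bigr => i _; rewrite !mxE; ring.
Qed.

(** Along every line through [x], [U] minus the touching paraboloid has a local maximum
    at [x], and the test in one variable gives the conditions of both orders. *)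
Lemma contact_derivatives (U : 'rV[R]_d -> R) (V : 'I_d -> 'rV[R]_d -> R)
    (M : 'I_d -> 'I_d -> 'rV[R]_d -> R) xh x (xi : 'I_d -> R) (delta r : R) :
  0 < r -> `|x - xh| <= r / 2 ->
  (forall y v, `|y - xh| <= r -> is_derive y v U (\sum_i v 0 i * V i y)) ->
  (forall i y v, `|y - xh| <= r -> is_derive y v (V i) (\sum_j v 0 j * M i j y)) ->
  (forall z, `|z - xh| <= r ->
    U z - delta * sqnorm (z - xh) - \sum_i xi i * (z - x) 0 i <= U x - delta * sqnorm (x - xh)) ->
  (forall i, V i x = xi i + 2 * delta * (x - xh) 0 i) /\
  (forall v, quad (fun i j => M i j x) (fun i => v 0 i) <= 2 * delta * sqnorm v).
Proof.
move=> r0 xr dU dV C.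
pose h v (s : R) := U (x + s *: v) - delta * sqnorm (x + s *: v - xh)
   - s * \sum_i xi i * v 0 i.
pose h1 v s := \sum_i v 0 i * V i (x + s *: v) - delta * \sum_i 2 * (x + s *: v - xh) 0 i * v 0 i
   - \sum_i xi i * v 0 i.
pose h2 v := quad (fun i j => M i j x) (fun i => v 0 i) - 2 * delta * sqnorm v.
have key v : h1 v 0 = 0 /\ h2 v <= 0.
  have v0 : 0 < `|v| + 1 by rewrite ltr_wpDl.
  have xv s : `|s| < r / 2 / (`|v| + 1) -> `|x + s *: v - xh| <= r.
    rewrite ltr_pdivlMr// => sv; rewrite addrAC (le_trans (ler_normD _ _))//.
    rewrite [r]splitr lerD// normrZ (le_trans _ (ltW sv))// ler_wpM2l// lerDl//.
  apply: (@second_derivative_test _ (h v) (h1 v) _ (r / 2 / (`|v| + 1))).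
  - by rewrite !divr_gt0.
  - move=> s /xv sv.
    have dUs : is_derive s (1 : R) (fun s : R => U (x + s *: v)) (\sum_i v 0 i * V i (x + s *: v)).
      by apply/is_derive_line_shift; exact: dU.
    have dQ := is_derive_sqnorm (x - xh) v s.
    have -> : h v = ((fun s : R => U (x + s *: v)) -
        delta *: (fun s : R => sqnorm (x - xh + s *: v)) - (\sum_i xi i * v 0 i) *: (@id R))%R.
      by apply/funext => t; rewrite /h !fctE /GRing.scale/= [t * _]mulrC [x + _ - xh]addrAC.
    by apply: is_derive_eq; rewrite /h1 /GRing.scale/= mulr1 [x + _ - xh]addrAC.
  - have dVs i : is_derive (0 : R) (1 : R) (fun s : R => V i (x + s *: v))
        (\sum_j v 0 j * M i j x).
      by apply/is_derive_line; apply: dV; rewrite (le_trans xr)// ler_pdivrMr// ler_pMr// ler1n.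
    have dQ := is_derive_dot (x - xh) v 0.
    have -> : h1 v = (\sum_i (v 0 i *: (fun s : R => V i (x + s *: v))) -
        delta *: (fun s : R => \sum_i 2 * (x - xh + s *: v) 0 i * v 0 i) -
        cst (\sum_i xi i * v 0 i))%R.
      apply/funext => t; rewrite /h1 !fctE fct_sumE /GRing.scale/=; congr (_ - _ * _ - _).
      by apply: eq_bigr => i _; rewrite [x + _ - xh]addrAC.
    apply: is_derive_eq; rewrite subr0 /h2 /GRing.scale/=; congr (_ - _); last by ring.
    by apply: eq_bigr => i _; rewrite mulr_sumr; apply: eq_bigr => j _; ring.
  - move=> s /xv sv; have := C _ sv; rewrite /h scale0r addr0 mul0r subr0.
    rewrite (_ : x + s *: v - x = s *: v); last by rewrite addrAC subrr add0r.
    rewrite (_ : \sum_i _ = s * \sum_i xi i * v 0 i)//.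
    by rewrite mulr_sumr; apply: eq_bigr => i _; rewrite mxE; ring.
split=> [i|v]; last by have [_] := key v; rewrite subr_le0.
have [+ _] := key (delta_mx 0 i); rewrite /h1 scale0r addr0.
have sd (f : 'I_d -> R) : \sum_j f j * (delta_mx 0 i : 'rV[R]_d) 0 j = f i.
  rewrite -[RHS](sum_delta f); apply: eq_bigr => j _; rewrite mxE eqxx/= eq_sym//.
under eq_bigr do rewrite mulrC; rewrite !sd.
move=> E; lra.
Qed.

End analysis.

(** * Local integrability on a cube *)

Section patches.
Context {R : realType} {d : nat}.
Local Notation leb := (@lebesgue_rV R d).
Variables (D : set 'rV[R]_d) (x0 : 'rV[R]_d) (r0 : R).
Hypothesis D_open : open D.
Let K := cube x0 r0.
Hypothesis KD : K `<=` D.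

Lemma measurable_patch (f : 'rV[R]_d -> R) : measurable_fun D f -> measurable_fun setT (f \_ K).
Proof.
move=> mf; have [+ _] := measurable_restrictT f (measurable_cube x0 r0); apply.
by apply: (@measurable_funS _ _ _ _ D) => //; exact: measurable_open_rV.
Qed.

Lemma patch_in (f : 'rV[R]_d -> R) x : K x -> (f \_ K) x = f x.
Proof. by move=> Kx; rewrite /patch mem_set. Qed.

Lemma patch_out (f : 'rV[R]_d -> R) x : ~ K x -> (f \_ K) x = 0.
Proof. by move=> Kx; rewrite /patch memNset. Qed.

Lemma L1_patch (f : 'rV[R]_d -> R) : locLp D 1 f -> L1 (f \_ K).
Proof.
move=> [mf /(_ K (@compact_cube _ _ x0 r0) KD) fK]; apply/integrableP; split.
  by apply/measurable_EFinP; exact: measurable_patch.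
rewrite [ltLHS](_ : _ = (\int[leb]_(x in K) (`|f x| `^ 1)%:E)%E)//.
rewrite [RHS]integral_mkcond; apply: eq_integral => x _; rewrite /= /patch.
by case: ifPn => _; rewrite ?normr0// powRr1.
Qed.

(** On a cube, [t ^ n.+1 <= 1 + t ^ p] reduces the exponent; this is the step that
    requires [p] to be at least the dimension. *)
Lemma L1_pow_patch p n (f : 'rV[R]_d -> R) : n.+1%:R <= p -> locLp D p f ->
  L1 (fun x => `|(f \_ K) x| ^+ n.+1).
Proof.
move=> np [mf /(_ K (@compact_cube _ _ x0 r0) KD) fK].
have mfK := measurable_patch mf.
pose h x := \1_K x + `|(f \_ K) x| `^ p.
have mh : measurable_fun setT (fun x => `|(f \_ K) x| `^ p).
  apply: (@measurableT_comp _ _ _ _ _ _ (fun a : R => a `^ p) _ (fun x => `|(f \_ K) x|)); first exact: measurable_powR.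
  exact: measurableT_comp.
have ih : L1 h.
  apply: L1D; first by apply: L1_indic; [exact: measurable_cube|exact: cube_ltoo].
  apply/integrableP; split; first exact/measurable_EFinP.
  rewrite [ltLHS](_ : _ = (\int[leb]_(x in K) (`|f x| `^ p)%:E)%E)//.
  rewrite [RHS]integral_mkcond; apply: eq_integral => x _; rewrite /= /patch.
  case: ifPn => _; rewrite ger0_norm ?powR_ge0//.
  by rewrite normr0 powR0// gt_eqF// (lt_le_trans _ np).
apply: L1_le ih _; first by apply: measurable_funX; exact: measurableT_comp.
move=> x; rewrite ger0_norm ?exprn_ge0// /h.
have [Kx|Kx] := pselect (K x); last first.
  by rewrite patch_out// normr0 expr0n normr_ge0.
rewrite patch_in// indicE mem_set// [leRHS]ger0_norm ?addr_ge0 ?powR_ge0//.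
have [f1|f1] := leP `|f x| 1.
  apply: (@le_trans _ _ 1); first by rewrite exprn_ile1.
  by rewrite -[leLHS]addr0 lerD ?powR_ge0.
rewrite -powR_mulrn// (@le_trans _ _ (`|f x| `^ p))// ?lerDr//.
by apply: ler_powR => //; exact: ltW.
Qed.

End patches.

(** * Contact sets of a mollification *)

Section continuity_helpers.
Context {R : realType} {d : nat}.
Implicit Types f g : 'rV[R]_d -> R.

Lemma continuous_add f g : continuous f -> continuous g -> continuous (fun x => f x + g x).
Proof. move=> cf cg x; exact: (continuousD (cf x) (cg x)). Qed.

Lemma continuous_sub f g : continuous f -> continuous g -> continuous (fun x => f x - g x).
Proof. move=> cf cg x; exact: (continuousB (cf x) (cg x)). Qed.

Lemma continuous_mul f g : continuous f -> continuous g -> continuous (fun x => f x * g x).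
Proof. move=> cf cg x; exact: (continuousM (cf x) (cg x)). Qed.

Lemma continuous_sum (I : Type) (s : seq I) (f : I -> 'rV[R]_d -> R) :
  (forall i, continuous (f i)) -> continuous (fun x => \sum_(i <- s) f i x).
Proof.
move=> cf; elim: s => [|i s IH].
  by under eq_fun do rewrite big_nil; exact: cst_continuous.
by under eq_fun do rewrite big_cons; exact: continuous_add.
Qed.

Lemma continuous_norm f : continuous f -> continuous (fun x => `|f x|).
Proof. move=> cf x; exact: (continuous_comp (cf x) (@norm_continuous _ _ _)). Qed.

Lemma continuous_coord_sub (z : 'rV[R]_d) i : continuous (fun x : 'rV[R]_d => (x - z) 0 i).
Proof.
under eq_fun do rewrite !mxE.
by apply: continuous_sub; [exact: coord_continuous|exact: cst_continuous].
Qed.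

Lemma continuous_sqnorm_sub (z : 'rV[R]_d) : continuous (fun x : 'rV[R]_d => sqnorm (x - z)).
Proof.
apply: continuous_sum => i; under eq_fun do rewrite expr2.
by apply: continuous_mul; exact: continuous_coord_sub.
Qed.

End continuity_helpers.

Lemma nrm_sum_le {R : realType} {d m : nat} (F : 'I_m -> 'rV[R]_d -> R) (e : R) :
  (forall i, L1 (F i)) -> (forall i, nrm (F i) <= e) ->
  nrm (fun x => \sum_i `|F i x|) <= m%:R * e.
Proof.
move=> iF Fe; rewrite -[m in m%:R]card_ord mulr_natl -sumr_const.
apply: le_trans (_ : \sum_i nrm (F i) <= _); last exact: ler_sum.
elim: (index_enum _) => [|i s IH].
  under eq_fun do rewrite big_nil.
  by rewrite big_nil /nrm /Rintegral integral0_eq// => x _; rewrite normr0.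
under eq_fun do rewrite big_cons.
rewrite big_cons; apply: le_trans (ler_nrmD _ _) _; first exact: L1_norm.
  by apply: L1_sum => j; exact: L1_norm.
rewrite lerD//; apply: nrm_le; [exact: L1_norm|exact: L1_norm|].
by move=> x; rewrite normr_id.
Qed.

Section scale.
Context {R : realType} {n : nat}.
Local Notation leb := (@lebesgue_rV R n.+1).
Variables (D : set 'rV[R]_n.+1) (xh : 'rV[R]_n.+1) (delta r s0 p : R).
Variables (u : 'rV[R]_n.+1 -> R) (du : 'I_n.+1 -> 'rV[R]_n.+1 -> R).
Variables (d2u g : 'I_n.+1 -> 'I_n.+1 -> 'rV[R]_n.+1 -> R).
Let K := cube xh (2 * r).
Hypothesis D_open : open D.
Hypothesis KD : K `<=` D.
Hypothesis de0 : 0 < delta.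
Hypothesis r0 : 0 < r.
Hypothesis s00 : 0 < s0.
Hypothesis ds : n.+1%:R * s0 <= delta * r / 8.
Hypothesis u_cont : continuous u.
Hypothesis umax : forall x, D x -> u x <= u xh.
Hypothesis u_du : forall i, weak_derivative D [:: i] u (du i).
Hypothesis u_d2u : forall i j, weak_derivative D [:: i; j] u (d2u i j).
Hypothesis u_g : forall i j, weak_derivative D [:: i; j] u (g i j).
Hypothesis gLp : forall i j, locLp D p (g i j).
Hypothesis hp : n.+1%:R <= p.

(** Up to an error [kap], [u] is touched from above at [x] by the paraboloid [delta *
    sqnorm (z - xh) + xi . z], where [xi] is computed with the representative [du], and
    [d2u] satisfies the resulting second order condition. Representatives of mixed
    derivatives are chosen independently, so symmetry is part of the conditions. *)
Definition almost_contact (kap : R) (x : 'rV[R]_n.+1) : Prop :=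
  let xi i := du i x - 2 * delta * (x - xh) 0 i in
  [/\ forall i, `|xi i| <= s0 + kap,
      forall z, `|z - xh| <= r ->
        u z - delta * sqnorm (z - xh) - \sum_i xi i * (z - x) 0 i <=
        u x - delta * sqnorm (x - xh) + kap * (2 + \sum_i `|(z - x) 0 i|),
      forall v : 'rV[R]_n.+1, quad (fun i j => d2u i j x) (fun i => v 0 i) <=
        2 * delta * sqnorm v + kap * \sum_i \sum_j `|v 0 i| * `|v 0 j| &
      forall i j, `|d2u i j x - d2u j i x| <= 2 * kap].

(** The slope map of a contact set has a local Lipschitz constant bounded by the
    mollification of this function. It is built from the representatives [g] of class
    [locLp D p], as its power [n.+1] has to be integrable. *)
Definition hess_majorant (x : 'rV[R]_n.+1) : R :=
  \sum_i \sum_j `|(g i j \_ K) x| + 2 * delta * n.+1%:R * \1_K x.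

Lemma hess_majorant_ge0 x : 0 <= hess_majorant x.
Proof.
rewrite addr_ge0//; last by rewrite !mulr_ge0// ltW.
by apply: sumr_ge0 => i _; exact: sumr_ge0.
Qed.

Lemma L1_g i j : L1 (g i j \_ K).
Proof. by apply: (L1_patch D_open KD); have [_ + _] := u_g i j. Qed.

Lemma L1_K (c : R) : L1 (fun x => c * \1_K x).
Proof. by apply: L1Z; apply: L1_indic; [exact: measurable_cube|exact: cube_ltoo]. Qed.

Lemma L1_hess_majorant : L1 hess_majorant.
Proof.
apply: L1D; last exact: L1_K.
by apply: L1_sum => i; apply: L1_sum => j; apply: L1_norm; exact: L1_g.
Qed.

Lemma L1_hess_majorant_pow : L1 (fun x => hess_majorant x ^+ n.+1).
Proof.
pose I := ('I_n.+1 * 'I_n.+1)%type.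
pose A x := \sum_(q : I) `|(g q.1 q.2 \_ K) x| ^+ n.+1.
have iA : L1 A by apply: L1_sum => q; exact: (L1_pow_patch D_open KD hp).
pose c := 2 * delta * n.+1%:R.
have c0 : 0 <= c by rewrite !mulr_ge0// ltW.
have iB := L1D (L1Z (#|{: I}|%:R ^+ n.+1) iA) (L1_K (c ^+ n.+1)).
apply: L1_le (L1Z (2 ^+ n.+1) iB) _.
  by apply: measurable_funX; exact: (L1_measurable L1_hess_majorant).
move=> x; rewrite ger0_norm ?exprn_ge0 ?hess_majorant_ge0//.
apply: le_trans (ler_norm _).
have := @sum_pow_le R bool (fun b => if b then \sum_i \sum_j `|(g i j \_ K) x| else c * \1_K x) n.
rewrite !big_bool card_bool => h; apply: le_trans (h _) _.
  by case; [apply: sumr_ge0 => i _; exact: sumr_ge0|exact: mulr_ge0].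
rewrite ler_wpM2l ?exprn_ge0// lerD//; last first.
  by rewrite exprMn indicE; case: (x \in K); rewrite ?expr1n ?expr0n.
by rewrite pair_bigA /=; exact: sum_pow_le.
Qed.

Section fixed_kernel.
Variables (eta : R) (b : nat -> R -> R) (tau : R).
Hypothesis eta0 : 0 < eta.
Hypothesis bP : bump_family eta b.
Hypothesis eta_r : eta <= r.
Hypothesis tau0 : 0 <= tau.
Hypothesis tau_small : 2 * tau <= delta * r ^+ 2 / 8.
Hypothesis tauP : forall x, cube xh r x -> forall y, `|y - x| <= eta -> `|u y - u x| <= tau.

Let U := moll b (u \_ K).
Let V i := moll b (du i \_ K).
Let M i j := moll b (d2u i j \_ K).

Lemma L1_u : L1 (u \_ K).
Proof. by apply: (L1_patch D_open KD); have [+ _ _] := u_du ord0. Qed.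

Lemma L1_du i : L1 (du i \_ K).
Proof. by apply: (L1_patch D_open KD); have [_ + _] := u_du i. Qed.

Lemma L1_d2u i j : L1 (d2u i j \_ K).
Proof. by apply: (L1_patch D_open KD); have [_ + _] := u_d2u i j. Qed.

Lemma cube_r_K x : `|x - xh| <= r -> K x.
Proof. by move=> xr; rewrite /K /cube /= (le_trans xr)// ler_peMl ?(ltW r0)// ler1n. Qed.

Lemma cube_eta_K x : `|x - xh| <= r -> cube x eta `<=` K.
Proof.
move=> xr y; rewrite /K /cube /= => yx; rewrite (_ : y - xh = (y - x) + (x - xh)).
  by rewrite (le_trans (ler_normD _ _))// mulr2n mulrDl mul1r lerD// (le_trans yx).
by rewrite addrA subrK.
Qed.

Lemma U_close x : `|x - xh| <= r -> `|U x - u x| <= tau.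
Proof.
move=> xr; rewrite -(patch_in u (cube_r_K xr)); apply: (moll_close eta0 bP) L1_u _ => y xy.
by rewrite !patch_in; [exact: tauP|exact: cube_r_K|exact: (cube_eta_K xr)].
Qed.

Lemma is_derive_U x v : `|x - xh| <= r -> is_derive x v U (\sum_i v 0 i * V i x).
Proof.
by move=> xr; apply: (is_derive_moll eta0 bP v D_open KD L1_u u_du); exact: cube_eta_K.
Qed.

Lemma is_derive_V i x v : `|x - xh| <= r -> is_derive x v (V i) (\sum_j v 0 j * M i j x).
Proof.
move=> xr; apply: (weak_derivative_step eta0 bP v D_open KD (L1_du i) (u_du i) (u_d2u i)).
exact: cube_eta_K.
Qed.

Let xi i x := V i x - 2 * delta * (x - xh) 0 i.

(** The points of the half-size cube at which the maximum over the whole cube of [U]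
    minus a paraboloid is attained, for the small slopes [xi]. *)
Definition contact_set : set 'rV[R]_n.+1 :=
  [set x | [/\ `|x - xh| <= r / 2, forall i, `|xi i x| <= s0 &
    forall z, `|z - xh| <= r ->
      U z - delta * sqnorm (z - xh) - \sum_i xi i x * (z - x) 0 i <=
      U x - delta * sqnorm (x - xh)]].

Lemma continuous_U : continuous U.
Proof. exact: (continuous_moll eta0 bP L1_u). Qed.

Lemma continuous_xi i : continuous (xi i).
Proof.
apply: continuous_sub; first exact: (continuous_moll eta0 bP (L1_du i)).
by apply: continuous_mul; [exact: cst_continuous|exact: continuous_coord_sub].
Qed.

Lemma contact_set_compact : compact contact_set.
Proof.
apply: (@closed_cube_compact _ _ _ xh (r / 2)); last by move=> x [].
rewrite (_ : contact_set = cube xh (r / 2) `&` (\bigcap_i [set x | `|xi i x| <= s0]) `&`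
   \bigcap_(z in [set z | `|z - xh| <= r]) [set x |
      U z - delta * sqnorm (z - xh) - \sum_i xi i x * (z - x) 0 i <=
      U x - delta * sqnorm (x - xh)]); last first.
  apply/seteqP; split => x /=.
    by move=> [h1 h2 h3]; split; [split => // i _; exact: h2|move=> z zr; exact: h3].
  by move=> [[h1 h2] h3]; split => // i; exact: h2.
apply: (closedI (closedI (@closed_cube _ _ xh (r / 2)) _) _).
  apply: closed_bigI => i _.
  apply: (@closed_le_fun _ _ (fun x => `|xi i x|) (fun=> s0)).
    by apply: continuous_norm; exact: continuous_xi.
  exact: cst_continuous.
apply: closed_bigI => z _; apply: closed_le_fun; last first.
  apply: continuous_sub; first exact: continuous_U.
  by apply: continuous_mul; [exact: cst_continuous|exact: continuous_sqnorm_sub].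
apply: continuous_sub; first exact: cst_continuous.
apply: continuous_sum => i; apply: continuous_mul; first exact: continuous_xi.
under eq_fun do rewrite !mxE.
by apply: continuous_sub; [exact: cst_continuous|exact: coord_continuous].
Qed.

Lemma contact_derivs x : contact_set x ->
  forall v : 'rV[R]_n.+1, quad (fun i j => M i j x) (fun i => v 0 i) <= 2 * delta * sqnorm v.
Proof.
by move=> [xr _ C]; have [_] := contact_derivatives r0 xr is_derive_U is_derive_V C.
Qed.

(** Maximize [U - delta * sqnorm (y - xh) - z . y] over the cube of radius [r]. As [U]
    is [tau]-close to [u], which is maximal at [xh], the value at a point far from [xh]
    is smaller than the one at [xh]: the maximum lies in the half-size cube, and there
    the slope of [U - delta * sqnorm (y - xh)] is [z]. *)
Lemma contact_slopes (z : 'rV[R]_n.+1) : cube 0 s0 z ->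
  exists2 x, contact_set x & \row_i xi i x = z.
Proof.
rewrite /cube /= subr0 => zs.
pose f x := U x - delta * sqnorm (x - xh) - \sum_i z 0 i * (x - xh) 0 i.
have cf : continuous f.
  apply: continuous_sub; last first.
    by apply: continuous_sum => i; apply: continuous_mul; [exact: cst_continuous|exact: continuous_coord_sub].
  apply: continuous_sub; first exact: continuous_U.
  by apply: continuous_mul; [exact: cst_continuous|exact: continuous_sqnorm_sub].
have [||x /set_mem xr fmax] := @EVT_max_rV R _ f (cube xh r) _ (@compact_cube _ _ xh r).
- by exists xh; rewrite /cube /= subrr normr0 ltW.
- exact: continuous_subspaceT.
have {}fmax y : `|y - xh| <= r -> f y <= f x by move=> yr; apply: fmax; apply/mem_set.
have hx0 : `|xh - xh| <= r by rewrite subrr normr0 ltW.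
have x2 : `|x - xh| <= r / 2.
  have := fmax _ hx0; rewrite /f subrr.
  have -> : sqnorm (0 : 'rV[R]_n.+1) = 0 by rewrite /sqnorm big1// => i _; rewrite mxE expr0n.
  rewrite big1 => [|i _]; last by rewrite mxE mulr0.
  have SB : - \sum_i z 0 i * (x - xh) 0 i <= delta * r / 8 * `|x - xh|.
    apply: le_trans (ler_norm _) _; rewrite normrN (le_trans (ler_norm_sum _ _ _))//.
    apply: (@le_trans _ _ (\sum_(i < n.+1) s0 * `|x - xh|)); last first.
      by rewrite sumr_const card_ord -[leLHS]mulr_natl mulrA ler_wpM2r.
    apply: ler_sum => i _; rewrite normrM ler_pM//; last exact: rV_coord_le.
    exact: le_trans (rV_coord_le _ _) zs.
  have := U_close hx0; have := U_close xr; rewrite !ler_distl => /andP[_ h1] /andP[h2 _].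
  have h3 := umax (KD (cube_r_K xr)); have q := sqr_norm_le_sqnorm (x - xh).
  rewrite mulr0 !subr0 => h4.
  have w0 := normr_ge0 (x - xh).
  have h5 : delta * `|x - xh| ^+ 2 <= delta * r ^+ 2 / 8 + delta * r / 8 * `|x - xh|.
    have : delta * `|x - xh| ^+ 2 <= delta * sqnorm (x - xh) by rewrite ler_wpM2l// ltW.
    move: h1 h2 h3 h4 SB tau_small; set S := \sum_i _.
    move: (U x) (U xh) (u x) (u xh) S (sqnorm _) (`|_|) => a1 a2 a3 a4 a5 a6 a7; lra.
  have h6 : delta * r / 8 * `|x - xh| <= delta * r / 8 * r.
    by rewrite ler_wpM2l// divr_ge0// mulr_ge0// ltW.
  have h7 : delta * `|x - xh| ^+ 2 <= delta * (r / 2) ^+ 2.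
    by apply: le_trans h5 _; nra.
  by move: h7; rewrite ler_pM2l// ler_pXn2r ?nnegrE ?divr_ge0// ltW.
have C y : `|y - xh| <= r ->
    U y - delta * sqnorm (y - xh) - \sum_i z 0 i * (y - x) 0 i <= U x - delta * sqnorm (x - xh).
  move=> /fmax; rewrite /f => h.
  have -> : \sum_i z 0 i * (y - x) 0 i = \sum_i z 0 i * (y - xh) 0 i - \sum_i z 0 i * (x - xh) 0 i.
    by rewrite -sumrB; apply: eq_bigr => i _; rewrite !mxE; ring.
  lra.
have [VE _] := contact_derivatives r0 x2 is_derive_U is_derive_V C.
have xiE i : xi i x = z 0 i by rewrite /xi VE addrK.
exists x; last by apply/rowP => i; rewrite mxE xiE.
split => //; first by move=> i; rewrite xiE; exact: le_trans (rV_coord_le _ _) zs.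
move=> y yr; under eq_bigr do rewrite xiE; exact: C.
Qed.

Lemma moll_sum (I : Type) (q : seq I) (F : I -> 'rV[R]_n.+1 -> R) x : (forall i, L1 (F i)) ->
  moll b (fun y => \sum_(i <- q) F i y) x = \sum_(i <- q) moll b (F i) x.
Proof.
move=> iF; elim: q => [|i q IH].
  by under eq_fun do rewrite big_nil; rewrite big_nil; exact: (moll_cst eta0 bP).
under eq_fun do rewrite big_cons.
by rewrite (mollD bP)// ?IH ?big_cons//; exact: L1_sum.
Qed.

Definition hess_norm x : R := \sum_i \sum_j `|M i j x| + 2 * delta * n.+1%:R.

Lemma hess_norm_ge0 x : 0 <= hess_norm x.
Proof.
rewrite addr_ge0//; last by rewrite !mulr_ge0// ltW.
by apply: sumr_ge0 => i _; exact: sumr_ge0.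
Qed.

Lemma hess_norm_lipschitz : exists2 L, 0 <= L &
  forall x y, `|hess_norm x - hess_norm y| <= L * `|x - y|.
Proof.
have h (q : 'I_n.+1 * 'I_n.+1) : exists L, forall x y,
    `|M q.1 q.2 x - M q.1 q.2 y| <= L * `|x - y|.
  exact: (moll_lipschitz eta0 bP (L1_d2u _ _)).
have [L LP] := choice h.
exists (\sum_i \sum_j `|L (i, j)|); first by apply: sumr_ge0 => i _; exact: sumr_ge0.
move=> x y; rewrite /hess_norm opprD addrACA subrr addr0 -sumrB mulr_suml.
rewrite (le_trans (ler_norm_sum _ _ _))// ler_sum// => i _; rewrite -sumrB mulr_suml.
rewrite (le_trans (ler_norm_sum _ _ _))// ler_sum// => j _.
rewrite (le_trans (ler_dist_dist _ _))// (le_trans (LP (i, j) x y))// ler_wpM2r//.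
exact: ler_norm.
Qed.

(** Mean value theorem on the segment from [x] to [y], which stays in the cube, and
    comparison of the second derivatives there with those at [x]. *)
Lemma xi_lipschitz L : 0 <= L -> (forall x y, `|hess_norm x - hess_norm y| <= L * `|x - y|) ->
  forall x y, `|x - xh| <= r -> `|y - xh| <= r ->
  `|\row_i xi i x - \row_i xi i y| <= `|x - y| * (hess_norm x + L * `|x - y|).
Proof.
move=> L0 LP x y xr yr.
have B0 : 0 <= `|x - y| * (hess_norm x + L * `|x - y|).
  by rewrite mulr_ge0// addr_ge0 ?hess_norm_ge0// mulr_ge0.
apply/rV_norm_leP => // i; rewrite !mxE.
pose v := y - x; pose k (s : R) := V i (x + s *: v).
have seg (s : R) : s \in `[0, 1] -> `|x + s *: v - xh| <= r /\ `|x - (x + s *: v)| <= `|x - y|.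
  rewrite in_itv/= => /andP[s_0 s_1]; split; last first.
    rewrite opprD addNKr normrN normrZ ger0_norm// distrC.
    by rewrite -[leRHS]mul1r ler_wpM2r.
  rewrite (_ : _ - xh = (1 - s) *: (x - xh) + s *: (y - xh)); last first.
    by apply/rowP => j; rewrite !mxE; ring.
  rewrite (le_trans (ler_normD _ _))// !normrZ !ger0_norm ?subr_ge0//.
  have -> : r = (1 - s) * r + s * r by ring.
  by rewrite lerD// ler_wpM2l// subr_ge0.
have dk (s : R) : s \in `[0, 1] -> is_derive s (1 : R) k (\sum_j v 0 j * M i j (x + s *: v)).
  by move=> /seg[sr _]; apply/is_derive_line_shift; exact: is_derive_V.
have [|s s01] := @MVT_segment R k _ 0 1 ler01 (fun s s01 => dk s (subset_itv_oo_cc s01)).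
  by apply: derivable_within_continuous => s /dk[].
rewrite /k scale1r scale0r addr0 subr0 mulr1 [x + v]addrC subrK => E.
have [_ sx] := seg _ s01; set w := x + s *: v in E sx.
have wB : hess_norm w <= hess_norm x + L * `|x - y|.
  have := LP w x; rewrite ler_distl => /andP[_ h]; apply: le_trans h _.
  by rewrite lerD2l ler_wpM2l// distrC.
apply: le_trans (_ : `|x - y| * hess_norm w <= _); last by rewrite ler_wpM2l.
rewrite /xi (_ : _ - _ = - (V i y - V i x) - 2 * delta * (x - y) 0 i); last first.
  by rewrite !mxE; ring.
rewrite (le_trans (ler_normB _ _))// normrN E /hess_norm mulrDr lerD//.
  rewrite (le_trans (ler_norm_sum _ _ _))// [X in _ <= _ * X](bigD1 i)//= mulrDr.
  rewrite -[leLHS]addr0 lerD//; last by rewrite mulr_ge0// sumr_ge0// => j _; exact: sumr_ge0.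
  rewrite mulr_sumr ler_sum// => j _; rewrite normrM ler_wpM2r// distrC.
  exact: rV_coord_le.
rewrite normrM ger0_norm ?mulr_ge0 ?(ltW de0)// mulrC ler_pM ?mulr_ge0 ?(ltW de0)//.
  exact: rV_coord_le.
by rewrite ler_peMr ?mulr_ge0 ?(ltW de0)// ler1n.
Qed.

(** The second derivatives of [U] are also the mollifications of the representatives
    [g]. *)
Lemma hess_norm_le x : `|x - xh| <= r -> hess_norm x <= moll b hess_majorant x.
Proof.
move=> xr; have xK := cube_eta_K xr.
have iabs i j : L1 (fun y => `|(g i j \_ K) y|) by apply: L1_norm; exact: L1_g.
rewrite /hess_majorant (mollD bP); last exact: L1_K; last first.
  by apply: L1_sum => i; exact: L1_sum.
rewrite lerD//; last first.
  rewrite (moll_cst eta0 bP (c := 2 * delta * n.+1%:R))// => y /xK Ky.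
  by rewrite indicE mem_set// mulr1.
rewrite moll_sum; last by move=> i; exact: L1_sum.
apply: ler_sum => i _; rewrite moll_sum//; apply: ler_sum => j _.
rewrite /M (moll_same_weak eta0 bP D_open KD (u_d2u i j) (u_g i j) xK).
by apply: (moll_norm_le eta0 bP); exact: L1_g.
Qed.

Let PP x := hess_majorant x ^+ n.+1.

(** The slope map sends the contact set onto the cube of slopes, so the area estimate
    applies. Jensen's inequality then brings the power inside the mollification, whose
    L1 distance to the original function is the second term. *)
Lemma contact_area :
  (((2 * s0) ^+ n.+1)%:E <= (2 ^+ n.+1)%:E *
     (\int[leb]_(x in contact_set) (PP x)%:E + (nrm (fun x => moll b PP x - PP x))%:E))%E.
Proof.
have [L L0 LP] := hess_norm_lipschitz.
have mE : measurable contact_set.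
  apply: measurable_closed_rV; apply: compact_closed (@norm_hausdorff _ _) _.
  exact: contact_set_compact.
rewrite -(lebesgue_rV_cube 0 (ltW s00)).
have sub_r x : contact_set x -> `|x - xh| <= r.
  by move=> [xr _ _]; rewrite (le_trans xr)// ler_pdivrMr// ler_pMr// ler1n.
have h := @area_estimate _ _ (fun x => \row_i xi i x) hess_norm contact_set (cube 0 s0) L L0
  hess_norm_ge0 LP (measurable_cube _ _).
apply: le_trans (h _ contact_set_compact _) _.
- by move=> z /contact_slopes[x Ex <-]; exists x.
- exists 1 => // x y /sub_r xr /sub_r yr _; exact: xi_lipschitz.
rewrite lee_pmul2l//.
have iPP : L1 PP := L1_hess_majorant_pow.
have imPP := L1_moll eta0 bP iPP.
have idiff : L1 (fun x => moll b PP x - PP x) by exact: L1B.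
have mPP := L1_measurable iPP.
have PP0 x : 0 <= PP x by rewrite exprn_ge0// hess_majorant_ge0.
apply: (@le_trans _ _ (\int[leb]_(x in contact_set) ((PP x)%:E + `|moll b PP x - PP x|%:E))%E).
  apply: ge0_le_integral => //.
  - by move=> x _; rewrite lee_fin exprn_ge0// hess_norm_ge0.
  - apply: (@measurable_funS _ _ _ _ setT) => //; apply/measurable_EFinP/measurable_funX.
    by apply: continuous_measurable_rV_R; exact: continuous_lipschitz LP.
  - apply: (@measurable_funS _ _ _ _ setT) => //; apply/measurable_EFinP/measurable_funD => //.
    by apply: measurableT_comp => //; exact: L1_measurable idiff.
  - move=> x /sub_r xr; rewrite -EFinD lee_fin.
    apply: (@le_trans _ _ (moll b PP x)); last first.
      by have := ler_norm (moll b PP x - PP x); rewrite lerBlDl.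
    apply: le_trans (_ : moll b hess_majorant x ^+ n.+1 <= _).
      rewrite lerXn2r ?nnegrE ?hess_norm_ge0//; last exact: hess_norm_le.
      by apply: le_trans (hess_norm_ge0 x) _; exact: hess_norm_le.
    apply: (moll_jensen eta0 bP) => //; first exact: L1_hess_majorant.
    exact: hess_majorant_ge0.
have m1 : measurable_fun contact_set (fun x => (PP x)%:E).
  by apply: (@measurable_funS _ _ _ _ setT) => //; exact/measurable_EFinP.
have m2 : measurable_fun contact_set (fun x => `|moll b PP x - PP x|%:E).
  apply: (@measurable_funS _ _ _ _ setT) => //; apply/measurable_EFinP/measurableT_comp => //.
  exact: L1_measurable idiff.
rewrite ge0_integralD//; last by move=> x _; rewrite lee_fin.
rewrite leeD2l// -nrmE//; apply: ge0_subset_integral => //.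
by apply/measurable_EFinP/measurableT_comp => //; exact: L1_measurable idiff.
Qed.

Definition approx_err x : R :=
  \sum_i `|V i x - (du i \_ K) x| + \sum_i \sum_j `|M i j x - (d2u i j \_ K) x|.

(** Where the mollified derivatives are [kap]-close to the given ones, the properties of
    the contact points of [U] pass to [u], [du] and [d2u]. *)
Lemma contact_almost kap x : contact_set x -> approx_err x < kap -> tau <= kap ->
  almost_contact kap x.
Proof.
move=> Ex ek tk; have [xr2 xs C] := Ex.
have xr : `|x - xh| <= r by rewrite (le_trans xr2)// ler_pdivrMr// ler_pMr// ler1n.
have Kx := cube_r_K xr.
have s1 : 0 <= \sum_i `|V i x - (du i \_ K) x| by exact: sumr_ge0.
have s2 : 0 <= \sum_i \sum_j `|M i j x - (d2u i j \_ K) x|.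
  by apply: sumr_ge0 => i _; exact: sumr_ge0.
have e1 i : `|V i x - du i x| <= kap.
  have : `|V i x - (du i \_ K) x| <= \sum_i `|V i x - (du i \_ K) x|.
    by rewrite [leRHS](bigD1 i)//= lerDl sumr_ge0.
  rewrite patch_in// => h; apply: le_trans h _; apply: le_trans _ (ltW ek).
  by rewrite /approx_err lerDl.
have e2 i j : `|M i j x - d2u i j x| <= kap.
  have : `|M i j x - (d2u i j \_ K) x| <= \sum_i \sum_j `|M i j x - (d2u i j \_ K) x|.
    rewrite [leRHS](bigD1 i)//= (bigD1 j)//= -addrA lerDl addr_ge0 ?sumr_ge0// => k _.
    exact: sumr_ge0.
  rewrite patch_in// => h; apply: le_trans h _; apply: le_trans _ (ltW ek).
  by rewrite /approx_err lerDr.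
split.
- move=> i; have := e1 i; have := xs i; rewrite /xi !ler_norml => /andP[a1 a2] /andP[a3 a4].
  by apply/andP; split; lra.
- move=> z zr; have := U_close zr; have := U_close xr; rewrite !ler_distl => /andP[_ h1] /andP[h2 _].
  have := C _ zr.
  have : - \sum_i (du i x - 2 * delta * (x - xh) 0 i) * (z - x) 0 i <=
      - \sum_i xi i x * (z - x) 0 i + kap * \sum_i `|(z - x) 0 i|.
    rewrite -!sumrN mulr_sumr -big_split/=; apply: ler_sum => i _; rewrite /xi.
    set w := (z - x) 0 i; have := e1 i => /(ler_wpM2r (normr_ge0 w)).
    rewrite -normrM => /(le_trans (ler_norm _)); lra.
  rewrite mulrDr; move: h1 h2 tk; set S := \sum_i xi i x * _.
  set S' := \sum_i (du i x - _) * _; set T := kap * \sum_i _.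
  move: (U x) (U z) (u x) (u z) S S' T (sqnorm _) (sqnorm _) => a1 a2 a3 a4 a5 a6 a7 a8 a9; lra.
- move=> v; have := contact_derivs Ex v.
  have : quad (fun i j => d2u i j x) (fun i => v 0 i) <=
      quad (fun i j => M i j x) (fun i => v 0 i) + kap * \sum_i \sum_j `|v 0 i| * `|v 0 j|.
    rewrite /quad mulr_sumr -big_split/=; apply: ler_sum => i _.
    rewrite mulr_sumr -big_split/=; apply: ler_sum => j _.
    have := e2 i j; rewrite distrC => /(ler_wpM2r (normr_ge0 (v 0 i * v 0 j))).
    rewrite -normrM => /(le_trans (ler_norm _)); rewrite normrM; lra.
  by move=> h1 h2; apply: le_trans h1 _; rewrite lerD2r.
- move=> i j; have := e2 i j; have := e2 j i.
  have -> : M j i x = M i j x.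
    exact: (moll_hessian_sym eta0 bP _ _ D_open KD u_d2u (cube_eta_K xr)).
  by rewrite !ler_distl => /andP[a1 a2] /andP[a3 a4]; apply/andP; split; lra.
Qed.

(** Markov's inequality. *)
Lemma approx_err_measure (kap e1 : R) : 0 < kap ->
  (forall i, nrm (fun x => V i x - (du i \_ K) x) <= e1) ->
  (forall i j, nrm (fun x => M i j x - (d2u i j \_ K) x) <= e1) ->
  measurable [set x | kap <= approx_err x] /\
  (leb [set x | (kap <= approx_err x)%R] <= ((n.+1%:R * e1 + n.+1%:R * (n.+1%:R * e1)) / kap)%:E)%E.
Proof.
move=> kap0 h1 h2.
have i1 i : L1 (fun x => V i x - (du i \_ K) x).
  by apply: L1B; [apply: (L1_moll eta0 bP); exact: L1_du|exact: L1_du].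
have i2 i j : L1 (fun x => M i j x - (d2u i j \_ K) x).
  by apply: L1B; [apply: (L1_moll eta0 bP); exact: L1_d2u|exact: L1_d2u].
have i3 : L1 (fun x => \sum_i `|V i x - (du i \_ K) x|) by apply: L1_sum => i; exact: L1_norm.
have i4 i : L1 (fun x => \sum_j `|M i j x - (d2u i j \_ K) x|).
  by apply: L1_sum => j; exact: L1_norm.
have i5 : L1 (fun x => \sum_i \sum_j `|M i j x - (d2u i j \_ K) x|) by exact: L1_sum.
have ie : L1 approx_err by exact: L1D.
have merr := L1_measurable ie.
have e0 x : 0 <= approx_err x.
  by rewrite addr_ge0// ?sumr_ge0// => i _; exact: sumr_ge0.
have setE : [set x | kap <= approx_err x] =
    setT `&` [set x | (kap%:E <= `|(EFin \o approx_err) x|)%E].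
  by rewrite setTI; apply/seteqP; split => x /=; rewrite lee_fin ger0_norm.
split.
  rewrite (_ : [set x | _] = approx_err @^-1` `[kap, +oo[%classic).
    by rewrite -[X in measurable X]setTI; apply: merr.
  by apply/seteqP; split => x /=; rewrite in_itv/= andbT.
have := @le_integral_abse _ _ _ leb setT measurableT (EFin \o approx_err) kap _ kap0.
have mE : measurable_fun setT (EFin \o approx_err) by exact/measurable_EFinP.
rewrite -setE => /(_ mE) h.
rewrite EFinM lee_pdivlMr// muleC; apply: le_trans h _.
rewrite (_ : (\int[leb]_(x in setT) _)%E = (nrm approx_err)%:E); last by rewrite -nrmE.
rewrite lee_fin /approx_err.
apply: le_trans (ler_nrmD i3 i5) _; rewrite lerD//; first exact: nrm_sum_le.
have i6 : L1 (fun x => \sum_i `| \sum_j `|M i j x - (d2u i j \_ K) x| |).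
  by apply: L1_sum => i; exact: (L1_norm (i4 i)).
apply: le_trans (_ : nrm (fun x => \sum_i `| \sum_j `|M i j x - (d2u i j \_ K) x| |) <= _).
  apply: nrm_le => //; first exact: (L1_norm i6).
  move=> x; rewrite ger0_norm; last by apply: sumr_ge0 => i _; exact: sumr_ge0.
  by apply: le_trans (ler_norm _); apply: ler_sum => i _; exact: ler_norm.
by apply: nrm_sum_le => // i; exact: nrm_sum_le.
Qed.

End fixed_kernel.

(** A radius small enough for the modulus of continuity of [u] and for the L1
    convergence of the derivatives and of the power of the majorant. The set [B]
    contains the points where the mollified derivatives are not yet close to the given
    ones. *)
Lemma contact_at_scale kap kap2 : 0 < kap -> 0 < kap2 -> exists E B : set 'rV[R]_n.+1,
  [/\ compact E /\ E `<=` cube xh (r / 2), measurable B /\ (leb B <= kap2%:E)%E,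
    (((2 * s0) ^+ n.+1)%:E <= (2 ^+ n.+1)%:E *
       (\int[leb]_(x in E) (hess_majorant x ^+ n.+1)%:E + kap%:E))%E &
    forall x, E x -> ~ B x -> almost_contact kap x].
Proof.
move=> kap0 kap20.
pose N := n.+1%:R : R.
have N0 : 0 < N by rewrite ltr0n.
have NN0 : 0 < N + N * N by rewrite addr_gt0// mulr_gt0.
(* the [N + N * N] derivatives of order 1 and 2 then have a total L1 error of [kap2 * kap] *)
pose e1 := kap2 * kap / (N + N * N).
have e10 : 0 < e1 by rewrite divr_gt0// mulr_gt0.
(* [16] is what the condition [tau_small] of the contact sets asks for *)
pose tau := Num.min kap (delta * r ^+ 2 / 16).
have tau0 : 0 < tau by rewrite lt_min kap0 divr_gt0// mulr_gt0// exprn_gt0.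
have tauk : tau <= kap by rewrite ge_min lexx.
have tau2 : 2 * tau <= delta * r ^+ 2 / 8.
  have : tau <= delta * r ^+ 2 / 16 by rewrite ge_min lexx orbT.
  lra.
have [eta1 eta10 h1] := unif_continuous_cube xh r u_cont tau0.
have zK (f : 'rV[R]_n.+1 -> R) x : ~ cube xh (2 * r) x -> (f \_ K) x = 0 by exact: patch_out.
have [eta2 eta20 h2] := moll_cvg_family (fun i => moll_cvg_L1 (L1_du i) (zK (du i))) e10.
have [eta3 eta30 h3] := moll_cvg_family
  (fun q : 'I_n.+1 * 'I_n.+1 => moll_cvg_L1 (L1_d2u q.1 q.2) (zK (d2u q.1 q.2))) e10.
have zP x : ~ cube xh (2 * r) x -> hess_majorant x ^+ n.+1 = 0.
  move=> Kx; rewrite /hess_majorant indicE memNset// mulr0 addr0 big1 ?expr0n// => i _.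
  by rewrite big1// => j _; rewrite zK// normr0.
have [eta4 eta40 h4] := moll_cvg_L1 L1_hess_majorant_pow zP kap0.
pose eta := Num.min (Num.min eta1 eta2) (Num.min (Num.min eta3 eta4) r).
have eta0 : 0 < eta by rewrite !lt_min eta10 eta20 eta30 eta40 r0.
have [l1 l2 l3 l4 l5] : [/\ eta <= eta1, eta <= eta2, eta <= eta3, eta <= eta4 & eta <= r].
  by split; rewrite !ge_min lexx ?orbT.
have [b bP] := bump_family_exists eta0.
have tauP x : cube xh r x -> forall y, `|y - x| <= eta -> `|u y - u x| <= tau.
  by move=> xr y yx; apply: h1 => //; exact: le_trans yx l1.
have [mB Bk] := approx_err_measure eta0 bP kap0 (h2 _ _ eta0 l2 bP)
   (fun i j => h3 _ _ eta0 l3 bP (i, j)).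
exists (contact_set b), [set x | kap <= approx_err b x]; split.
- split; last by move=> x [].
  exact: (contact_set_compact eta0 bP).
- split => //; apply: le_trans Bk _; rewrite lee_fin ler_pdivrMr//.
  by rewrite mulrA -mulrDl mulrC divfK// gt_eqF.
- apply: le_trans (contact_area eta0 bP l5 tau2 tauP) _; rewrite lee_pmul2l// leeD2l// lee_fin.
  exact: (h4 _ _ eta0 l4 bP).
- move=> x Ex /negP; rewrite -ltNge => ex.
  exact: (contact_almost eta0 bP l5 tauP).
Qed.

End scale.

(** * Exact contact points of the limit function *)

Section limit.
Context {R : realType} {n : nat}.
Local Notation leb := (@lebesgue_rV R n.+1).
Variables (D : set 'rV[R]_n.+1) (xh : 'rV[R]_n.+1) (delta r s0 p : R).
Variables (u : 'rV[R]_n.+1 -> R) (du : 'I_n.+1 -> 'rV[R]_n.+1 -> R).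
Variables (d2u g : 'I_n.+1 -> 'I_n.+1 -> 'rV[R]_n.+1 -> R).

Lemma almost_contact_lim x :
  (forall m, exists2 k, (m <= k)%N &
     almost_contact xh delta r s0 u du d2u k.+1%:R^-1 x) ->
  almost_contact xh delta r s0 u du d2u 0 x.
Proof.
move=> h; split.
- move=> i; rewrite addr0; apply: (@le_of_frequently _ _ _ 1) => // m.
  by have [k mk [h1 _ _ _]] := h m; exists k => //; rewrite mul1r.
- move=> z zr; rewrite mul0r addr0.
  apply: (@le_of_frequently _ _ _ (2 + \sum_i `|(z - x) 0 i|)).
    by rewrite addr_ge0// sumr_ge0.
  move=> m; have [k mk [_ h2 _ _]] := h m; exists k => //.
  by rewrite [_ / k.+1%:R]mulrC; exact: h2.
- move=> v; rewrite mul0r addr0.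
  apply: (@le_of_frequently _ _ _ (\sum_i \sum_j `|v 0 i| * `|v 0 j|)).
    by apply: sumr_ge0 => i _; apply: sumr_ge0 => j _; rewrite mulr_ge0.
  move=> m; have [k mk [_ _ h3 _]] := h m; exists k => //.
  by rewrite [_ / k.+1%:R]mulrC; exact: h3.
- move=> i j; rewrite mulr0; apply: (@le_of_frequently _ _ _ 2) => // m.
  by have [k mk [_ _ _ h4]] := h m; exists k => //; rewrite add0r.
Qed.

Hypothesis D_open : open D.
Hypothesis KD : cube xh (2 * r) `<=` D.
Hypothesis de0 : 0 < delta.
Hypothesis r0 : 0 < r.
Hypothesis s00 : 0 < s0.
Hypothesis ds : n.+1%:R * s0 <= delta * r / 8.
Hypothesis u_cont : continuous u.
Hypothesis umax : forall x, D x -> u x <= u xh.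
Hypothesis u_du : forall i, weak_derivative D [:: i] u (du i).
Hypothesis u_d2u : forall i j, weak_derivative D [:: i; j] u (d2u i j).
Hypothesis u_g : forall i j, weak_derivative D [:: i; j] u (g i j).
Hypothesis gLp : forall i j, locLp D p (g i j).
Hypothesis hp : n.+1%:R <= p.

(** With [kap = 1 / k.+1], the sets [E k] carry a mass of the majorant that stays close
    to [s0 ^+ n.+1] or above, so their upper limit is not null, by dominated
    convergence. The measures of the sets [B k] are summable, so their upper limit is
    null. The other points of the upper limit of the [E k] are contact points up to
    arbitrarily small errors. *)
Lemma contact_not_negligible (Z : set 'rV[R]_n.+1) : leb.-negligible Z ->
  exists x, [/\ ~ Z x, `|x - xh| <= r / 2 & almost_contact xh delta r s0 u du d2u 0 x].
Proof.
move=> Z0.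
pose PP x := hess_majorant xh delta r g x ^+ n.+1.
have iPP : L1 PP := L1_hess_majorant_pow D_open KD de0 u_g gLp hp.
have PP0 x : 0 <= PP x by rewrite exprn_ge0// hess_majorant_ge0.
have mPP : measurable_fun setT (fun x => (PP x)%:E).
  by apply/measurable_EFinP; exact: L1_measurable.
(* the measures [1 / 2 ^+ k.+1] are summable *)
have /choice[EB EBP] : forall k : nat, exists EB : set 'rV[R]_n.+1 * set 'rV[R]_n.+1,
    [/\ compact EB.1 /\ EB.1 `<=` cube xh (r / 2),
      measurable EB.2 /\ (leb EB.2 <= (1 / 2 ^+ k.+1)%:E)%E,
      (((2 * s0) ^+ n.+1)%:E <= (2 ^+ n.+1)%:E *
         (\int[leb]_(x in EB.1) (PP x)%:E + k.+1%:R^-1%:E))%E &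
      forall x, EB.1 x -> ~ EB.2 x -> almost_contact xh delta r s0 u du d2u k.+1%:R^-1 x].
  move=> k; have k1 : 0 < k.+1%:R^-1 :> R by rewrite invr_gt0.
  have k2 : 0 < 1 / 2 ^+ k.+1 :> R by rewrite divr_gt0// exprn_gt0.
  have [E [B EB]] := contact_at_scale D_open KD de0 r0 s00 ds u_cont umax u_du u_d2u u_g gLp hp k1 k2.
  by exists (E, B).
pose E k := (EB k).1; pose B k := (EB k).2.
have mE k : measurable (E k).
  apply: measurable_closed_rV; apply: compact_closed (@norm_hausdorff _ _) _.
  by have [[]] := EBP k.
have mB k : measurable (B k) by have [_ []] := EBP k.
have mT (F : (set 'rV[R]_n.+1)^nat) k : (forall j, measurable (F j)) ->
    measurable (\bigcup_(j in [set j | (k <= j)%N]) F j).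
  by move=> mF; apply: bigcup_measurable => j _; exact: mF.
have B0 : leb (lim_sup_set B) = 0%E.
  apply: lim_sup_set_cvg0 => //; apply: (@le_lt_trans _ _ 1%:E); last exact: ltry.
  apply: le_trans (epsilon_trick0 xpredT ler01).
  apply: lee_nneseries => // k _; have [_ [_ h] _ _] := EBP k.
  by rewrite natrX.
have [h|hN] := pselect (exists x, [/\ ~ Z x, lim_sup_set E x & ~ lim_sup_set B x]).
  have [x [Zx Ex Bx]] := h; exists x.
  have {Bx}[m Bx] : exists m, forall k, (m <= k)%N -> ~ B k x.
    apply: contrapT => hB; apply: Bx => m _; apply: contrapT => hm; apply: hB.
    by exists m => k mk Bkx; apply: hm; exists k.
  split => //.
    by have [k _ Ekx] := Ex 0%N I; have [[_ h1] _ _ _] := EBP k; exact: h1 Ekx.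
  apply: almost_contact_lim => m'.
  have [k /= mk Ekx] := Ex (maxn m m') I; exists k.
    exact: leq_trans (leq_maxr _ _) mk.
  have [_ _ _] := EBP k; apply => //; apply: Bx.
  exact: leq_trans (leq_maxl _ _) mk.
exfalso.
have mLE : measurable (lim_sup_set E) by apply: bigcap_measurable => // k _; exact: mT.
have E0 : leb (lim_sup_set E) = 0%E.
  apply/negligibleP => //.
  have : leb.-negligible (Z `|` lim_sup_set B).
    apply: negligibleU => //; exists (lim_sup_set B); split => //.
    by apply: bigcap_measurable => // k _; exact: mT.
  apply: negligibleS => x Ex.
  have [|Zx] := pselect (Z x); first by left.
  by right; apply: contrapT => Bx; apply: hN; exists x.
pose U k := \bigcup_(j in [set j | (k <= j)%N]) E j.
have mU k : measurable (U k) by exact: mT.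
have cvgU : (\int[leb]_x (((fun x => (PP x)%:E) \_ (U k)) x) @[k --> \oo] -->
    \int[leb]_x (((fun x => (PP x)%:E) \_ (lim_sup_set E)) x))%E.
  apply: (@dominated_cvg _ _ _ _ _ measurableT _ _ (fun x => (PP x)%:E)) => //.
  - by move=> k; apply/(measurable_restrictT _ (mU k)); exact: measurable_funTS.
  - move=> x _; have [Ex|Ex] := pselect (lim_sup_set E x).
      apply: cvg_near_cst; apply: nearW => k.
      by rewrite /patch !mem_set//; exact: Ex.
    have [m Em] : exists m, ~ U m x.
      by apply: contrapT => hm; apply: Ex => m _; apply: contrapT => mx; apply: hm; exists m.
    apply: cvg_near_cst; exists m => // k /= mk.
    rewrite /patch !memNset// => -[j /= kj Ej]; apply: Em; exists j => //=.
    exact: leq_trans mk kj.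
  - by move=> k x _; rewrite /patch; case: ifP => _; rewrite ?abse0 ?lee_fin//= ger0_norm.
have z0 : (\int[leb]_x (((fun x => (PP x)%:E) \_ (lim_sup_set E)) x) = 0)%E.
  by rewrite -(integral_mkcond (mu := leb)); apply: null_set_integral => //; exact: measurable_funTS.
rewrite z0 in cvgU.
have c0 : 0 < s0 ^+ n.+1 / 2 by rewrite divr_gt0// exprn_gt0.
have [m1 _ h1] : \forall k \near \oo,
    (\int[leb]_x (((fun x => (PP x)%:E) \_ (U k)) x) < (s0 ^+ n.+1 / 2)%:E)%E.
  by apply: (cvgU [set y | (y < (s0 ^+ n.+1 / 2)%:E)%E]); exact: lt_nbhsl.
have [m2 _ h2] := near_infty_natSinv_lt (PosNum c0).
pose k := maxn m1 m2.
have := h2 k (leq_maxr _ _) => /= h2k.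
have h1k : (\int[leb]_(x in U k) (PP x)%:E < (s0 ^+ n.+1 / 2)%:E)%E.
  by rewrite integral_mkcond; exact: h1 k (leq_maxl _ _).
have [_ _ area _] := EBP k; move: area.
rewrite exprMn EFinM lee_pmul2l ?lte_fin ?exprn_gt0//.
rewrite leNgt => /negP; apply.
rewrite [X in (_ < X%:E)%E]splitr EFinD; apply: lteD; last by rewrite lte_fin.
apply: le_lt_trans h1k; apply: ge0_subset_integral => //.
- exact: mE.
- exact: measurable_funTS.
- by move=> x _; rewrite lee_fin.
- by move=> x Ex; exists k => /=.
Qed.
End limit.

(** * The operator at a contact point *)

Lemma bounded_familyP {R : realType} {d : nat} (I : finType) (f : I -> 'rV[R]_d -> R) :
  (forall i, bounded_fun (f i)) -> exists2 M, 0 <= M & forall i x, `|f i x| <= M.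
Proof.
move=> bf; have /choice[M MP] i : exists M, 0 < M /\ forall x, `|f i x| < M.
  by have [M M0 h] := ex_strict_bound_gt0 (bf i); exists M; split => // x; exact: h.
exists (\sum_i M i); first by apply: sumr_ge0 => i _; exact/ltW/(MP i).1.
move=> i x; rewrite (bigD1 i)//=; apply: le_trans (ltW ((MP i).2 x)) _.
by rewrite lerDl sumr_ge0// => j _; exact/ltW/(MP j).1.
Qed.

Section operator.
Context {R : realType} {n : nat}.
Local Notation leb := (@lebesgue_rV R n.+1).
Variables (q : 'I_n.+1 -> 'I_n.+1 -> 'rV[R]_n.+1 -> R) (b : 'I_n.+1 -> 'rV[R]_n.+1 -> R).
Variable N : R.-sigmafker 'rV[R]_n.+1 ~> 'rV[R]_n.+1.
Variables (D : set 'rV[R]_n.+1) (xh : 'rV[R]_n.+1) (delta r s0 : R).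
Variables (u : 'rV[R]_n.+1 -> R) (du : 'I_n.+1 -> 'rV[R]_n.+1 -> R).
Variables (d2u : 'I_n.+1 -> 'I_n.+1 -> 'rV[R]_n.+1 -> R).
Variables (x : 'rV[R]_n.+1) (Q B M : R).
Hypothesis de0 : 0 < delta.
Hypothesis r0 : 0 < r.
Hypothesis r1 : r <= 1.
Hypothesis s00 : 0 < s0.
Hypothesis ds : n.+1%:R * s0 <= delta * r / 8.
Hypothesis xr : `|x - xh| <= r / 2.
Hypothesis C : almost_contact xh delta r s0 u du d2u 0 x.

(** The second order term is controlled by the trace inequality for [q] and [2 * delta *
    1 - d2u], and the gradient is at most [s0 + delta <= 2 * delta]. *)
Lemma opL_le : (forall y : 'rV[R]_n.+1, 0 <= quad (fun i j => q i j x) (fun i => y 0 i)) ->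
  (forall i j, `|q i j x| <= Q) -> (forall i, `|b i x| <= B) ->
  opL q b du d2u x <= (n.+1%:R * Q + n.+1%:R * B * 2) * delta.
Proof.
move=> q0 qQ bB; have [C1 _ C3 C4] := C.
have sym i j : d2u i j x = d2u j i x.
  by apply/eqP; rewrite -subr_eq0 -normr_le0; have := C4 i j; rewrite mulr0.
have quad_row (P : 'I_n.+1 -> 'I_n.+1 -> R) (y : 'I_n.+1 -> R) :
    quad P y = quad P (fun i => (\row_j y j) 0 i).
  by apply: eq_bigr => i _; apply: eq_bigr => j _; rewrite !mxE.
rewrite /opL mulrDl; apply: lerD.
- have h : 0 <= \sum_i \sum_j q i j x * (2 * delta * (i == j)%:R - d2u i j x).
    apply: trace_mul_ge0.
    + by move=> y; rewrite (quad_row (fun i j => q i j x)).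
    + by move=> i j; rewrite eq_sym sym.
    + move=> y; rewrite quad_row; set v := \row_j _.
      have := C3 v; rewrite mul0r addr0 -subr_ge0; congr (0 <= _).
      rewrite /sqnorm mulr_sumr -sumrB; apply: eq_bigr => i _.
      under [RHS]eq_bigr do rewrite !mulrBl.
      rewrite sumrB; congr (_ - _); rewrite -(sum_delta (fun j => 2 * delta * v 0 j ^+ 2) i).
      apply: eq_bigr => j _; rewrite [j == i]eq_sym.
      by case: eqP => [->|_]; rewrite !(mulr1, mulr0, mul0r) ?expr2 ?mulrA.
  have E : \sum_i \sum_j q i j x * (2 * delta * (i == j)%:R - d2u i j x) =
      2 * delta * (\sum_i q i i x) - \sum_i \sum_j q i j x * d2u i j x.
    rewrite mulr_sumr -sumrB; apply: eq_bigr => i _.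
    under eq_bigr do rewrite mulrBr.
    rewrite sumrB; congr (_ - _); rewrite -(sum_delta (fun j => 2 * delta * q i j x) i).
    by apply: eq_bigr => j _; rewrite [j == i]eq_sym; ring.
  have T : \sum_i q i i x <= n.+1%:R * Q.
    rewrite -[n.+1 in leRHS]card_ord mulr_natl -sumr_const; apply: ler_sum => i _.
    exact: le_trans (ler_norm _) (qQ i i).
  have {}T := ler_wpM2l (ltW de0) T.
  by move: h; rewrite E; lra.
- rewrite -!mulrA -[n.+1 in leRHS]card_ord mulr_natl -sumr_const; apply: ler_sum => i _.
  apply: le_trans (ler_norm _) _; rewrite normrM; apply: ler_pM => //.
  have := C1 i; rewrite addr0 => h.
  have s1 : s0 <= delta / 8.
    apply: (@le_trans _ _ (n.+1%:R * s0)); first by rewrite ler_peMl ?ler1n// ltW.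
    by apply: le_trans ds _; rewrite ler_pdivrMr// divfK// ler_piMr// ltW.
  have xi : `|2 * delta * (x - xh) 0 i| <= delta.
    rewrite normrM gtr0_norm ?mulr_gt0//.
    have := le_trans (rV_coord_le (x - xh) i) xr.
    move=> /(ler_wpM2l (ltW de0)); have := r1 => /(ler_wpM2l (ltW de0)) k1 k2; lra.
  have := ler_normD (du i x - 2 * delta * (x - xh) 0 i) (2 * delta * (x - xh) 0 i).
  rewrite subrK => k; apply: le_trans (le_trans k (lerD h xi)) _.
  have a1 (a c : R) : 0 < c -> a <= c / 8 -> a + c <= 2 * c by move=> ? ?; lra.
  exact: a1.
Qed.

Lemma opS_le : (forall y, measure_support (N x) y -> u (x + y) <= u xh) ->
  continuous u -> 
  (\int[N x]_y (Num.min 1 (enorm y ^+ 2))%:E <= M%:E)%E ->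
  (opS N u du x <= (9 * n.+1%:R * M * delta)%:E)%E.
Proof.
move=> uN cu NM; have [C1 C2 _ _] := C.
have [mS S0] := measure_support_setC (N x).
have sq_cont : continuous (fun y : 'rV[R]_n.+1 => enorm y ^+ 2).
  under eq_fun do rewrite enorm_sqr -[X in sqnorm X]subr0.
  exact: continuous_sqnorm_sub.
have mf : measurable_fun setT (fun y => u (x + y) - u x
    - \sum_i y 0 i * du i x / (1 + enorm y ^+ 2)).
  apply: continuous_measurable_rV_R; apply: continuous_sub.
    apply: continuous_sub; last exact: cst_continuous.
    move=> y; apply: (@continuous_comp _ _ _ (fun y => x + y) u); last exact: cu.
    by apply: continuousD; [exact: cst_continuous|exact: cvg_id].
  apply: continuous_sum => i; apply: continuous_mul.
    by apply: continuous_mul; [exact: coord_continuous|exact: cst_continuous].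
  move=> y; apply: (@continuousV _ _ (fun y : 'rV[R]_n.+1 => 1 + enorm y ^+ 2)).
    by rewrite gt_eqF// ltr_pwDl// sqr_ge0.
  have : continuous (fun y : 'rV[R]_n.+1 => 1 + enorm y ^+ 2); last exact.
  by apply: continuous_add => //; exact: cst_continuous.
have mg : measurable_fun setT (fun y : 'rV[R]_n.+1 => Num.min 1 (enorm y ^+ 2)).
  by apply: measurable_minr => //; exact: continuous_measurable_rV_R.
have c0 : 0 <= 9 * n.+1%:R * delta by rewrite !mulr_ge0// ltW.
have m0 (y : 'rV[R]_n.+1) : 0 <= Num.min 1 (enorm y ^+ 2) by rewrite le_min ler01 sqr_ge0.
apply: (le_trans (@integral_le_almost _ _ _ _ _
  (fun y => 9 * n.+1%:R * delta * Num.min 1 (enorm y ^+ 2)) mS S0 mf _ _ _)).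
- by apply: measurable_funM.
- by move=> y; rewrite mulr_ge0.
- move=> y /uN uy; apply: (jump_pointwise _ de0 r0 r1 (ltW s00) ds xr) => //.
  + by move=> i; have := C1 i; rewrite addr0.
  + by move=> z zr; have := C2 z zr; rewrite mul0r addr0.
under eq_integral do rewrite EFinM.
rewrite ge0_integralZl//.
- rewrite (_ : 9 * n.+1%:R * M * delta = 9 * n.+1%:R * delta * M); last by ring.
  by rewrite [X in (_ <= X)%E]EFinM lee_wpmul2l.
- exact/measurable_EFinP.
- by move=> y _; rewrite lee_fin.
Qed.
End operator.

Lemma enorm_le {R : realType} {d : nat} (y : 'rV[R]_d) : (0 < d)%N -> enorm y <= d%:R * `|y|.
Proof.
move=> d0; have d1 : 1 <= d%:R :> R by rewrite ler1n.
rewrite -ler_sqr ?nnegrE ?sqrtr_ge0 ?mulr_ge0//.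
rewrite enorm_sqr (le_trans (sqnorm_le y))// exprMn ler_wpM2r ?sqr_ge0//.
by rewrite expr2 ler_peMr// (le_trans ler01).
Qed.

Theorem theorem3p3 (R : realType) (d : nat) (hd : (0 < d)%N)
  (q : 'I_d -> 'I_d -> 'rV[R]_d -> R) (b : 'I_d -> 'rV[R]_d -> R)
  (N : R.-sigmafker 'rV[R]_d ~> 'rV[R]_d)
  (q_measurable : forall i j, measurable_fun setT (q i j))
  (q_bounded : forall i j, bounded_fun (q i j))
  (b_measurable : forall i, measurable_fun setT (b i))
  (b_bounded : forall i, bounded_fun (b i))
  (q_elliptic : forall K : set 'rV[R]_d, compact K ->
    exists2 gamma : R, 0 < gamma & forall x, K x -> forall xi : 'rV[R]_d,
      gamma * enorm xi ^+ 2 <= \sum_i \sum_j q i j x * xi 0 i * xi 0 j)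
  (N_levy : (ereal_sup [set \int[N x]_y (Num.min 1 (enorm y ^+ 2))%:E | x in setT]
     < +oo)%E)
  (D : set 'rV[R]_d) (D_open : open D)
  (jump_D : jump_range N D `<=` closure D)
  (p : R) (hp : d%:R < p)
  (u : 'rV[R]_d -> R) (u_sobolev : sobolev_loc D 2 p u)
  (u_continuous : continuous u) (u_bounded : bounded_fun u)
  (du : 'I_d -> 'rV[R]_d -> R) (d2u : 'I_d -> 'I_d -> 'rV[R]_d -> R)
  (u_du : forall i, weak_derivative D [:: i] u (du i))
  (u_d2u : forall i j, weak_derivative D [:: i; j] u (d2u i j))
  (xhat : 'rV[R]_d) (xhat_D : D xhat)
  (xhat_max : forall x, D x -> u x <= u xhat) :
  (ess_liminf (opA q b N u du d2u) xhat <= 0)%E.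
Proof.
destruct d as [|n]; first by [].
have /choice[g gP] : forall ij : 'I_n.+1 * 'I_n.+1, exists g,
    locLp D p g /\ weak_derivative D [:: ij.1; ij.2] u g.
  by move=> [i j]; have [_ /(_ [:: i; j] isT)[g]] := u_sobolev; exists g.
have [Q Q0 QP] := bounded_familyP (fun ij : 'I_n.+1 * 'I_n.+1 => q_bounded ij.1 ij.2).
have [B B0 BP] := bounded_familyP b_bounded.
have [M M0 MP] : exists2 M : R, 0 <= M & forall x,
    (\int[N x]_y (Num.min 1 (enorm y ^+ 2))%:E <= M%:E)%E.
  set S := ereal_sup _ in N_levy.
  have SP x : (\int[N x]_y (Num.min 1 (enorm y ^+ 2))%:E <= S)%E.
    by apply: ereal_sup_ubound; exists x.
  have S0 : (0 <= S)%E.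
    apply: le_trans (SP 0); apply: integral_ge0 => y _.
    by rewrite lee_fin le_min ler01 sqr_ge0.
  have Sf : S \is a fin_num by rewrite ge0_fin_numE.
  exists (fine S); first exact: fine_ge0.
  by move=> x; rewrite fineK.
rewrite ess_liminfE; apply: ge_ereal_sup => _ [rr rr0 <-].
move: rr0; rewrite /= in_itv/= andbT => rr0.
apply/lee_addgt0Pr => eps eps0; rewrite add0e leNgt; apply/negP => /ltW /ess_infP hess.
pose NN := n.+1%:R : R.
have NN0 : 0 < NN by rewrite ltr0n.
have /nbhs_ballP[e /= e0 eD] : nbhs xhat D by exact: open_nbhs_nbhs.
(* the cube of radius [2 * r] is in [D], the one of radius [r / 2] in the Euclidean ball *)
pose r := Num.min 1 (Num.min (e / 4) (rr / NN)).
have r0 : 0 < r by rewrite !lt_min ltr01 !divr_gt0.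
have r1 : r <= 1 by rewrite ge_min lexx.
have re : r <= e / 4 by rewrite !ge_min lexx orbT.
have rN : r <= rr / NN by rewrite !ge_min lexx !orbT.
have KD : cube xhat (2 * r) `<=` D.
  move=> x xr; apply: eD; rewrite -ball_normE /= distrC.
  by apply: le_lt_trans xr _; lra.
(* at a contact point, [Au] is at most [C * delta] by [opL_le] and [opS_le] *)
pose C := NN * Q + NN * B * 2 + 9 * NN * M.
have C0 : 0 <= C by rewrite !addr_ge0// !mulr_ge0// ltW.
pose delta := eps / (2 * (C + 1)).
have de0 : 0 < delta by rewrite divr_gt0// mulr_gt0// ltr_wpDl.
have Cd : C * delta < eps.
  rewrite /delta mulrA ltr_pdivrMr ?mulr_gt0 ?ltr_wpDl// mulrC ltr_pM2l//; lra.
pose s0 := delta * r / (8 * NN).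
have s00 : 0 < s0 by rewrite divr_gt0 // mulr_gt0 //.
have ds : n.+1%:R * s0 <= delta * r / 8.
  by rewrite (_ : n.+1%:R * s0 = delta * r / 8)// /s0 -/NN; field; rewrite gt_eqF.
have [x [Zx xr ex]] := contact_not_negligible D_open KD de0 r0 s00 ds u_continuous xhat_max
  u_du u_d2u (fun i j => (gP (i, j)).2) (fun i j => (gP (i, j)).1) (ltW hp) hess.
have {Zx} := contrapT Zx => /=; rewrite /patch mem_set; last first.
  rewrite /eball /=; apply: le_lt_trans (enorm_le _ _) _ => //.
  have : NN * `|x - xhat| <= NN * (rr / NN / 2).
    by rewrite ler_wpM2l ?(ltW NN0)//; apply: le_trans xr _; rewrite ler_pM2r// invr_gt0.
  move=> h; apply: le_lt_trans h _; rewrite mulrA mulrCA divff ?gt_eqF// mulr1; lra.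
rewrite leNgt => /negP; apply; apply: (@le_lt_trans _ _ (C * delta)%:E); last by [].
have Dx : D x by apply: KD; rewrite /cube/=; apply: le_trans xr _; lra.
have L := opL_le (q := q) (b := b) (Q := Q) (B := B) de0 r1 s00 ds xr ex.
have S := opS_le (N := N) (M := M) de0 r0 r1 s00 ds xr ex.
rewrite (_ : C * delta = (n.+1%:R * Q + n.+1%:R * B * 2) * delta + 9 * n.+1%:R * M * delta);
  last by rewrite -mulrDl.
rewrite EFinD; apply: leeD; [rewrite lee_fin; apply: L|apply: S] => //.
- move=> y; have [gam gam0 gamP] := q_elliptic [set x] (@compact_set1 _ x).
  apply: le_trans (gamP x erefl y); rewrite mulr_ge0 ?sqr_ge0 ?(ltW gam0)//.
- by move=> i j; exact: QP (i, j) x.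
- move=> y yS; have : closure D (x + y) by apply: jump_D; exists x => //; exists y.
  have cl : closed [set z | u z <= u xhat].
    by apply: closed_le_fun => //; exact: cst_continuous.
  by rewrite closure_id in cl; move/(closure_subset (fun z => @xhat_max z)); rewrite -cl.
Qed.
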